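(* Let $0<c<d$, $p,q:[c,d]\to[0,\infty)$ bounded measurable, and $B_1,B_2:\mathbb R\times C([c,d])\to\mathbb R$. Consider problem (PP): $V''(x)+H(x,V(x),V'(x))=0$ for a.e. $x\in[c,d]$, $B_1(V(c),V)=0$, $B_2(V(d),V)=0$. Assume there exist a lower solution $\alpha$ and an upper solution $\beta$ of (PP) with $\alpha(x)\le\beta(x)$ for all $x\in[c,d]$. Let $[\alpha,\beta]=\{\gamma\in AC([c,d]):\alpha\le\gamma\le\beta\}$ and $E=[\min_{[c,d]}\alpha,\max_{[c,d]}\beta]$, and assume: (H1) for all $\gamma\in[\alpha,\beta]$, all $y\in E$ and $i=1,2$: $\liminf_{z\to y^-}B_i(z,\gamma)\ge B_i(y,\gamma)\ge\limsup_{z\to y^+}B_i(z,\gamma)$; (H2) for all $y\in E$ and $i=1,2$, $B_i(y,\cdot)$ is nonincreasing on $[\alpha,\beta]$: if $\gamma_1,\gamma_2\in[\alpha,\beta]$ and $\gamma_1\le\gamma_2$ on $[c,d]$, then $B_i(y,\gamma_1)\ge B_i(y,\gamma_2)$. Then (PP) has extremal convex solutions in $[\alpha,\beta]$: there exist convex solutions $V_*,V^*\in[\alpha,\beta]$ of (PP) such that every solution $V\in[\alpha,\beta]$ of (PP) satisfies $V_*\le V\le V^*$ on $[c,d]$.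
   Context: $H(x,y,z)=\frac{p(x)x^2-\sqrt{p(x)^2x^4+4x^3q(x)|xz-y|}}{2x^3}$. A solution of (PP) is a $V\in C^1([c,d])$ with $V'$ absolutely continuous satisfying the equation a.e. and both boundary conditions. Dini derivatives: $D^+\gamma(x_0)=\limsup_{h\to0^+}\frac{\gamma(x_0+h)-\gamma(x_0)}{h}$, $D_+\gamma(x_0)=\liminf_{h\to0^+}(\cdot)$, $D^-\gamma(x_0)=\limsup_{h\to0^-}(\cdot)$, $D_-\gamma(x_0)=\liminf_{h\to0^-}(\cdot)$. A lower solution of (PP) is $\alpha\in AC([c,d])$ with $B_1(\alpha(c),\alpha)\le0$, $B_2(\alpha(d),\alpha)\le0$, and such that for each $x_0\in(c,d)$ either $D_-\alpha(x_0)<D^+\alpha(x_0)$, or there is an open interval $J_0$ with $x_0\in J_0\subset(c,d)$, $\alpha|_{J_0}\in W^{2,1}(J_0)$ and $\alpha''(x)+H(x,\alpha(x),\alpha'(x))\ge0$ for a.e. $x\in J_0$. An upper solution of (PP) is $\beta\in AC([c,d])$ with $B_1(\beta(c),\beta)\ge0$, $B_2(\beta(d),\beta)\ge0$, and such that for each $x_0\in(c,d)$ either $D^-\beta(x_0)>D_+\beta(x_0)$, or there is an open interval $J_0$ with $x_0\in J_0\subset(c,d)$, $\beta|_{J_0}\in W^{2,1}(J_0)$ and $\beta''(x)+H(x,\beta(x),\beta'(x))\le0$ for a.e. $x\in J_0$. *)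

(* Defs.v *)
From Stdlib Require Import Reals Lra.
Open Scope R_scope.

Fixpoint sum_lt (f : nat -> R) (n : nat) : R :=
  match n with
  | O => 0
  | S m => sum_lt f m + f m
  end.

(* Lebesgue outer measure: m*(A) <= r (countable covers by open intervals) *)
Definition outer_le (A : R -> Prop) (r : R) : Prop :=
  forall eps, 0 < eps ->
    exists u v : nat -> R,
      (forall k, u k <= v k) /\
      (forall x, A x -> exists k, u k < x < v k) /\
      (forall n, sum_lt (fun k => v k - u k) n <= r + eps).

Definition null_set (N : R -> Prop) : Prop := outer_le N 0.

(* Lebesgue measurability (Caratheodory criterion) *)
Definition leb_measurable (E : R -> Prop) : Prop :=
  forall (A : R -> Prop) r, outer_le A r ->
    exists r1 r2, r1 + r2 <= r /\
      outer_le (fun x => A x /\ E x) r1 /\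
      outer_le (fun x => A x /\ ~ E x) r2.

Definition measurable_on (c d : R) (f : R -> R) : Prop :=
  forall a, leb_measurable (fun x => c <= x <= d /\ a < f x).

Definition bounded_on (c d : R) (f : R -> R) : Prop :=
  exists M, forall x, c <= x <= d -> Rabs (f x) <= M.

Definition ae_on (a b : R) (P : R -> Prop) : Prop :=
  exists N, null_set N /\ forall x, a <= x <= b -> ~ N x -> P x.

Definition AC_on (a b : R) (f : R -> R) : Prop :=
  forall eps, 0 < eps -> exists delta, 0 < delta /\
    forall (n : nat) (u v : nat -> R),
      (forall k, (k < n)%nat -> a <= u k <= v k /\ v k <= b) ->
      (forall k, (S k < n)%nat -> v k <= u (S k)) ->
      sum_lt (fun k => v k - u k) n < delta ->
      sum_lt (fun k => Rabs (f (v k) - f (u k))) n < eps.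

Definition deriv_on (a b : R) (f f' : R -> R) : Prop :=
  forall x, a <= x <= b ->
    limit1_in (fun y => (f y - f x) / (y - x)) (fun y => a <= y <= b /\ y <> x) (f' x) x.

Definition Hfun (p q : R -> R) (x y z : R) : R :=
  (p x * x ^ 2 - sqrt (p x ^ 2 * x ^ 4 + 4 * x ^ 3 * q x * Rabs (x * z - y)))
  / (2 * x ^ 3).

Definition is_solution (c d : R) (p q : R -> R) (B1 B2 : R -> (R -> R) -> R)
  (V : R -> R) : Prop :=
  exists V' : R -> R,
    deriv_on c d V V' /\
    (forall x, c <= x <= d -> continuity_pt V' x) /\
    AC_on c d V' /\
    ae_on c d (fun x => exists l, derivable_pt_lim V' x l /\
                                  l + Hfun p q x (V x) (V' x) = 0) /\
    B1 (V c) V = 0 /\ B2 (V d) V = 0.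

(* D_- g(x0) < D^+ g(x0) (in the extended reals) *)
Definition dini_Dlm_lt_Dup (g : R -> R) (x0 : R) : Prop :=
  exists s1 s2, s1 < s2 /\
    (forall delta, 0 < delta -> exists h, - delta < h < 0 /\
        (g (x0 + h) - g x0) / h < s1) /\
    (forall delta, 0 < delta -> exists h, 0 < h < delta /\
        s2 < (g (x0 + h) - g x0) / h).

(* D^- g(x0) > D_+ g(x0) (in the extended reals) *)
Definition dini_Dum_gt_Dlp (g : R -> R) (x0 : R) : Prop :=
  exists s1 s2, s1 < s2 /\
    (forall delta, 0 < delta -> exists h, 0 < h < delta /\
        (g (x0 + h) - g x0) / h < s1) /\
    (forall delta, 0 < delta -> exists h, - delta < h < 0 /\
        s2 < (g (x0 + h) - g x0) / h).

(* g restricted to the open interval (a,b) lies in W^{2,1}(a,b), with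
   g'' + H(x,g,g') >= 0 (sgn = 1) resp. <= 0 (sgn = -1) a.e. on (a,b).
   W^{2,1}(a,b): g differentiable on (a,b) with derivative g' that extends to an
   absolutely continuous function on [a,b]. *)
Definition W21_ineq (c d : R) (p q : R -> R) (sgn : R) (g : R -> R) (a b : R) : Prop :=
  exists g' : R -> R,
    (forall x, a < x < b -> derivable_pt_lim g x (g' x)) /\
    AC_on a b g' /\
    ae_on a b (fun x => exists l, derivable_pt_lim g' x l /\
                                  0 <= sgn * (l + Hfun p q x (g x) (g' x))).

Definition is_lower_solution (c d : R) (p q : R -> R) (B1 B2 : R -> (R -> R) -> R)
  (al : R -> R) : Prop :=
  AC_on c d al /\ B1 (al c) al <= 0 /\ B2 (al d) al <= 0 /\
  forall x0, c < x0 < d ->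
    dini_Dlm_lt_Dup al x0 \/
    exists a b, c <= a < x0 /\ x0 < b <= d /\ W21_ineq c d p q 1 al a b.

Definition is_upper_solution (c d : R) (p q : R -> R) (B1 B2 : R -> (R -> R) -> R)
  (be : R -> R) : Prop :=
  AC_on c d be /\ 0 <= B1 (be c) be /\ 0 <= B2 (be d) be /\
  forall x0, c < x0 < d ->
    dini_Dum_gt_Dlp be x0 \/
    exists a b, c <= a < x0 /\ x0 < b <= d /\ W21_ineq c d p q (-1) be a b.

Definition in_order_interval (c d : R) (al be g : R -> R) : Prop :=
  AC_on c d g /\ forall x, c <= x <= d -> al x <= g x <= be x.

(* y in E = [min_{[c,d]} alpha, max_{[c,d]} beta] *)
Definition in_E (c d : R) (al be : R -> R) (y : R) : Prop :=
  (exists x, c <= x <= d /\ al x <= y) /\ (exists x, c <= x <= d /\ y <= be x).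

Definition convex_on (c d : R) (V : R -> R) : Prop :=
  forall x y t, c <= x <= d -> c <= y <= d -> 0 <= t <= 1 ->
    V (t * x + (1 - t) * y) <= t * V x + (1 - t) * V y.

Definition liminf_left_ge (f : R -> R) (y v : R) : Prop :=
  forall eps, 0 < eps -> exists delta, 0 < delta /\
    forall z, y - delta < z < y -> v - eps < f z.

Definition limsup_right_le (f : R -> R) (y v : R) : Prop :=
  forall eps, 0 < eps -> exists delta, 0 < delta /\
    forall z, y < z < y + delta -> f z < v + eps.

(* Main.v *)
Require Import Defs.
From Stdlib Require Import Reals Lra Lia Classical ClassicalChoice.
From Stdlib Require Import FunctionalExtensionality PropExtensionality.
From mathcomp Require all_boot all_order all_algebra all_classical all_reals all_analysis.
From mathcomp Require measurable_realfun Rstruct Rstruct_topology.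
Open Scope R_scope.

(** With [w = x V' - V] the equation reads [V'' = h(x, w)], and [w] is unchanged when a
    multiple of [x] is added to [V].  Hence functions are compared at a maximum of
    [(g - V) / x], where the second derivatives contradict each other as soon as one of the
    inequalities is strict.  Dirichlet problems between lower and upper solutions are solved
    by truncating [h], penalising values outside the order interval and replacing [p] by
    [p + eps], which makes [h] Lipschitz in [w]: the resulting problems are solved by Picard
    iteration and shooting, and for suitably shifted right-hand sides the solutions increase
    to a solution of the original problem.

    Given two lower solutions [g1], [g2] of (PP), [B_i(., max g1 g2)] has a zero between
    [max g1 g2] and [be] because it only jumps downwards, and the Dirichlet solution with
    these boundary values is, by monotonicity of [B_i] in its second argument, again a lower
    solution.  A lower solution with maximal integral therefore dominates all lower solutions
    and satisfies the boundary conditions.  The least solution is obtained by applying this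
    to [- V]. *)

(** Where [p] vanishes and [q] does not, H is a multiple of the square root of [|w|]: it is not
    Lipschitz, and comparison is proved only under a strict inequality. Hence the detour over
    [p + eps], whose Lipschitz constant blows up as [eps] tends to 0; the bounds on solutions are
    therefore made to depend on the size of the right-hand side alone. The same square root closes
    the a priori estimate: truncation at [M] bounds [V''] by a multiple of [sqrt M] plus a constant,
    hence [x V' - V] by an affine function of [sqrt M], which is below [M] for large [M].

    The [B_i] are monotone but possibly discontinuous in their second argument. Freezing it at
    [max g1 g2] leaves scalar equations for the end values. For a limit [V] of increasing lower
    solutions [W_n], monotonicity gives [B_i(W_n, V) <= B_i(W_n, W_n) <= 0], and only a left limit
    in the first argument remains.

    Lebesgue integration enters once, to produce Lipschitz primitives; afterwards inequalities
    between a.e. derivatives become inequalities between increments of absolutely continuous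
    functions. *)

(** [F] plays the indefinite integral of a bounded measurable [f]. Being Lipschitz on the whole
    line, it is absolutely continuous on every interval, so its a.e. derivative determines its
    increments on [[c, d]]. *)
Definition has_primitive (c d : R) (f : R -> R) : Prop :=
  exists F K, (forall x y, Rabs (F x - F y) <= K * Rabs (x - y)) /\
    ae_on c d (fun x => derivable_pt_lim F x (f x)).

(** * Lebesgue measure and primitives of bounded measurable functions *)

Module LebesguePrimitive.
Import all_boot all_order all_algebra.
Import all_classical all_reals all_analysis measurable_realfun.
Import Rstruct Rstruct_topology.
Import Order.TTheory GRing.Theory Num.Theory numFieldNormedType.Exports.
Local Open Scope classical_set_scope.
Local Open Scope ring_scope.

Lemma sum_ltE (f : nat -> R) n : sum_lt f n = \sum_(0 <= k < n) f k.
Proof. elim: n => [|n IH]; first by rewrite big_geq.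
by rewrite big_nat_recr//= IH. Qed.

(** The outer measure generated by interval lengths is an infimum over covers by open intervals; the
    slack [eps] in [outer_le] accounts for an infimum that is not attained. *)
Lemma outer_leP (A : set R) (r : R) :
  outer_le A r <-> ((@wlength R idfun)^*%mu A <= r%:E)%E.
Proof.
have lE (a b : R) : a <= b -> wlength idfun `]a, b[%classic = (b - a)%:E.
  move=> ab; rewrite wlength_itv/= lte_fin; case: ltP => //= ba.
  by have -> : a = b :> R; [apply/eqP; rewrite eq_le ab ba | rewrite subrr].
rewrite outer_measure_open_itv_cover; split.
- move=> Ar; apply/lee_addgt0Pr => e /RltP e0.
  have [u [v [uv [Auv suv]]]] := Ar e e0.
  apply: ge_ereal_inf; exists (\sum_(k <oo) wlength idfun `]u k, v k[%classic)%E.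
    exists (fun k => `]u k, v k[%classic) => //; split.
      by move=> k; exists (u k, v k).
    move=> x /Auv [k [/RltP h1 /RltP h2]]; exists k => //=.
    by rewrite in_itv/= h1 h2.
  have luv k : wlength idfun `]u k, v k[%classic = (v k - u k)%:E.
    by rewrite lE//; apply/RleP.
  apply: lime_le; first by apply: is_cvg_nneseries => n _ _; rewrite luv lee_fin subr_ge0; apply/RleP.
  apply: nearW => n; under eq_bigr do rewrite luv.
  by rewrite sumEFin -EFinD lee_fin -sum_ltE; apply/RleP.
- move=> Ar e /RltP e0.
  set S := [set _ | _ in _] in Ar.
  have : (ereal_inf S < (r + e)%:E)%E.
    by apply: le_lt_trans Ar _; rewrite lte_fin ltrDl.
  move=> /ereal_inf_lt[_ [F [FE AF] <-] sF].
  have /choice[ab abF] : forall k, exists ab : R * R, ab.1 <= ab.2 /\ F k = `]ab.1, ab.2[%classic.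
    move=> k; have [[a b] /= Fk] := FE k.
    (* An interval with reversed endpoints is empty and is re-encoded as []a, a[], because
       [outer_le] wants [u k <= v k]. *)
    have [ab|ba] := leP a b; first by exists (a, b).
    exists (a, a); split => //=; rewrite Fk !set_itv_ge// bnd_simp ?ltxx// -leNgt.
    exact: ltW.
  exists (fun k => (ab k).1), (fun k => (ab k).2); split; [|split].
  + by move=> k; apply/RleP; case: (abF k).
  + move=> x /AF[k _]; rewrite (abF k).2/= in_itv/= => /andP[h1 h2].
    by exists k; split; apply/RltP.
  + move=> n; apply/RleP; rewrite -lee_fin sum_ltE -sumEFin.
    apply: le_trans (ltW sF).
    have lF k : wlength idfun (F k) = ((ab k).2 - (ab k).1)%:E.
      by rewrite (abF k).2 lE//; case: (abF k).
    rewrite (eq_bigr (fun k => wlength idfun (F k))); last by move=> k _; rewrite lF.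
    apply: nneseries_lim_ge => k _ _; rewrite lF lee_fin subr_ge0.
    by case: (abF k).
Qed.

Lemma null_setP (N : set R) : Defs.null_set N <-> (@lebesgue_measure R).-negligible N.
Proof.
rewrite negligible_outer_measure /Defs.null_set outer_leP; split => [h|->//].
by apply/eqP; rewrite eq_le h outer_measure_ge0.
Qed.

(** Sets satisfying the Caratheodory criterion form the completion of the Borel sigma-algebra,
    whence a Borel part and a negligible part. *)
Lemma leb_measurable_borelU (E : set R) : leb_measurable E ->
  exists X N : set R, [/\ measurable (X : set (measurableTypeR R)),
    (@lebesgue_measure R).-negligible N & E = X `|` N].
Proof.
move=> mE.
have : ((wlength idfun)^*%mu).-cara.-measurable%classic (E : set R).
  apply: le_caratheodory_measurable => A.
  (* [outer_le] speaks of real bounds only; for a test set of infinite outer measure the inequality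
     is trivial. *)
  have [e|Aoo] := eqVneq ((wlength idfun)^*%mu A) +oo%E; first by rewrite [leRHS]e leey.
  have Afin : (wlength idfun)^*%mu A \is a fin_num.
    by rewrite ge0_fin_numE ?outer_measure_ge0// ltey.
  have /outer_leP/mE[r1 [r2 [r12 [/outer_leP h1 /outer_leP h2]]]] :
    ((wlength idfun)^*%mu A <= (fine ((wlength idfun)^*%mu A))%:E)%E.
    by rewrite fineK.
  apply: (le_trans (leeD h1 h2)).
  by rewrite -[leRHS](fineK Afin) -EFinD lee_fin; apply/RleP.
rewrite -completed_caratheodory_measurable g_sigma_completed_algebra_genE.
by move=> -[X mX [N nN <-]]; exists X, N.
Qed.

(** Every superlevel set is a union of those at rational levels, so only countably many negligible
    parts have to be discarded. Their union lies in one Borel null set [N], off which [f] is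
    Borel. *)
Lemma measurable_on_borel (c d : R) (f : R -> R) : measurable_on c d f ->
  exists N : set R, [/\ measurable (N : set (measurableTypeR R)), lebesgue_measure N = 0%E
   & measurable_fun ((`[c, d] `\` N) : set (measurableTypeR R)) (f : measurableTypeR R -> measurableTypeR R)].
Proof.
move=> mf.
pose E (a : R) : set R := fun x => (c <= x <= d)%coqR /\ (a < f x)%coqR.
have /choice[XN XNE] : forall a, exists XN : set R * set R,
   [/\ measurable (XN.1 : set (measurableTypeR R)),
    (@lebesgue_measure R).-negligible XN.2 & E a = XN.1 `|` XN.2].
  by move=> a; have [X [N ?]] := leb_measurable_borelU _ (mf a); exists (X, N).
(* [s] enumerates the rationals; the default 0 serves the codes of no rational and only repeats a
   level. *)
pose s (n : nat) : R := ratr (odflt 0%Q (unpickle n)).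
have : (@lebesgue_measure R).-negligible (\bigcup_n (XN (s n)).2).
  by apply: negligible_bigcup => n; have [_ + _] := XNE (s n).
move=> -[N [mN N0 sN]]; exists N; split => //.
have mD : measurable ((`[c, d] `\` N) : set (measurableTypeR R)).
  by apply: measurableD => //; exact: measurable_itv.
apply: (measurability _ (RGenOInfty.measurableE R)) => //.
move=> /= _ [_ [a ->] <-].
rewrite [X in measurable X](_ : _ =
  (`[c, d] `\` N) `&` \bigcup_(n in [set n | a < s n]) (XN (s n)).1).
  apply: measurableI => //; apply: bigcup_measurable => n _.
  by have [] := XNE (s n).
apply/seteqP; split => x [[/= cd Nx]].
- rewrite in_itv/= andbT => afx; split => //.
  have [q /andP[aq qf]] := rat_in_itvoo afx.
  exists (pickle q); rewrite /= /s pickleK//=.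
  have : E (ratr q) x.
    move: cd; rewrite in_itv/= => /andP[/RleP cx /RleP xd].
    by split; [split|apply/RltP].
  have := XNE (s (pickle q)); rewrite /s pickleK/= => -[_ _ ->] [//|].
  by move=> Nqx; exfalso; apply: Nx; apply: sN; exists (pickle q); rewrite // /s pickleK.
- move=> -[n /= an Xx]; split => //; rewrite /= in_itv/= andbT.
  have : E (s n) x by have [_ _ ->] := XNE (s n); left.
  by move=> [_ /RltP]; exact: lt_trans.
Qed.

Lemma null_setU (A B : R -> Prop) :
  Defs.null_set A -> Defs.null_set B -> Defs.null_set (fun x => A x \/ B x).
Proof. by move=> /null_setP nA /null_setP nB; apply/null_setP; exact: negligibleU. Qed.

Lemma null_set1 (a : R) : Defs.null_set [set a].
Proof.
apply/null_setP; rewrite -(@set_itv1 _ R a).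
have ma : measurable (`[a, a]%classic : set (measurableTypeR R)) by exact: measurable_itv.
exists (`[a, a]%classic : set (measurableTypeR R)); split => //.
by rewrite lebesgue_measure_itv/= ltxx.
Qed.

Lemma derivable_pt_lim_derive1 (F : R -> R) (x l : R) :
  derivable (F : R^o -> R^o) x 1 /\ derive1 (F : R^o -> R^o) x = l ->
  derivable_pt_lim F x l.
Proof.
move=> [dF <-] e /RltP e0.
have : h^-1 *: ((F : R^o -> R^o) (h + x) - F x) @[h --> (0:R^o)^'] --> derive1 (F : R^o -> R^o) x.
  have := dF; rewrite derive1E /derive /derivable /=.
  set g := fun h : R^o => _; set g' := fun h : R^o => _.
  have -> : g = g' by apply/funext => h; rewrite /g /g' /= [_%:A]mulr1.
  by [].
move=> /cvgrPdist_lt/(_ e e0)[r /= r0 Hr].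
have r0' : Rlt 0 r by apply/RltP.
exists (mkposreal r r0') => h h0 hr.
have {}hr : `|h| < r by rewrite -RabsE; apply/RltP.
apply/RltP; rewrite RabsE distrC.
have := Hr h; rewrite /= sub0r normrN => H.
have {}H := H hr (introN eqP h0).
suff <- : h^-1 *: ((F (h + x) : R^o) - F x) = Rdiv (F (x + h) - F x) h by [].
by rewrite RdivE [RHS]mulrC [h + x]addrC.
Qed.

(** Boundedness and support in [[c, d]] make [f] integrable over the line, so [F] can be its
    integral over []-oo, x]]; the a.e. derivative comes from Lebesgue differentiation. *)
Lemma bounded_borel_FTC (K : realType) (c d M : K) (f : K -> K) :
  measurable_fun setT (f : measurableTypeR K -> measurableTypeR K) ->
  (forall x, `|f x| <= M) -> (forall x, x \notin `[c, d] -> f x = 0) ->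
  exists F : K -> K,
    (forall x y, `|F x - F y| <= M * `|x - y|) /\
    {ae (@lebesgue_measure K), forall x, derivable F x 1 /\ derive1 F x = f x}.
Proof.
move=> mf fM f0.
have bf (A : set K) : [bounded f x | x in A].
  exists M; split; first exact: num_real.
  by move=> r Mr x _; apply: le_trans (fM x) (ltW Mr).
have intK (S : set (measurableTypeR K)) : measurable S -> (lebesgue_measure S < +oo)%E ->
    (@lebesgue_measure K).-integrable S (EFin \o f).
  move=> mS Soo; apply: measurable_bounded_integrable => //.
  exact: measurable_funS mf.
have itvoo (i j : K) : (lebesgue_measure (`[i, j]%classic : set (measurableTypeR K)) < +oo)%E.
  by rewrite lebesgue_measure_itv/=; case: ifP => _; rewrite ?ltry// -EFinB ltry.
have intT : (@lebesgue_measure K).-integrable setT (EFin \o f).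
  have -> : EFin \o f = (EFin \o f) \_ (`[c, d]%classic : set K).
    apply/funext => x; rewrite patchE; case: ifPn => //.
    by rewrite notin_setE/= => /negP xcd; rewrite f0.
  have mcd : measurable (`[c, d]%classic : set (measurableTypeR K)) by exact: measurable_itv.
  apply/(integrable_restrict _ mcd) => //.
  by rewrite setTI; apply: intK => //; exact: measurable_itv.
have intS (S : set (measurableTypeR K)) : measurable S -> (@lebesgue_measure K).-integrable S (EFin \o f).
  by move=> mS; apply: integrableS intT.
pose F x := \int[lebesgue_measure]_(t in `]-oo, x]) f t.
exists F; split.
  have Fle (x y : K) : x <= y -> `|F y - F x| <= M * (y - x).
    move=> xy; rewrite /F Rintegral_itvB//; last by apply: intS; exact: measurable_itv.
    have mxy : measurable (`]x, y]%classic : set (measurableTypeR K)) by exact: measurable_itv.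
    have oxy : (lebesgue_measure (`]x, y]%classic : set (measurableTypeR K)) < +oo)%E.
      by rewrite lebesgue_measure_itv/=; case: ifP => _; rewrite ?ltry// -EFinB ltry.
    apply: le_trans (le_normr_Rintegral mxy (intS _ mxy)) _.
    apply: (@le_trans _ _ (\int[lebesgue_measure]_(t in `]x, y]) M)).
      apply: le_Rintegral => //.
        by have := integrable_norm (intS _ mxy).
      apply: (measurable_bounded_integrable mxy).
      - exact: oxy.
      - exact: measurable_cst.
      - by exists `|M|; split; rewrite ?num_real// => r Mr z _; exact: ltW.
    rewrite Rintegral_cst// [X in fine X](_ : _ = lebesgue_measure (`]x, y]%classic : set (measurableTypeR K)))//.
    rewrite lebesgue_measure_itv/= lte_fin; case: ltP => //= yx.
    by have -> : x = y; [apply/eqP; rewrite eq_le xy yx | rewrite subrr].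
  move=> x y; have [xy|/ltW yx] := leP x y.
    by rewrite distrC (le_trans (Fle _ _ xy))// distrC ger0_norm// subr_ge0.
  by rewrite (le_trans (Fle _ _ yx))// ger0_norm// subr_ge0.
apply: FTC1Ny => [y|]; first by apply: intS; exact: measurable_itv.
split => //; first exact: openT.
move=> S _ cS; have mS : measurable (S : set (measurableTypeR K)) by exact: compact_measurable.
by have /integrableP[_] := intS _ mS.
Qed.

Lemma bounded_borel_primitive (c d M : R) (f : R -> R) :
  measurable_fun setT (f : measurableTypeR R -> measurableTypeR R) ->
  (forall x : R, Rle (Rabs (f x)) M) -> (forall x : R, x \notin `[c, d] -> f x = 0) ->
  exists F : R -> R,
    (forall x y : R, Rle (Rabs (F x - F y)) (M * Rabs (x - y))) /\
    exists N, Defs.null_set N /\ forall x, ~ N x -> derivable_pt_lim F x (f x).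
Proof.
move=> mf fM f0.
have [x|F [lipF [N [mN N0 sN]]]] := bounded_borel_FTC _ c d M f mf _ f0.
  by rewrite -RabsE; apply/RleP.
exists F; split => [x y|]; first by apply/RleP; rewrite !RabsE; exact: lipF.
exists N; split; first by apply/null_setP; exists N; split.
by move=> x Nx; apply: derivable_pt_lim_derive1; apply: contrapT => h; apply: Nx; exact: sN.
Qed.

Lemma continuity_measurable (D : set (measurableTypeR R)) (f : R -> R) :
  measurable D -> continuity f ->
  measurable_fun D (f : measurableTypeR R -> measurableTypeR R).
Proof.
move=> mD cf; have mf : measurable_fun setT (f : measurableTypeR R -> measurableTypeR R).
  by apply: (@continuous_measurable_fun R) => x; exact/continuity_pt_cvg/cf.
exact: measurable_funS mf.
Qed.

Lemma continuity_Rmax (c : R) : continuity (Rmax c).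
Proof.
apply: (@continuity_eq (fun t => (c + t + Rabs (c - t)) / 2)%coqR).
  by move=> t; rewrite /Rmax /Rabs; case: Rle_dec => ?; case: Rcase_abs => ? /=; lra.
by reg.
Qed.

Lemma continuity_sqrt_pos : continuity (fun x => sqrt (Rmax 0 x)).
Proof.
move=> x; apply: continuity_pt_comp; first exact: continuity_Rmax.
by apply: continuity_pt_sqrt; exact: Rmax_l.
Qed.

(** Off a Borel null set, H is assembled from Borel [p], [q] and continuous functions by sums,
    products and a square root. Extended by 0, it is a bounded Borel function on the line, whose
    integral is the primitive. *)
Lemma Hfun_primitive (c d M : R) (p q y z : R -> R) :
  Rlt 0 c -> measurable_on c d p -> measurable_on c d q ->
  (forall x, Rle c x /\ Rle x d -> Rle 0 (q x)) ->
  continuity y -> continuity z ->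
  (forall x, Rle c x /\ Rle x d -> Rle (Rabs (Hfun p q x (y x) (z x))) M) ->
  has_primitive c d (fun x => Hfun p q x (y x) (z x)).
Proof.
move=> c0 /measurable_on_borel[Np [mNp Np0 mp]] /measurable_on_borel[Nq [mNq Nq0 mq]].
move=> q0 cy cz HM.
pose N : set (measurableTypeR R) := Np `|` Nq.
have mN : measurable N by exact: measurableU.
pose D : set (measurableTypeR R) := `[c, d] `\` N.
have mcd : measurable (`[c, d]%classic : set (measurableTypeR R)) by exact: measurable_itv.
have mD : measurable D by exact: measurableD.
have Dcd x : D x -> Rle c x /\ Rle x d.
  by move=> [/=]; rewrite in_itv/= => /andP[/RleP ? /RleP ?] _.
have {}mp : measurable_fun D (p : measurableTypeR R -> measurableTypeR R).
  by apply: measurable_funS mp; [exact: measurableD|move=> x [? xN]; split => // ?; apply: xN; left].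
have {}mq : measurable_fun D (q : measurableTypeR R -> measurableTypeR R).
  by apply: measurable_funS mq; [exact: measurableD|move=> x [? xN]; split => // ?; apply: xN; right].
pose a1 (x : R) : R := pow x 2.
pose a2 (x : R) : R := pow x 4.
pose a3 (x : R) : R := (4 * x ^ 3 * Rabs (x * z x - y x))%coqR.
(* [Rmax c x] equals [x] on [[c, d]] and keeps the denominator away from 0 elsewhere. Likewise
   [Rmax 0] in [g] leaves the nonnegative radicand unchanged on [D] and makes the root continuous on
   the line. *)
pose a4 (x : R) : R := (/ (2 * Rmax c x ^ 3))%coqR.
have ca1 : continuity a1 by rewrite /a1; reg.
have ca2 : continuity a2 by rewrite /a2; reg.
have ca3 : continuity a3.
  rewrite /a3 => x; apply: continuity_pt_mult; first by reg.
  apply: (continuity_pt_comp (fun x => x * z x - y x)%coqR Rabs); last exact: Rcontinuity_abs.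
  apply: continuity_pt_minus; last exact: cy.
  by apply: continuity_pt_mult; [reg|exact: cz].
have ca4 : continuity a4.
  rewrite /a4 => x; apply: continuity_pt_inv; last first.
    have h : Rlt 0 (Rmax c x) by have := Rmax_l c x; lra.
    by have := pow_lt _ 3 h; lra.
  apply: continuity_pt_mult; first by reg.
  by apply: (continuity_pt_comp (Rmax c) (fun t => pow t 3)); [exact: continuity_Rmax|reg].
pose g (x : R) : R := ((p x * a1 x - sqrt (Rmax 0 (p x * p x * a2 x + a3 x * q x))) * a4 x)%coqR.
have mM (f1 f2 : R -> R) : measurable_fun D (f1 : measurableTypeR R -> measurableTypeR R) ->
    measurable_fun D (f2 : measurableTypeR R -> measurableTypeR R) ->
    measurable_fun D ((fun x => Rmult (f1 x) (f2 x)) : measurableTypeR R -> measurableTypeR R).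
  by move=> h1 h2; exact: (@measurable_funM _ _ R D f1 f2).
have mA (f1 f2 : R -> R) : measurable_fun D (f1 : measurableTypeR R -> measurableTypeR R) ->
    measurable_fun D (f2 : measurableTypeR R -> measurableTypeR R) ->
    measurable_fun D ((fun x => Rplus (f1 x) (f2 x)) : measurableTypeR R -> measurableTypeR R).
  by move=> h1 h2; exact: (@measurable_funD _ _ R D f1 f2).
have mB (f1 f2 : R -> R) : measurable_fun D (f1 : measurableTypeR R -> measurableTypeR R) ->
    measurable_fun D (f2 : measurableTypeR R -> measurableTypeR R) ->
    measurable_fun D ((fun x => Rminus (f1 x) (f2 x)) : measurableTypeR R -> measurableTypeR R).
  by move=> h1 h2; exact: (@measurable_funB _ _ R D f1 f2).
have mc f : continuity f -> measurable_fun D (f : measurableTypeR R -> measurableTypeR R).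
  exact: continuity_measurable.
have mg : measurable_fun D (g : measurableTypeR R -> measurableTypeR R).
  apply: (mM _ _); last exact: mc.
  apply: (mB _ _); first by apply: (mM _ _) => //; exact: mc.
  have ms := @continuity_measurable setT _ measurableT continuity_sqrt_pos.
  apply: (measurableT_comp ms).
  apply: (mA _ _); first by apply: (mM _ _); [exact: (mM _ _)|exact: mc].
  by apply: (mM _ _) => //; exact: mc.
have gE x : D x -> g x = Hfun p q x (y x) (z x).
  move=> /Dcd cxd; rewrite /g /Hfun /a4 (Rmax_right c x); last by case: cxd.
  rewrite /Rdiv /a1; congr (Rmult (Rminus _ (sqrt _)) _).
  rewrite /a2 /a3 Rmax_right; first by ring.
  have h0 := q0 x cxd; have hx : Rlt 0 x by lra.
  have h3 := pow_lt _ 3 hx; have h4 := pow_lt _ 4 hx.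
  have ha := Rabs_pos (x * z x - y x)%coqR; have hp := Rle_0_sqr (p x).
  apply: Rplus_le_le_0_compat; first by apply: Rmult_le_pos; [exact: hp|lra].
  by apply: Rmult_le_pos h0; apply: Rmult_le_pos ha; lra.
have M0 : c <= d -> Rle 0 M.
  move=> /RleP cd; have := HM c (conj (Rle_refl _) cd).
  by have := Rabs_pos (Hfun p q c (y c) (z c)); lra.
have [cd|dc] := leP c d; last first.
  exists (fun=> 0), 0; split=> [x t|].
    by rewrite Rminus_diag Rabs_R0 Rmult_0_l; lra.
  exists set0; split; first by apply/null_setP; exact: negligible_set0.
  by move=> x [h1 h2]; move/RltP: dc; lra.
have mg' : measurable_fun setT ((g \_ D) : measurableTypeR R -> measurableTypeR R).
  by apply/(measurable_restrictT _ mD).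
have [| |F [lipF [N' [nN' dF]]]] := bounded_borel_primitive c d M _ mg'.
- move=> x; rewrite patchE; case: ifPn => [|_]; last by rewrite Rabs_R0; exact: M0.
  by rewrite inE => Dx; rewrite gE//; apply: HM; exact: Dcd.
- move=> x xcd; rewrite patchE; case: ifPn => //.
  by rewrite inE => -[/=]; rewrite (negbTE xcd).
exists F, M; split => //; exists (N' `|` N); split.
  apply/null_setP; apply: negligibleU; first exact/null_setP.
  exists N; split => //; apply/eqP; rewrite eq_le measure_ge0 andbT.
  apply: le_trans (measureU2 _ _ _) _ => //.
  by rewrite [X in (X + _)%E]Np0 [X in (_ + X)%E]Nq0 adde0.
move=> x cxd NNx; have Dx : D x.
  split; first by rewrite /= in_itv/=; case: cxd => /RleP -> /RleP ->.
  by move=> Nx; apply: NNx; right.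
have := dF x (fun h => NNx (or_introl h)).
by rewrite patchE mem_set// gE.
Qed.

End LebesguePrimitive.
Import LebesguePrimitive.

From Coquelicot Require Import Coquelicot.
Open Scope R_scope.
Set Bullet Behavior "Strict Subproofs".

(** * Absolutely continuous functions *)

Lemma sum_lt_ext (f g : nat -> R) n :
  (forall k, (k < n)%nat -> f k = g k) -> sum_lt f n = sum_lt g n.
Proof.
  induction n as [|n IH]; intros H; simpl; auto.
  rewrite IH by (intros; apply H; lia). rewrite H by lia. reflexivity.
Qed.

Lemma sum_lt_le (f g : nat -> R) n :
  (forall k, (k < n)%nat -> f k <= g k) -> sum_lt f n <= sum_lt g n.
Proof.
  induction n as [|n IH]; intros H; simpl; [lra|].
  assert (sum_lt f n <= sum_lt g n) by (apply IH; intros; apply H; lia).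
  specialize (H n ltac:(lia)). lra.
Qed.

Lemma sum_lt_nonneg (f : nat -> R) n :
  (forall k, (k < n)%nat -> 0 <= f k) -> 0 <= sum_lt f n.
Proof.
  intros H. induction n as [|n IH]; simpl; [lra|].
  assert (0 <= sum_lt f n) by (apply IH; intros; apply H; lia).
  specialize (H n ltac:(lia)). lra.
Qed.

Lemma sum_lt_plus (f g : nat -> R) n :
  sum_lt (fun k => f k + g k) n = sum_lt f n + sum_lt g n.
Proof. induction n as [|n IH]; simpl; lra. Qed.

Lemma sum_lt_scal (K : R) (f : nat -> R) n :
  sum_lt (fun k => K * f k) n = K * sum_lt f n.
Proof. induction n as [|n IH]; simpl; [|rewrite IH]; ring. Qed.

(** Differences, negatives and maxima are all instances of this domination. *)
Lemma AC_on_dominated2 (a b : R) (f g h : R -> R) :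
  AC_on a b f -> AC_on a b g ->
  (forall x y, a <= x <= b -> a <= y <= b ->
     Rabs (h x - h y) <= Rabs (f x - f y) + Rabs (g x - g y)) ->
  AC_on a b h.
Proof.
  intros Hf Hg Hh eps He.
  destruct (Hf (eps / 2) ltac:(lra)) as [d1 [Hd1 H1]].
  destruct (Hg (eps / 2) ltac:(lra)) as [d2 [Hd2 H2]].
  exists (Rmin d1 d2); split; [apply Rmin_glb_lt; auto|].
  intros n u v Hin Hord Hs.
  specialize (H1 n u v Hin Hord (Rlt_le_trans _ _ _ Hs (Rmin_l _ _))).
  specialize (H2 n u v Hin Hord (Rlt_le_trans _ _ _ Hs (Rmin_r _ _))).
  eapply Rle_lt_trans; [apply sum_lt_le with
    (g := fun k => Rabs (f (v k) - f (u k)) + Rabs (g (v k) - g (u k)))|].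
  - intros k Hk. specialize (Hin k Hk). apply Hh; lra.
  - rewrite sum_lt_plus. lra.
Qed.

Lemma AC_on_lipschitz (a b K : R) (f : R -> R) :
  (forall x y, a <= x <= b -> a <= y <= b -> Rabs (f x - f y) <= K * Rabs (x - y)) ->
  AC_on a b f.
Proof.
  (* The sign of [K] is not known, hence [Rabs K]; adding 1 keeps the divisor positive. *)
  intros Hf eps He. pose proof (Rabs_pos K) as HK.
  exists (eps / (Rabs K + 1)); split; [apply Rdiv_lt_0_compat; lra|].
  intros n u v Hin Hord Hs.
  eapply Rle_lt_trans; [apply sum_lt_le with (g := fun k => Rabs K * (v k - u k))|].
  - intros k Hk. specialize (Hin k Hk).
    eapply Rle_trans; [apply Hf; lra|].
    rewrite (Rabs_right (v k - u k)) by lra.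
    apply Rmult_le_compat_r; [lra|apply Rle_abs].
  - rewrite sum_lt_scal.
    assert (0 <= sum_lt (fun k => v k - u k) n)
      by (apply sum_lt_nonneg; intros k Hk; specialize (Hin k Hk); lra).
    apply Rle_lt_trans with ((Rabs K + 1) * sum_lt (fun k => v k - u k) n); [nra|].
    replace eps with ((Rabs K + 1) * (eps / (Rabs K + 1))) at 1 by (field; lra).
    apply Rmult_lt_compat_l; lra.
Qed.

Lemma AC_on_minus (a b : R) (f g : R -> R) :
  AC_on a b f -> AC_on a b g -> AC_on a b (fun x => f x - g x).
Proof.
  intros Hf Hg. apply (AC_on_dominated2 a b f g); auto.
  intros x y _ _. replace (f x - g x - (f y - g y)) with ((f x - f y) - (g x - g y)) by ring.
  eapply Rle_trans; [apply Rabs_triang|]. rewrite Rabs_Ropp. lra.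
Qed.

Lemma AC_on_opp (a b : R) (f : R -> R) : AC_on a b f -> AC_on a b (fun x => - f x).
Proof.
  intros Hf. apply (AC_on_dominated2 a b f f); auto.
  intros x y _ _. replace (- f x - - f y) with (- (f x - f y)) by ring.
  rewrite Rabs_Ropp. pose proof (Rabs_pos (f x - f y)). lra.
Qed.

Lemma Rmax_dist (p q r s : R) :
  Rabs (Rmax p q - Rmax r s) <= Rabs (p - r) + Rabs (q - s).
Proof.
  unfold Rmax. destruct (Rle_dec p q), (Rle_dec r s); unfold Rabs;
  repeat destruct (Rcase_abs _); lra.
Qed.

Lemma AC_on_max (a b : R) (f g : R -> R) :
  AC_on a b f -> AC_on a b g -> AC_on a b (fun x => Rmax (f x) (g x)).
Proof.
  intros Hf Hg. apply (AC_on_dominated2 a b f g); auto.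
  intros x y _ _. apply Rmax_dist.
Qed.

Lemma AC_on_sub (a b a' b' : R) (f : R -> R) :
  AC_on a b f -> a <= a' -> b' <= b -> AC_on a' b' f.
Proof.
  intros Hf Ha Hb eps He. destruct (Hf eps He) as [d [Hd H]].
  exists d; split; auto. intros n u v Hin. apply H.
  intros k Hk. specialize (Hin k Hk). lra.
Qed.

Definition cont_on (a b : R) (f : R -> R) : Prop :=
  forall x, a <= x <= b -> forall eps, 0 < eps -> exists delta, 0 < delta /\
    forall y, a <= y <= b -> Rabs (y - x) < delta -> Rabs (f y - f x) < eps.

Lemma AC_on_cont (a b : R) (f : R -> R) : AC_on a b f -> cont_on a b f.
Proof.
  intros Hf x Hx eps He. destruct (Hf eps He) as [d [Hd H]].
  exists d; split; auto. intros y Hy Hyx.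
  specialize (H 1%nat (fun _ => Rmin x y) (fun _ => Rmax x y)). simpl in H.
  assert (Hm : Rabs (f (Rmax x y) - f (Rmin x y)) = Rabs (f y - f x)).
  { unfold Rmax, Rmin. destruct (Rle_dec x y); auto. apply Rabs_minus_sym. }
  rewrite <- Hm. eapply Rle_lt_trans; [|apply H]; [lra| | |].
  - intros _ _. unfold Rmax, Rmin. destruct (Rle_dec x y); lra.
  - intros; lia.
  - unfold Rmax, Rmin. revert Hyx. unfold Rabs. destruct (Rle_dec x y), (Rcase_abs _); lra.
Qed.

(* Real induction on [x]: on [[a, x]] the decrease of [f] is at most [eps * (x - a)] plus the
   variation of [f] over finitely many intervals taken inside the cover of the exceptional
   null set; [cover_len m x] bounds the total length of those intervals. *)
Section Nondecreasing.
Variables (u v : nat -> R).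
Hypothesis Huv : forall k, u k <= v k.

Let cover_len (m : nat) (x : R) := sum_lt (fun k => Rmax (u k) (Rmin (v k) x) - u k) m.

Lemma cover_len_mono m x y : x <= y -> cover_len m x <= cover_len m y.
Proof.
  intros H. apply sum_lt_le. intros k _.
  assert (Rmax (u k) (Rmin (v k) x) <= Rmax (u k) (Rmin (v k) y))
    by (apply Rle_max_compat_l, Rle_min_compat_l; auto). lra.
Qed.

Lemma cover_len_bounds m x : 0 <= cover_len m x <= sum_lt (fun k => v k - u k) m.
Proof.
  split; [apply sum_lt_nonneg | apply sum_lt_le]; intros k _.
  - pose proof (Rmax_l (u k) (Rmin (v k) x)). lra.
  - pose proof (Rmax_lub (u k) (Rmin (v k) x) (v k) (Huv k) (Rmin_l _ _)). lra.
Qed.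

Lemma cover_len_grow m m' x y : (m <= m')%nat -> x <= y ->
  cover_len m y - cover_len m x <= cover_len m' y - cover_len m' x.
Proof.
  intros Hm Hxy. induction Hm as [|m' Hm IH]; [lra|].
  unfold cover_len in *; simpl.
  assert (Rmax (u m') (Rmin (v m') x) <= Rmax (u m') (Rmin (v m') y))
    by (apply Rle_max_compat_l, Rle_min_compat_l; auto). lra.
Qed.

(** Moving inside the [k]-th covering interval raises its own summand by exactly [y - x], and no
    summand decreases. An added interval is thus paid for by the growth of [cover_len]. *)
Lemma cover_len_inside k m x y : (k < m)%nat -> x <= y -> u k < x -> y < v k ->
  y - x <= cover_len m y - cover_len m x.
Proof.
  intros Hk Hxy Hx Hy.
  apply Rle_trans with (cover_len (S k) y - cover_len (S k) x);
    [|apply cover_len_grow; auto].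
  pose proof (cover_len_mono k x y Hxy). unfold cover_len in *; simpl.
  rewrite (Rmin_right (v k) x), (Rmin_right (v k) y) by lra.
  rewrite (Rmax_right (u k) x), (Rmax_right (u k) y) by lra. lra.
Qed.

Variables (a b eps : R) (f : R -> R).

Let controlled (x : R) := exists (m n : nat) (s t : nat -> R),
  (forall k, (k < n)%nat -> a <= s k <= t k /\ t k <= x) /\
  (forall k, (S k < n)%nat -> t k <= s (S k)) /\
  sum_lt (fun k => t k - s k) n <= cover_len m x - cover_len m a /\
  f a - f x <= eps * (x - a) + sum_lt (fun k => Rabs (f (t k) - f (s k))) n.

Lemma controlled_slope x y : a <= x <= y -> controlled x ->
  f x - f y <= eps * (y - x) -> controlled y.
Proof.
  intros Hxy (m & n & s & t & H1 & H2 & H3 & H4) Hf. exists m, n, s, t.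
  split; [intros k Hk; specialize (H1 k Hk); lra|]. split; auto.
  pose proof (cover_len_mono m x y ltac:(lra)). split; lra.
Qed.

Lemma controlled_cover k x y : 0 <= eps -> a <= x <= y -> controlled x ->
  u k < x -> y < v k -> controlled y.
Proof.
  intros He Hxy (m & n & s & t & H1 & H2 & H3 & H4) Hx Hy.
  exists (Nat.max m (S k)), (S n),
    (fun j => if Nat.eqb j n then x else s j), (fun j => if Nat.eqb j n then y else t j).
  split; [|split; [|split]].
  - intros j Hj. destruct (Nat.eqb_spec j n); [lra|]. specialize (H1 j ltac:(lia)). lra.
  - intros j Hj. destruct (Nat.eqb_spec j n); [lia|]. destruct (Nat.eqb_spec (S j) n).
    + specialize (H1 j ltac:(lia)). lra.
    + apply H2; lia.
  - simpl. rewrite Nat.eqb_refl.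
    rewrite (sum_lt_ext _ (fun k => t k - s k)).
    2:{ intros j Hj. destruct (Nat.eqb_spec j n); [lia|reflexivity]. }
    pose proof (cover_len_grow m (Nat.max m (S k)) a x ltac:(lia) ltac:(lra)).
    pose proof (cover_len_inside k (Nat.max m (S k)) x y ltac:(lia) ltac:(lra) Hx Hy). lra.
  - simpl. rewrite Nat.eqb_refl.
    rewrite (sum_lt_ext _ (fun k => Rabs (f (t k) - f (s k)))).
    2:{ intros j Hj. destruct (Nat.eqb_spec j n); [lia|reflexivity]. }
    pose proof (Rle_abs (- (f y - f x))). rewrite Rabs_Ropp in *. nra.
Qed.

(** Near every point [controlled] propagates to the right, either by the slope bound or by one more
    interval inside the cover; a supremum argument makes this global. *)
Lemma controlled_all : a <= b -> 0 <= eps ->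
  (forall x, a <= x <= b -> (exists k, u k < x < v k) \/
     exists delta, 0 < delta /\ forall y, Rabs (y - x) < delta ->
       (x <= y -> f x - f y <= eps * (y - x)) /\ (y <= x -> f y - f x <= eps * (x - y))) ->
  controlled b.
Proof.
  intros Hab He Hloc.
  (* The slope bound compares [x] only with its neighbours, so one of the two points is [x] itself.
     This suffices to reach the supremum from the left and to leave it to the right. *)
  assert (Hstep : forall x, a <= x <= b -> exists delta, 0 < delta /\
    forall y z, a <= y <= z -> x - delta < y -> z < x + delta -> y = x \/ z = x ->
      controlled y -> controlled z).
  { intros x Hx. destruct (Hloc x Hx) as [[k Hk]|[delta [Hd H]]].
    - exists (Rmin (x - u k) (v k - x)). split; [apply Rmin_glb_lt; lra|].
      pose proof (Rmin_l (x - u k) (v k - x)). pose proof (Rmin_r (x - u k) (v k - x)).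
      intros y z Hyz Hy Hz _ Hc. apply (controlled_cover k y z); auto; lra.
    - exists delta; split; auto. intros y z Hyz Hy Hz [->| ->] Hc.
      + apply (controlled_slope x z); auto. apply (H z); [apply Rabs_def1; lra|lra].
      + apply (controlled_slope y x); auto. apply (H y); [apply Rabs_def1; lra|lra]. }
  assert (Ha : controlled a).
  { exists 0%nat, 0%nat, (fun _ => 0), (fun _ => 0). split; [intros; lia|].
    split; [intros; lia|]. simpl. lra. }
  destruct (completeness (fun x => a <= x <= b /\ controlled x)) as [s [Hub Hlub]].
  { exists b. intros x Hx. lra. }
  { exists a. split; [lra|auto]. }
  assert (Has : a <= s) by (apply Hub; split; [lra|auto]).
  assert (Hsb : s <= b) by (apply Hlub; intros x Hx; lra).
  destruct (Hstep s (conj Has Hsb)) as [delta [Hd Hst]].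
  assert (Hs : controlled s).
  { apply NNPP; intro Hn.
    assert (s <= s - delta); [|lra]. apply Hlub. intros x [Hx Hcx].
    apply Rnot_lt_le; intro Hlt. apply Hn.
    assert (x <= s) by (apply Hub; split; auto).
    apply (Hst x s); auto; lra. }
  destruct (Rle_lt_dec b s) as [Hbs|Hbs]; [replace b with s by lra; auto|].
  exfalso. pose (y := Rmin b (s + delta / 2)).
  assert (Hy : s < y <= b) by (unfold y; split; [apply Rmin_glb_lt; lra|apply Rmin_l]).
  assert (y <= s); [|lra]. apply Hub. split; [lra|].
  assert (y <= s + delta / 2) by apply Rmin_r.
  apply (Hst s y); auto; lra.
Qed.
End Nondecreasing.

(** Off the null set the decrease is at most [eps] per unit length, and on the intervals taken from
    the cover absolute continuity bounds the variation by [eps]. *)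
Lemma AC_nondecreasing (a b : R) (f : R -> R) (N : R -> Prop) :
  a <= b -> AC_on a b f -> null_set N ->
  (forall x, a < x < b -> ~ N x -> exists l, derivable_pt_lim f x l /\ 0 <= l) ->
  f a <= f b.
Proof.
  intros Hab Hf HN Hd.
  (* No derivative is assumed at the endpoints, so they join the exceptional set. *)
  assert (Hn' : null_set (fun x => (N x \/ x = a) \/ x = b)).
  { apply null_setU; [apply null_setU; auto|]; apply null_set1. }
  apply le_epsilon. intros e He.
  (* [eps * (b - a)] is lost through slopes and at most [eps] inside the cover, together less than
     [e]. *)
  pose (eps := e / (b - a + 2)).
  assert (Heps : 0 < eps) by (apply Rdiv_lt_0_compat; lra).
  destruct (Hf eps Heps) as [delta [Hdel HAC]].
  destruct (Hn' (delta / 2) ltac:(lra)) as (u & v & Huv & Hcov & Hsum).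
  destruct (controlled_all u v a b eps f Hab ltac:(lra)) as (m & n & s & t & H1 & H2 & H3 & H4).
  { intros x Hx.
    destruct (classic ((N x \/ x = a) \/ x = b)) as [HNx|HNx]; [left; apply Hcov; auto|right].
    destruct (Hd x) as [l [Hl Hl0]].
    { split; apply Rnot_le_lt; intro; apply HNx; [left|]; right; lra. }
    { intro; apply HNx; auto. }
    destruct (Hl eps Heps) as [r Hr]. exists r. split; [apply cond_pos|].
    assert (Hq : forall y, Rabs (y - x) < r -> y <> x -> - eps < (f y - f x) / (y - x)).
    { intros y Hy Hne. specialize (Hr (y - x) ltac:(lra) Hy).
      replace (x + (y - x)) with y in Hr by ring. apply Rabs_def2 in Hr. lra. }
    intros y Hy. split; intro Hxy; destruct (Req_dec y x) as [->|Hne]; try lra.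
    - specialize (Hq y Hy Hne).
      assert (E : f y - f x = (f y - f x) / (y - x) * (y - x)) by (field; lra). nra.
    - specialize (Hq y Hy Hne).
      assert (E : f x - f y = (f y - f x) / (y - x) * (x - y)) by (field; lra). nra. }
  assert (Hs : sum_lt (fun k => Rabs (f (t k) - f (s k))) n < eps).
  { apply HAC; auto. eapply Rle_lt_trans; [apply H3|].
    pose proof (cover_len_bounds u v Huv m b). pose proof (cover_len_bounds u v Huv m a).
    specialize (Hsum m). simpl in *. lra. }
  assert (E : eps * (b - a + 2) = e) by (unfold eps; field; lra). nra.
Qed.

(** This is the integrated form of an inequality between a.e. derivatives. Later estimates use it to
    compare increments with those of an explicit function. *)
Lemma AC_deriv_le (a b : R) (f g : R -> R) (N : R -> Prop) :
  a <= b -> AC_on a b f -> AC_on a b g -> null_set N ->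
  (forall x, a < x < b -> ~ N x -> exists l m,
     derivable_pt_lim f x l /\ derivable_pt_lim g x m /\ l <= m) ->
  f b - f a <= g b - g a.
Proof.
  intros Hab Hf Hg HN H.
  pose proof (AC_nondecreasing a b (fun x => g x - f x) N Hab (AC_on_minus _ _ _ _ Hg Hf) HN)
    as Hle. simpl in Hle.
  assert (g a - f a <= g b - f b); [|lra]. apply Hle.
  intros x Hx HNx. destruct (H x Hx HNx) as (l & m & Hl & Hm & Hlm).
  exists (m - l). split; [|lra]. apply derivable_pt_lim_minus; auto.
Qed.

(** * Functions with Lipschitz derivative *)

Definition clamp (c d x : R) : R := Rmax c (Rmin d x).

Lemma clamp_in c d x : c <= d -> c <= clamp c d x <= d.
Proof.
  intros H. unfold clamp. split; [apply Rmax_l|]. apply Rmax_lub; auto. apply Rmin_l.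
Qed.

Lemma clamp_id c d x : c <= x <= d -> clamp c d x = x.
Proof. intros H. unfold clamp. rewrite Rmin_right, Rmax_right; lra. Qed.

Lemma clamp_lip c d x y : Rabs (clamp c d x - clamp c d y) <= Rabs (x - y).
Proof.
  unfold clamp, Rmax, Rmin.
  destruct (Rle_dec d x), (Rle_dec d y);
    repeat (destruct (Rle_dec _ _)); unfold Rabs; repeat destruct (Rcase_abs _); lra.
Qed.

Lemma continuity_eps (f : R -> R) :
  (forall x eps, 0 < eps -> exists delta, 0 < delta /\
     forall y, Rabs (y - x) < delta -> Rabs (f y - f x) < eps) -> continuity f.
Proof.
  intros H x eps He. destruct (H x eps He) as [d [Hd Hf]].
  exists d. split; auto. intros y [_ Hy]. apply Hf, Hy.
Qed.

Lemma continuity_lipschitz (K : R) (f : R -> R) :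
  (forall x y, Rabs (f x - f y) <= K * Rabs (x - y)) -> continuity f.
Proof.
  intros H. apply continuity_eps. intros x eps He. pose proof (Rabs_pos K) as HK.
  exists (eps / (Rabs K + 1)). split; [apply Rdiv_lt_0_compat; lra|].
  intros y Hy. pose proof (Rabs_pos (y - x)).
  apply Rle_lt_trans with ((Rabs K + 1) * Rabs (y - x)).
  - eapply Rle_trans; [apply H|]. apply Rmult_le_compat_r; auto.
    pose proof (Rle_abs K); lra.
  - replace eps with ((Rabs K + 1) * (eps / (Rabs K + 1))) by (field; lra).
    apply Rmult_lt_compat_l; lra.
Qed.

Lemma continuity_clamp c d : continuity (clamp c d).
Proof.
  apply (continuity_lipschitz 1). intros x y. rewrite Rmult_1_l. apply clamp_lip.
Qed.

(** Facts about functions continuous on the line, such as the existence of maxima, transfer in this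
    way to functions known only on [[a, b]]. *)
Lemma cont_on_clamp a b f : a <= b ->
  cont_on a b f <-> continuity (fun x => f (clamp a b x)).
Proof.
  intros Hab. split.
  - intros H. apply continuity_eps. intros x eps He.
    destruct (H (clamp a b x) (clamp_in a b x Hab) eps He) as [d [Hd Hf]].
    exists d; split; auto. intros y Hy. apply Hf; [apply clamp_in; auto|].
    eapply Rle_lt_trans; [apply clamp_lip|auto].
  - intros H x Hx eps He. destruct (H x eps He) as [d [Hd Hf]].
    exists d; split; auto. intros y Hy Hyx.
    destruct (Req_dec y x) as [->|Hne]; [rewrite Rminus_diag, Rabs_R0; auto|].
    specialize (Hf y). simpl in Hf. unfold R_dist in Hf.
    rewrite !clamp_id in Hf by auto. apply Hf. split; auto.
    split; [exact I|auto].
Qed.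

Lemma cont_on_lipschitz a b K f :
  (forall x y, a <= x <= b -> a <= y <= b -> Rabs (f x - f y) <= K * Rabs (x - y)) ->
  cont_on a b f.
Proof. intros H. apply AC_on_cont, (AC_on_lipschitz a b K), H. Qed.

Lemma cont_on_continuity a b f : continuity f -> cont_on a b f.
Proof.
  intros H x _ eps He. destruct (H x eps He) as [d [Hd Hf]].
  exists d; split; auto. intros y _ Hyx.
  destruct (Req_dec y x) as [->|Hne]; [rewrite Rminus_diag, Rabs_R0; auto|].
  apply Hf. split; [split; [exact I|auto]|exact Hyx].
Qed.

Lemma cont_on_sub a b a' b' f : cont_on a b f -> a <= a' -> b' <= b -> cont_on a' b' f.
Proof.
  intros H Ha Hb x Hx eps He. destruct (H x ltac:(lra) eps He) as [d [Hd Hf]].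
  exists d; split; auto. intros y Hy. apply Hf. lra.
Qed.

Lemma cont_on_empty a b f : b < a -> cont_on a b f.
Proof. intros H x Hx. lra. Qed.

Lemma cont_on_plus a b f g :
  cont_on a b f -> cont_on a b g -> cont_on a b (fun x => f x + g x).
Proof.
  intros Hf Hg. destruct (Rle_lt_dec a b) as [Hab|Hab]; [|apply cont_on_empty; auto].
  apply cont_on_clamp in Hf; auto. apply cont_on_clamp in Hg; auto.
  apply cont_on_clamp; auto. exact (continuity_plus _ _ Hf Hg).
Qed.

Lemma cont_on_mult a b f g :
  cont_on a b f -> cont_on a b g -> cont_on a b (fun x => f x * g x).
Proof.
  intros Hf Hg. destruct (Rle_lt_dec a b) as [Hab|Hab]; [|apply cont_on_empty; auto].
  apply cont_on_clamp in Hf; auto. apply cont_on_clamp in Hg; auto.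
  apply cont_on_clamp; auto. exact (continuity_mult _ _ Hf Hg).
Qed.

Lemma cont_on_minus a b f g :
  cont_on a b f -> cont_on a b g -> cont_on a b (fun x => f x - g x).
Proof.
  intros Hf Hg. destruct (Rle_lt_dec a b) as [Hab|Hab]; [|apply cont_on_empty; auto].
  apply cont_on_clamp in Hf; auto. apply cont_on_clamp in Hg; auto.
  apply cont_on_clamp; auto. exact (continuity_minus _ _ Hf Hg).
Qed.

Lemma cont_on_comp a b f g : cont_on a b f -> continuity g -> cont_on a b (fun x => g (f x)).
Proof.
  intros Hf Hg. destruct (Rle_lt_dec a b) as [Hab|Hab]; [|apply cont_on_empty; auto].
  apply cont_on_clamp in Hf; auto. apply cont_on_clamp; auto.
  exact (continuity_comp _ _ Hf Hg).
Qed.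

Lemma cont_on_max a b f : a <= b -> cont_on a b f ->
  exists x0, a <= x0 <= b /\ forall x, a <= x <= b -> f x <= f x0.
Proof.
  intros Hab Hf. apply cont_on_clamp in Hf; auto.
  destruct (continuity_ab_maj _ a b Hab (fun x _ => Hf x)) as [x0 [H1 H2]].
  exists x0. split; auto. intros x Hx. specialize (H1 x Hx).
  rewrite !clamp_id in H1; auto.
Qed.

(** A function known only on [[a, b]] has a meaningful two-sided derivative at interior points only.
    The endpoints form a null set, so [ae_in_on] leads back to [ae_on]. *)
Definition ae_in (a b : R) (P : R -> Prop) : Prop :=
  exists N, null_set N /\ forall x, a < x < b -> ~ N x -> P x.

Lemma ae_in_sub a b a' b' P : ae_in a b P -> a <= a' -> b' <= b -> ae_in a' b' P.
Proof.
  intros [N [HN H]] Ha Hb. exists N; split; auto. intros x Hx. apply H. lra.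
Qed.

Lemma ae_on_in a b P : ae_on a b P -> ae_in a b P.
Proof. intros [N [HN H]]. exists N; split; auto. intros x Hx. apply H. lra. Qed.

Lemma ae_in_on a b P : ae_in a b P -> ae_on a b P.
Proof.
  intros [N [HN H]]. exists (fun x => (N x \/ x = a) \/ x = b). split.
  - apply null_setU; [apply null_setU; auto|]; apply null_set1.
  - intros x Hx Hn. apply H.
    + split; apply Rnot_le_lt; intro; apply Hn; [left|]; right; lra.
    + intro; apply Hn; auto.
Qed.

Lemma ae_in_and a b P Q : ae_in a b P -> ae_in a b Q -> ae_in a b (fun x => P x /\ Q x).
Proof.
  intros [N [HN H]] [M [HM H']]. exists (fun x => N x \/ M x).
  split; [apply null_setU; auto|]. intros x Hx Hn.
  split; [apply H|apply H']; auto.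
Qed.

Lemma ae_in_impl a b (P Q : R -> Prop) :
  (forall x, a < x < b -> P x -> Q x) -> ae_in a b P -> ae_in a b Q.
Proof. intros HPQ [N [HN H]]. exists N; split; auto. Qed.

Lemma derivable_pt_lim_local (f g : R -> R) a b x l :
  a < x < b -> (forall y, a < y < b -> f y = g y) ->
  derivable_pt_lim f x l -> derivable_pt_lim g x l.
Proof.
  intros Hx Hfg Hf eps He. destruct (Hf eps He) as [d Hd].
  assert (Hp : 0 < Rmin d (Rmin (x - a) (b - x))).
  { repeat apply Rmin_glb_lt; try lra. apply cond_pos. }
  exists (mkposreal _ Hp). simpl. intros h Hh Hl.
  destruct (Rmin_Rgt_l _ _ _ Hl) as [Hl1 Hl']. destruct (Rmin_Rgt_l _ _ _ Hl') as [Hl2 Hl3].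
  rewrite <- !Hfg; auto. split; unfold Rabs in *; destruct (Rcase_abs h); lra.
Qed.

Lemma derivable_pt_lim_linear k x : derivable_pt_lim (fun t => k * t) x k.
Proof.
  intros eps He. exists (mkposreal 1 Rlt_0_1). intros h Hh _.
  replace ((k * (x + h) - k * x) / h - k) with 0 by (field; auto).
  rewrite Rabs_R0. exact He.
Qed.

Lemma derivative_at_max (f : R -> R) a b x0 l :
  a < x0 < b -> (forall x, a < x < b -> f x <= f x0) ->
  derivable_pt_lim f x0 l -> l = 0.
Proof.
  intros Hx Hmax Hl.
  pose (pr := exist _ l Hl : derivable_pt f x0).
  assert (E : derive_pt f x0 pr = l) by reflexivity.
  rewrite <- E. apply (deriv_maximum f a b x0 pr); try lra. intros; apply Hmax; lra.
Qed.

(** A quantitative form of [V' = Z] with [Z] Lipschitz, endpoints included. It consists of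
    non-strict inequalities between values, so it survives pointwise limits with the same [K]. *)
Definition C11 (c d K : R) (V Z : R -> R) : Prop :=
  (forall x, c <= x <= d -> Rabs (Z x) <= K) /\
  (forall x y, c <= x <= d -> c <= y <= d ->
     Rabs (V y - V x - Z x * (y - x)) <= K * (y - x) ^ 2).

Lemma C11_K_nonneg c d K V Z : c <= d -> C11 c d K V Z -> 0 <= K.
Proof.
  intros H [H1 _]. specialize (H1 c ltac:(lra)). pose proof (Rabs_pos (Z c)). lra.
Qed.

(** The Taylor remainders at [x] and at [y] add up to [(Z x - Z y) * (y - x)] up to sign. *)
Lemma C11_deriv_lipschitz c d K V Z : C11 c d K V Z -> forall x y,
  c <= x <= d -> c <= y <= d -> Rabs (Z x - Z y) <= 2 * K * Rabs (x - y).
Proof.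
  intros [_ H] x y Hx Hy. destruct (Req_dec x y) as [->|Hne].
  { rewrite !Rminus_diag, Rabs_R0. lra. }
  apply Rmult_le_reg_r with (Rabs (y - x)); [apply Rabs_pos_lt; lra|].
  rewrite <- Rabs_mult.
  replace ((Z x - Z y) * (y - x)) with
    (- (V y - V x - Z x * (y - x)) - (V x - V y - Z y * (x - y))) by ring.
  rewrite (Rabs_minus_sym x y), Rmult_assoc, <- Rabs_mult, (Rabs_right ((y - x) * (y - x)))
    by (apply Rle_ge, Rle_0_sqr).
  pose proof (H x y Hx Hy). pose proof (H y x Hy Hx).
  eapply Rle_trans; [apply Rabs_triang|]. rewrite !Rabs_Ropp. nra.
Qed.

Lemma C11_lipschitz c d K V Z : C11 c d K V Z -> forall x y,
  c <= x <= d -> c <= y <= d -> Rabs (V x - V y) <= (K + K * (d - c)) * Rabs (x - y).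
Proof.
  intros HC x y Hx Hy. pose proof (C11_K_nonneg c d K V Z ltac:(lra) HC) as HK.
  destruct HC as [H0 H].
  replace (V x - V y) with ((V x - V y - Z y * (x - y)) + Z y * (x - y)) by ring.
  eapply Rle_trans; [apply Rabs_triang|]. rewrite Rabs_mult.
  specialize (H y x Hy Hx). specialize (H0 y Hy).
  assert (E : (x - y) ^ 2 = Rabs (x - y) * Rabs (x - y)).
  { rewrite <- Rabs_mult, Rabs_right by (apply Rle_ge, Rle_0_sqr). ring. }
  rewrite E in H. pose proof (Rabs_pos (x - y)).
  assert (Rabs (x - y) <= d - c) by (unfold Rabs; destruct (Rcase_abs _); lra).
  assert (Rabs (Z y) * Rabs (x - y) <= K * Rabs (x - y)) by nra.
  assert (K * Rabs (x - y) * Rabs (x - y) <= K * Rabs (x - y) * (d - c))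
    by (apply Rmult_le_compat_l; nra). nra.
Qed.

Lemma C11_deriv_on c d K V Z : C11 c d K V Z -> deriv_on c d V Z.
Proof.
  intros HC x Hx eps He. pose proof (C11_K_nonneg c d K V Z ltac:(lra) HC) as HK.
  destruct HC as [_ H]. exists (eps / (K + 1)). split; [apply Rdiv_lt_0_compat; lra|].
  intros y [[Hy Hne] Hd]. simpl in *. unfold R_dist in *.
  specialize (H x y Hx Hy).
  replace ((V y - V x) / (y - x) - Z x) with ((V y - V x - Z x * (y - x)) / (y - x))
    by (field; lra).
  unfold Rdiv. rewrite Rabs_mult, Rabs_inv.
  assert (Hp : 0 < Rabs (y - x)) by (apply Rabs_pos_lt; lra).
  apply Rmult_lt_reg_r with (Rabs (y - x)); auto.
  rewrite Rmult_assoc, Rinv_l, Rmult_1_r by lra.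
  eapply Rle_lt_trans; [apply H|].
  replace ((y - x) * ((y - x) * 1)) with (Rabs (y - x) * Rabs (y - x))
    by (rewrite <- Rabs_mult, Rabs_right by (apply Rle_ge, Rle_0_sqr); ring).
  assert (Hb : (K + 1) * Rabs (y - x) < eps).
  { replace eps with ((K + 1) * (eps / (K + 1))) by (field; lra).
    apply Rmult_lt_compat_l; lra. }
  apply (Rmult_lt_compat_r (Rabs (y - x))) in Hb; auto.
  pose proof (Rmult_lt_0_compat _ _ Hp Hp). nra.
Qed.

Lemma deriv_on_derivable c d V Z x :
  deriv_on c d V Z -> c < x < d -> derivable_pt_lim V x (Z x).
Proof.
  intros HC Hx eps He. destruct (HC x ltac:(lra) eps He) as [a [Ha H]].
  assert (Hp : 0 < Rmin a (Rmin (x - c) (d - x))) by (repeat apply Rmin_glb_lt; lra).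
  exists (mkposreal _ Hp). simpl. intros h Hh Hl.
  destruct (Rmin_Rgt_l _ _ _ Hl) as [Hl1 Hl']. destruct (Rmin_Rgt_l _ _ _ Hl') as [Hl2 Hl3].
  specialize (H (x + h)). simpl in H. unfold R_dist in H.
  replace (x + h - x) with h in H by ring. apply H. split; auto. split; [|lra].
  unfold Rabs in *; destruct (Rcase_abs h); lra.
Qed.

Lemma C11_derivable c d K V Z x :
  C11 c d K V Z -> c < x < d -> derivable_pt_lim V x (Z x).
Proof. intros HC. apply deriv_on_derivable. eapply C11_deriv_on; eauto. Qed.

(** At the touching point the first derivatives agree. To its right [f' - g'] grows at rate at least
    [eta], which lifts [f] strictly above [g]. *)
Lemma touching_second_order (a b eta x0 : R) (f g f' g' : R -> R) :
  a < x0 < b -> 0 < eta ->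
  (forall x, a < x < b -> derivable_pt_lim f x (f' x)) ->
  (forall x, a < x < b -> derivable_pt_lim g x (g' x)) ->
  AC_on a b f' -> AC_on a b g' ->
  (forall x, a < x < b -> f x <= g x) -> f x0 = g x0 ->
  ae_in a b (fun x => exists l m,
    derivable_pt_lim f' x l /\ derivable_pt_lim g' x m /\ m + eta <= l) ->
  False.
Proof.
  intros Hx0 Heta Hf Hg Af Ag Hle Heq [N [HN Hae]].
  assert (H0 : f' x0 - g' x0 = 0).
  { apply (derivative_at_max (fun x => f x - g x) a b x0); auto.
    - intros x Hx. specialize (Hle x Hx). lra.
    - apply derivable_pt_lim_minus; auto. }
  assert (Hpos : forall x, x0 < x < b -> 0 < f' x - g' x).
  { intros x Hx.
    assert (eta * x - eta * x0 <= (f' x - g' x) - (f' x0 - g' x0)); [|nra].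
    apply (AC_deriv_le x0 x (fun t => eta * t) (fun t => f' t - g' t) N); auto; try lra.
    - apply AC_on_lipschitz with eta. intros. replace (eta * x1 - eta * y) with (eta * (x1 - y))
        by ring. rewrite Rabs_mult, (Rabs_right eta) by lra. lra.
    - apply AC_on_sub with a b; try lra. apply AC_on_minus; auto.
    - intros t Ht HNt. destruct (Hae t ltac:(lra) HNt) as (l & m & Hl & Hm & Hlm).
      exists eta, (l - m). split; [|split; [|lra]].
      + apply derivable_pt_lim_linear.
      + apply derivable_pt_lim_minus; auto. }
  pose (x1 := (x0 + b) / 2).
  destruct (MVT_cor2 (fun x => f x - g x) (fun x => f' x - g' x) x0 x1) as [xi [E Hxi]].
  { unfold x1; lra. }
  { intros t Ht. assert (a < t < b) by (unfold x1 in *; lra).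
    apply derivable_pt_lim_minus; auto. }
  specialize (Hpos xi ltac:(unfold x1 in *; lra)).
  specialize (Hle x1 ltac:(unfold x1 in *; lra)).
  assert (0 < (f' xi - g' xi) * (x1 - x0)) by (apply Rmult_lt_0_compat; lra). lra.
Qed.

(** * Comparison and limits of solutions *)

(** Continuity is required in [w] only, uniformly in [x], since H is merely measurable in [x]. *)
Definition equicont (c d : R) (h : R -> R -> R) : Prop :=
  forall eps, 0 < eps -> exists delta, 0 < delta /\
    forall x w w', c <= x <= d -> Rabs (w - w') < delta -> Rabs (h x w - h x w') < eps.

(** The local condition on lower solutions for an abstract right-hand side, so that it applies both
    to the equation and to its reflection. *)
Definition lower_at (c d : R) (h : R -> R -> R) (g : R -> R) (x0 : R) : Prop :=
  dini_Dlm_lt_Dup g x0 \/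
  exists a b, c <= a < x0 /\ x0 < b <= d /\
    exists g' : R -> R,
      (forall x, a < x < b -> derivable_pt_lim g x (g' x)) /\
      AC_on a b g' /\
      ae_on a b (fun x => exists l, derivable_pt_lim g' x l /\ h x (x * g' x - g x) <= l).

(* The quantity [x V' - V] does not change when a multiple of [x] is added to [V], so [g] is
   compared with the smallest [V + kappa x] lying above it. *)
Lemma comparison (c d K : R) (h : R -> R -> R) (g V Z r : R -> R) :
  0 < c -> c < d -> equicont c d h ->
  cont_on c d g -> (forall x0, c < x0 < d -> lower_at c d h g x0) ->
  C11 c d K V Z ->
  ae_in c d (fun x => derivable_pt_lim Z x (h x (x * Z x - V x) + r x)) ->
  cont_on c d r -> (forall x, c <= x <= d -> V x < g x -> r x < 0) ->
  g c <= V c -> g d <= V d ->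
  forall x, c <= x <= d -> g x <= V x.
Proof.
  intros Hc Hcd Hh Hg Hlow HC Hode Hr Hneg Hbc Hbd x1 Hx1.
  apply Rnot_lt_le; intro Hlt.
  assert (HV : cont_on c d V) by (eapply cont_on_lipschitz, C11_lipschitz, HC).
  assert (HZ : cont_on c d Z) by (eapply cont_on_lipschitz, C11_deriv_lipschitz, HC).
  assert (Hinv : cont_on c d (fun x => / x)).
  { apply cont_on_clamp; [lra|]. apply (continuity_inv (clamp c d)).
    - apply continuity_clamp.
    - intros x. pose proof (clamp_in c d x ltac:(lra)). lra. }
  destruct (cont_on_max c d (fun x => (g x - V x) * / x)) as [x0 [Hx0 Hmax]]; [lra| |].
  { apply cont_on_mult; auto. apply cont_on_minus; auto. }
  simpl in Hmax. set (kap := (g x0 - V x0) * / x0) in *.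
  assert (Hkap : 0 < kap).
  { specialize (Hmax x1 Hx1). eapply Rlt_le_trans; [|apply Hmax].
    apply Rmult_lt_0_compat; [lra|apply Rinv_0_lt_compat; lra]. }
  assert (Hle : forall x, c <= x <= d -> g x <= V x + kap * x).
  { intros x Hx. specialize (Hmax x Hx).
    apply (Rmult_le_compat_r x) in Hmax; [|lra].
    rewrite Rmult_assoc, Rinv_l in Hmax by lra. lra. }
  assert (Heq : g x0 = V x0 + kap * x0) by (unfold kap; field; lra).
  assert (Hgt : V x0 < g x0) by nra.
  assert (Hin : c < x0 < d).
  { split; apply Rnot_le_lt; intro; [replace x0 with c in * by lra|replace x0 with d in * by lra];
      lra. }
  assert (HG : forall x, c < x < d -> derivable_pt_lim (fun x => V x + kap * x) x (Z x + kap)).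
  { intros x Hx. apply derivable_pt_lim_plus; [eapply C11_derivable; eauto|].
    apply derivable_pt_lim_linear. }
  destruct (Hlow x0 Hin) as [(s1 & s2 & Hs & HL & HR)|(a & b & Ha & Hb & g' & Dg & Ag & Hae)].
  (* The differentiable function [V + kap x] lies above [g] and touches it at [x0]. Left quotients
     of [g] are therefore at least, and right quotients at most, those of [V + kap x], which near
     [x0] are all within [(s2 - s1) / 2] of its derivative. This excludes the kink. *)
  - destruct (HG x0 Hin ((s2 - s1) / 2) ltac:(lra)) as [del Hdel]. simpl in Hdel.
    pose (rho := Rmin del (Rmin (x0 - c) (d - x0))).
    assert (Hrho : 0 < rho) by (repeat apply Rmin_glb_lt; try lra; apply cond_pos).
    assert (Hr1 : rho <= del) by apply Rmin_l.
    assert (Hr2 : rho <= x0 - c) by (eapply Rle_trans; [apply Rmin_r|apply Rmin_l]).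
    assert (Hr3 : rho <= d - x0) by (eapply Rle_trans; [apply Rmin_r|apply Rmin_r]).
    destruct (HL rho Hrho) as [hl [Hhl Hql]]. destruct (HR rho Hrho) as [hr [Hhr Hqr]].
    pose proof (Hdel hl ltac:(lra) ltac:(rewrite Rabs_left; lra)) as El.
    pose proof (Hdel hr ltac:(lra) ltac:(rewrite Rabs_right; lra)) as Er.
    apply Rabs_def2 in El. apply Rabs_def2 in Er.
    pose proof (Hle (x0 + hl) ltac:(lra)) as Ll. pose proof (Hle (x0 + hr) ltac:(lra)) as Lr.
    set (Gl := V (x0 + hl) + kap * (x0 + hl)) in *.
    set (Gr := V (x0 + hr) + kap * (x0 + hr)) in *. rewrite <- Heq in El, Er.
    assert (Q1 : (Gl - g x0) / hl <= (g (x0 + hl) - g x0) / hl).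
    { unfold Rdiv. assert (/ hl < 0) by (apply Rinv_lt_0_compat; lra). nra. }
    assert (Q2 : (g (x0 + hr) - g x0) / hr <= (Gr - g x0) / hr).
    { unfold Rdiv. assert (0 < / hr) by (apply Rinv_0_lt_compat; lra). nra. }
    lra.
  - assert (Hg'0 : g' x0 = Z x0 + kap).
    { assert (g' x0 - (Z x0 + kap) = 0); [|lra].
      apply (derivative_at_max (fun x => g x - (V x + kap * x)) a b x0); [lra| |].
      - intros x Hx. specialize (Hle x ltac:(lra)). lra.
      - apply derivable_pt_lim_minus; [apply Dg; lra|apply HG; lra]. }
    pose proof (Hneg x0 Hx0 Hgt) as Hr0.
    (* One third of the gap [- r x0] pays for the variation of [r], one for the change in the
       argument of [h], and one remains as the strict gap of second derivatives. *)
    pose (eta := - r x0 / 3). assert (Heta : 0 < eta) by (unfold eta; lra).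
    destruct (Hr x0 Hx0 eta Heta) as [d1 [Hd1 Hrc]].
    destruct (Hh eta Heta) as [d2 [Hd2 Hhc]].
    (* At [x0] the slope of [g] is [Z x0 + kap], and [kap] cancels in [x g' - g]. The two arguments
       of [h] agree there and stay close nearby. *)
    assert (HD : cont_on a b (fun x => (x * g' x - g x) - (x * Z x - V x))).
    { assert (Hid : cont_on a b (fun x => x))
        by (apply cont_on_continuity, derivable_continuous, derivable_id).
      apply cont_on_minus; apply cont_on_minus; try apply cont_on_mult; auto;
        try (apply cont_on_sub with c d; auto; lra).
      apply AC_on_cont; auto. }
    destruct (HD x0 ltac:(lra) d2 Hd2) as [d3 [Hd3 Hwc]]. simpl in Hwc.
    pose (rho := Rmin (Rmin d1 d3) (Rmin (x0 - a) (b - x0))).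
    assert (Hrho : 0 < rho) by (repeat apply Rmin_glb_lt; lra).
    assert (Hr1 : rho <= d1) by (eapply Rle_trans; [apply Rmin_l|apply Rmin_l]).
    assert (Hr2 : rho <= d3) by (eapply Rle_trans; [apply Rmin_l|apply Rmin_r]).
    assert (Hr3 : rho <= x0 - a) by (eapply Rle_trans; [apply Rmin_r|apply Rmin_l]).
    assert (Hr4 : rho <= b - x0) by (eapply Rle_trans; [apply Rmin_r|apply Rmin_r]).
    apply (touching_second_order (x0 - rho) (x0 + rho) eta x0 g (fun x => V x + kap * x)
             g' (fun x => Z x + kap)); auto; try lra.
    + intros x Hx. apply Dg; lra.
    + intros x Hx. apply HG; lra.
    + apply AC_on_sub with a b; auto; lra.
    + apply AC_on_lipschitz with (2 * K). intros x y Hx Hy.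
      replace (Z x + kap - (Z y + kap)) with (Z x - Z y) by ring.
      apply (C11_deriv_lipschitz c d K V Z HC); lra.
    + intros x Hx. apply Hle; lra.
    + assert (Hboth := ae_in_and _ _ _ _
        (ae_in_sub _ _ (x0 - rho) (x0 + rho) _ (ae_on_in _ _ _ Hae) ltac:(lra) ltac:(lra))
        (ae_in_sub _ _ (x0 - rho) (x0 + rho) _ Hode ltac:(lra) ltac:(lra))).
      revert Hboth. apply ae_in_impl. intros x Hx [[l [Hl Hhl]] HZx].
      exists l, (h x (x * Z x - V x) + r x + 0). split; [auto|split].
      * apply (derivable_pt_lim_plus Z (fun _ => kap)); auto. apply derivable_pt_lim_const.
      * assert (Hxx : Rabs (x - x0) < rho) by (apply Rabs_def1; lra).
        specialize (Hrc x ltac:(lra) ltac:(lra)). apply Rabs_def2 in Hrc.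
        specialize (Hwc x ltac:(lra) ltac:(lra)).
        replace (x * g' x - g x - (x * Z x - V x) - (x0 * g' x0 - g x0 - (x0 * Z x0 - V x0)))
          with (x * g' x - g x - (x * Z x - V x)) in Hwc by (rewrite Hg'0, Heq; ring).
        specialize (Hhc x _ _ ltac:(lra) Hwc). apply Rabs_def2 in Hhc.
        unfold eta in *. lra.
Qed.

Lemma is_lim_seq_bound (u : nat -> R) (l B : R) :
  is_lim_seq u l -> (forall n, Rabs (u n) <= B) -> Rabs l <= B.
Proof.
  intros Hu HB. apply is_lim_seq_abs in Hu.
  apply (is_lim_seq_le (fun n => Rabs (u n)) (fun _ => B) (Rabs l) B); auto.
  apply is_lim_seq_const.
Qed.

Lemma is_lim_seq_eps (u : nat -> R) (l : R) : is_lim_seq u l ->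
  forall eps, 0 < eps -> exists N, forall n, (N <= n)%nat -> Rabs (u n - l) < eps.
Proof.
  intros H eps He. apply is_lim_seq_Reals in H. destruct (H eps He) as [N HN].
  exists N. intros n Hn. apply HN. lia.
Qed.

(** [Zn n x] differs from the difference quotient of [Vn n] with step [e] by at most [K * e],
    uniformly in [n]. Convergence of the values therefore makes the derivatives Cauchy; the step
    goes to whichever side of [x] has room. *)
Lemma C11_limit (c d K : R) (Vn Zn : nat -> R -> R) (V : R -> R) :
  c < d -> (forall n, C11 c d K (Vn n) (Zn n)) ->
  (forall x, c <= x <= d -> is_lim_seq (fun n => Vn n x) (V x)) ->
  exists Z, C11 c d K V Z /\ forall x, c <= x <= d -> is_lim_seq (fun n => Zn n x) (Z x).
Proof.
  intros Hcd HC HV.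
  assert (HK : 0 <= K) by (apply (C11_K_nonneg c d K (Vn 0%nat) (Zn 0%nat)); auto; lra).
  assert (Hlim : forall x, exists z, c <= x <= d -> is_lim_seq (fun n => Zn n x) (Finite z)).
  { intros x. destruct (classic (c <= x <= d)) as [Hx|Hx]; [|exists 0; tauto].
    assert (Hex : ex_finite_lim_seq (fun n => Zn n x)).
    { apply ex_lim_seq_cauchy_corr. intros eps.
      pose (e := Rmin (eps / (4 * K + 4)) ((d - c) / 2)).
      assert (He : 0 < e).
      { apply Rmin_glb_lt; [|lra]. apply Rdiv_lt_0_compat; [apply cond_pos|lra]. }
      assert (He1 : e <= eps / (4 * K + 4)) by apply Rmin_l.
      assert (He2 : e <= (d - c) / 2) by apply Rmin_r.
      assert (Hy : exists y, c <= y <= d /\ Rabs (y - x) = e).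
      { destruct (Rle_lt_dec x ((c + d) / 2)).
        - exists (x + e). split; [lra|]. replace (x + e - x) with e by ring.
          apply Rabs_right; lra.
        - exists (x - e). split; [lra|]. replace (x - e - x) with (- e) by ring.
          rewrite Rabs_Ropp. apply Rabs_right; lra. }
      destruct Hy as [y [Hy Hyx]].
      assert (Heps : 0 < eps * e / 8) by (apply Rdiv_lt_0_compat; [apply Rmult_lt_0_compat|];
        auto; try lra; apply cond_pos).
      destruct (is_lim_seq_eps _ _ (HV x Hx) _ Heps) as [N1 H1].
      destruct (is_lim_seq_eps _ _ (HV y Hy) _ Heps) as [N2 H2].
      exists (Nat.max N1 N2). intros n m Hn Hm.
      destruct (HC n) as [_ Qn]. destruct (HC m) as [_ Qm].
      specialize (Qn x y Hx Hy). specialize (Qm x y Hx Hy).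
      replace ((y - x) ^ 2) with (e ^ 2) in Qn, Qm by (rewrite <- Hyx, pow2_abs; auto).
      pose proof (H1 n ltac:(lia)) as A1. pose proof (H1 m ltac:(lia)) as A2.
      pose proof (H2 n ltac:(lia)) as A3. pose proof (H2 m ltac:(lia)) as A4.
      apply Rmult_lt_reg_r with e; auto. rewrite <- Hyx at 1. rewrite <- Rabs_mult.
      assert (Hke : 4 * K * e < eps).
      { apply Rlt_le_trans with ((4 * K + 4) * e); [nra|].
        replace (pos eps) with ((4 * K + 4) * (eps / (4 * K + 4))) by (field; lra).
        apply Rmult_le_compat_l; lra. }
      apply Rabs_le_between in Qn. apply Rabs_le_between in Qm.
      apply Rabs_def2 in A1. apply Rabs_def2 in A2. apply Rabs_def2 in A3. apply Rabs_def2 in A4.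
      assert (2 * K * e ^ 2 < eps * e / 2) by (simpl; nra).
      apply Rabs_def1; lra. }
    destruct Hex as [z Hz]. exists z. auto. }
  apply choice in Hlim. destruct Hlim as [Z HZ]. exists Z. split; [split|auto].
  - intros x Hx. apply (is_lim_seq_bound (fun n => Zn n x)); auto. intros n. apply HC; auto.
  - intros x y Hx Hy.
    apply (is_lim_seq_bound (fun n => Vn n y - Vn n x - Zn n x * (y - x))).
    + apply (is_lim_seq_minus' (fun n => Vn n y - Vn n x) (fun n => Zn n x * (y - x))).
      * apply is_lim_seq_minus'; auto.
      * apply (is_lim_seq_scal_r (fun n => Zn n x) (y - x) (Z x)). auto.
    + intros n. apply HC; auto.
Qed.

(** On a grid of mesh [s] finitely many points have to converge; between grid points [fn n] and [f]
    each move by at most [L * s <= eps / 4]. The induction runs over the grid. *)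
Lemma lipschitz_limit_uniform (c d L : R) (fn : nat -> R -> R) (f : R -> R) :
  c <= d -> 0 <= L ->
  (forall n x y, c <= x <= d -> c <= y <= d -> Rabs (fn n x - fn n y) <= L * Rabs (x - y)) ->
  (forall x, c <= x <= d -> is_lim_seq (fun n => fn n x) (f x)) ->
  forall eps, 0 < eps -> exists N, forall n, (N <= n)%nat ->
    forall x, c <= x <= d -> Rabs (fn n x - f x) <= eps.
Proof.
  intros Hcd HL Hfn Hlim eps He.
  assert (Hf : forall x y, c <= x <= d -> c <= y <= d -> Rabs (f x - f y) <= L * Rabs (x - y)).
  { intros x y Hx Hy. apply (is_lim_seq_bound (fun n => fn n x - fn n y)); auto.
    apply is_lim_seq_minus'; auto. }
  pose (s := eps / (4 * (L + 1))).
  assert (Hs : 0 < s) by (apply Rdiv_lt_0_compat; lra).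
  assert (Hls : L * s <= eps / 4).
  { apply Rle_trans with ((L + 1) * s); [nra|]. unfold s. right. field. lra. }
  assert (Hm : forall m, exists N, forall n, (N <= n)%nat -> forall x, c <= x <= d ->
    x <= c + INR m * s -> Rabs (fn n x - f x) <= eps).
  { induction m as [|m [N1 IH]].
    - destruct (is_lim_seq_eps _ _ (Hlim c ltac:(lra)) eps He) as [N HN].
      exists N. intros n Hn x Hx Hxc. simpl in Hxc. replace x with c by lra.
      left. apply HN, Hn.
    - destruct (Rle_lt_dec (c + INR m * s) d) as [Hmd|Hmd].
      + pose (y := c + INR m * s).
        assert (Hy : c <= y <= d).
        { unfold y. split; auto. pose proof (pos_INR m). nra. }
        destruct (is_lim_seq_eps _ _ (Hlim y Hy) (eps / 2) ltac:(lra)) as [N2 HN].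
        exists (Nat.max N1 N2). intros n Hn x Hx Hxm.
        destruct (Rle_lt_dec x y) as [Hxy|Hxy]; [apply IH; auto; lia|].
        specialize (HN n ltac:(lia)). rewrite S_INR in Hxm.
        pose proof (Hfn n x y Hx Hy) as A1. pose proof (Hf x y Hx Hy) as A2.
        rewrite (Rabs_right (x - y)) in A1, A2 by lra.
        assert (L * (x - y) <= L * s) by (apply Rmult_le_compat_l; auto; unfold y; lra).
        apply Rabs_le_between in A1. apply Rabs_le_between in A2. apply Rabs_def2 in HN.
        apply Rabs_le_between. lra.
      + exists N1. intros n Hn x Hx _. apply IH; auto. lra. }
  destruct (INR_archimed s (d - c) Hs) as [m Hmm].
  destruct (Hm m) as [N HN]. exists N. intros n Hn x Hx. apply HN; auto. lra.
Qed.

(** The limit is taken in integrated form: comparing [Zn n] with [F t + eps * t] and [F t - eps * t]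
    shows that [Z] and the primitive [F] of [f] differ by a constant, so [Z] inherits the
    derivatives of [F]. *)
Lemma ode_limit (c d L : R) (Zn fn : nat -> R -> R) (Z f : R -> R) :
  c < d ->
  (forall n x y, c <= x <= d -> c <= y <= d -> Rabs (Zn n x - Zn n y) <= L * Rabs (x - y)) ->
  (forall x, c <= x <= d -> is_lim_seq (fun n => Zn n x) (Z x)) ->
  (forall n, ae_in c d (fun x => derivable_pt_lim (Zn n) x (fn n x))) ->
  (forall eps, 0 < eps -> exists N, forall n, (N <= n)%nat ->
    forall x, c <= x <= d -> Rabs (fn n x - f x) <= eps) ->
  has_primitive c d f ->
  ae_in c d (fun x => derivable_pt_lim Z x (f x)).
Proof.
  intros Hcd HL Hlim Hder Hunif (F & K & HF & HFd).
  assert (Hconst : forall x, c <= x <= d -> Z x - Z c = F x - F c).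
  { intros x Hx. apply cond_eq. intros e He.
    pose (eps := e / (d - c + 2)).
    assert (Heps : 0 < eps) by (apply Rdiv_lt_0_compat; lra).
    destruct (Hunif eps Heps) as [N1 HN1].
    destruct (is_lim_seq_eps _ _ (Hlim x Hx) (eps / 2) ltac:(lra)) as [N2 HN2].
    destruct (is_lim_seq_eps _ _ (Hlim c ltac:(lra)) (eps / 2) ltac:(lra)) as [N3 HN3].
    pose (n := Nat.max N1 (Nat.max N2 N3)).
    specialize (HN1 n ltac:(lia)). specialize (HN2 n ltac:(lia)). specialize (HN3 n ltac:(lia)).
    destruct (ae_in_and _ _ _ _ (Hder n) (ae_on_in _ _ _ HFd)) as [N [HN Hae]].
    assert (AZ : AC_on c x (Zn n)).
    { apply AC_on_lipschitz with L. intros; apply HL; lra. }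
    assert (ALin : forall s, AC_on c x (fun t => F t + s * t)).
    { intros s. apply AC_on_lipschitz with (K + Rabs s). intros t y _ _.
      replace (F t + s * t - (F y + s * y)) with ((F t - F y) + s * (t - y)) by ring.
      eapply Rle_trans; [apply Rabs_triang|]. rewrite Rabs_mult.
      specialize (HF t y). lra. }
    assert (DLin : forall s t, derivable_pt_lim F t (f t) ->
      derivable_pt_lim (fun t => F t + s * t) t (f t + s)).
    { intros s t Ht. apply derivable_pt_lim_plus; auto. apply derivable_pt_lim_linear. }
    assert (U : Zn n x - Zn n c <= (F x + eps * x) - (F c + eps * c)).
    { apply (AC_deriv_le c x (Zn n) (fun t => F t + eps * t) N); auto; try lra.
      intros t Ht HNt. destruct (Hae t ltac:(lra) HNt) as [D1 D2].
      exists (fn n t), (f t + eps). split; [auto|split; [auto|]].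
      specialize (HN1 t ltac:(lra)). apply Rabs_le_between in HN1. lra. }
    assert (U' : (F x + - eps * x) - (F c + - eps * c) <= Zn n x - Zn n c).
    { apply (AC_deriv_le c x (fun t => F t + - eps * t) (Zn n) N); auto; try lra.
      intros t Ht HNt. destruct (Hae t ltac:(lra) HNt) as [D1 D2].
      exists (f t + - eps), (fn n t). split; [auto|split; [auto|]].
      specialize (HN1 t ltac:(lra)). apply Rabs_le_between in HN1. lra. }
    apply Rabs_def2 in HN2. apply Rabs_def2 in HN3.
    assert (eps * (d - c + 2) = e) by (unfold eps; field; lra).
    assert (eps * (x - c) <= eps * (d - c)) by (apply Rmult_le_compat_l; lra).
    apply Rabs_def1; lra. }
  apply (ae_in_impl c d (fun x => derivable_pt_lim F x (f x))); [|apply ae_on_in, HFd].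
  intros x Hx Hd.
  apply (derivable_pt_lim_local (fun y => F y + (Z c - F c)) Z c d x); auto.
  - intros y Hy. specialize (Hconst y ltac:(lra)). lra.
  - replace (f x) with (f x + 0) by ring.
    apply (derivable_pt_lim_plus F (fun _ => Z c - F c)); auto. apply derivable_pt_lim_const.
Qed.

(** * Lipschitz Dirichlet problems *)

Lemma continuous_antiderivative (f : R -> R) (a : R) : continuity f ->
  exists F, F a = 0 /\ forall x, derivable_pt_lim F x (f x).
Proof.
  intros Hf. exists (fun x => RInt f a x). split; [exact (RInt_point a f)|].
  intros x. apply is_derive_Reals. apply (is_derive_RInt f (RInt f a) a x).
  - apply filter_forall. intros y. apply (@RInt_correct R_CompleteNormedModule).
    apply (@ex_RInt_continuous R_CompleteNormedModule).
    intros z _. apply continuity_pt_filterlim, Hf.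
  - apply continuity_pt_filterlim, Hf.
Qed.

Lemma derivative_bound_lipschitz (F f : R -> R) (M : R) :
  (forall x, derivable_pt_lim F x (f x)) -> (forall x, Rabs (f x) <= M) ->
  forall x y, Rabs (F x - F y) <= M * Rabs (x - y).
Proof.
  intros HF HM.
  assert (H : forall x y, x < y -> Rabs (F y - F x) <= M * Rabs (y - x)).
  { intros x y Hxy. destruct (MVT_cor2 F f x y Hxy (fun t _ => HF t)) as [t [-> _]].
    rewrite Rabs_mult. apply Rmult_le_compat_r; [apply Rabs_pos|auto]. }
  intros x y. destruct (Rtotal_order x y) as [Hxy|[->|Hxy]].
  - rewrite (Rabs_minus_sym (F x)), (Rabs_minus_sym x). auto.
  - rewrite !Rminus_diag, Rabs_R0. lra.
  - auto.
Qed.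

Lemma has_primitive_continuous (c d : R) (f : R -> R) :
  c <= d -> cont_on c d f -> has_primitive c d f.
Proof.
  intros Hcd Hf.
  destruct (cont_on_max c d (fun x => Rabs (f x)) Hcd) as [x0 [Hx0 Hmax]].
  { apply cont_on_comp; auto. exact Rcontinuity_abs. }
  apply cont_on_clamp in Hf; auto.
  destruct (continuous_antiderivative _ c Hf) as [F [_ HF]].
  exists F, (Rabs (f x0)). split.
  - apply (derivative_bound_lipschitz F (fun x => f (clamp c d x))); auto.
    intros x. apply Hmax. apply clamp_in; auto.
  - exists (fun x => x = c). split; [apply null_set1|]. intros x Hx _.
    specialize (HF x). simpl in HF. rewrite clamp_id in HF; auto.
Qed.

Lemma has_primitive_plus (c d : R) (f g : R -> R) :
  has_primitive c d f -> has_primitive c d g -> has_primitive c d (fun x => f x + g x).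
Proof.
  intros (F & K & HF & DF) (G & L & HG & DG).
  exists (fun x => F x + G x), (K + L). split.
  - intros x y. replace (F x + G x - (F y + G y)) with ((F x - F y) + (G x - G y)) by ring.
    eapply Rle_trans; [apply Rabs_triang|]. specialize (HF x y). specialize (HG x y). lra.
  - apply ae_in_on. generalize (ae_in_and _ _ _ _ (ae_on_in _ _ _ DF) (ae_on_in _ _ _ DG)).
    apply ae_in_impl. intros x _ [H1 H2]. apply derivable_pt_lim_plus; auto.
Qed.

Lemma has_primitive_ext (c d : R) (f g : R -> R) :
  (forall x, c <= x <= d -> f x = g x) -> has_primitive c d f -> has_primitive c d g.
Proof.
  intros Hfg (F & K & HF & N & HN & DF). exists F, K. split; auto. exists N. split; auto.
  intros x Hx HNx. rewrite <- Hfg by auto. auto.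
Qed.

Lemma has_primitive_opp (c d : R) (f : R -> R) :
  has_primitive c d f -> has_primitive c d (fun x => - f x).
Proof.
  intros (F & K & HF & N & HN & DF). exists (fun x => - F x), K. split.
  - intros x y. replace (- F x - - F y) with (- (F x - F y)) by ring. rewrite Rabs_Ropp. auto.
  - exists N. split; auto. intros x Hx HNx. apply derivable_pt_lim_opp. auto.
Qed.

Lemma AC_derivative_bound (c d K : R) (F : R -> R) :
  AC_on c d F -> ae_in c d (fun x => exists l, derivable_pt_lim F x l /\ Rabs l <= K) ->
  forall x y, c <= x <= d -> c <= y <= d -> Rabs (F x - F y) <= K * Rabs (x - y).
Proof.
  intros HF [N [HN Hae]].
  assert (ALin : forall s a b, AC_on a b (fun t => s * t)).
  { intros s a b. apply AC_on_lipschitz with (Rabs s). intros x y _ _.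
    replace (s * x - s * y) with (s * (x - y)) by ring. rewrite Rabs_mult. lra. }
  assert (H : forall x y, c <= x <= y -> y <= d -> Rabs (F x - F y) <= K * Rabs (x - y)).
  { intros x y Hx Hy. rewrite Rabs_minus_sym, (Rabs_left1 (x - y)) by lra.
    assert (AF : AC_on x y F) by (apply AC_on_sub with c d; auto; lra).
    assert (U : F y - F x <= K * y - K * x).
    { apply (AC_deriv_le x y F (fun t => K * t) N); auto; try lra.
      intros t Ht HNt. destruct (Hae t ltac:(lra) HNt) as [l [Hl Hb]].
      exists l, K. split; [auto|split; [apply derivable_pt_lim_linear|]].
      apply Rabs_le_between in Hb. lra. }
    assert (U' : (- K) * y - (- K) * x <= F y - F x).
    { apply (AC_deriv_le x y (fun t => (- K) * t) F N); auto; try lra.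
      intros t Ht HNt. destruct (Hae t ltac:(lra) HNt) as [l [Hl Hb]].
      exists (- K), l. split; [apply derivable_pt_lim_linear|split; [auto|]].
      apply Rabs_le_between in Hb. lra. }
    apply Rabs_le_between. lra. }
  intros x y Hx Hy. destruct (Rle_lt_dec x y); [apply H; lra|].
  rewrite (Rabs_minus_sym (F x)), (Rabs_minus_sym x). apply H; lra.
Qed.

(** The bound on the derivative is itself the derivative of [B / lam * exp (lam * (t - c))]. The
    gained factor [1 / lam] is what makes Picard iteration contract on an interval of any length. *)
Lemma AC_exponential_bound (c d lam B : R) (D : R -> R) :
  0 < lam -> 0 <= B -> AC_on c d D -> D c = 0 ->
  ae_in c d (fun x => exists l, derivable_pt_lim D x l /\ Rabs l <= B * exp (lam * (x - c))) ->
  forall x, c <= x <= d -> Rabs (D x) <= B / lam * exp (lam * (x - c)).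
Proof.
  intros Hlam HB HD HD0 [N [HN Hae]] x Hx.
  assert (DE : forall s t, derivable_pt_lim (fun t => s / lam * exp (lam * (t - c))) t
                                          (s * exp (lam * (t - c)))).
  { intros s t. apply is_derive_Reals. unfold Rminus. auto_derive; auto. field. lra. }
  assert (AE : forall s, AC_on c x (fun t => s / lam * exp (lam * (t - c)))).
  { intros s. apply AC_on_lipschitz with (Rabs s * exp (lam * (x - c))).
    assert (H : forall t y, c <= t <= y -> y <= x ->
      Rabs (s / lam * exp (lam * (y - c)) - s / lam * exp (lam * (t - c))) <=
      Rabs s * exp (lam * (x - c)) * Rabs (y - t)).
    { intros t y Ht Hy. destruct (Req_dec t y) as [->|Hne].
      { rewrite !Rminus_diag, Rabs_R0. lra. }
      destruct (MVT_cor2 (fun t => s / lam * exp (lam * (t - c)))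
        (fun t => s * exp (lam * (t - c))) t y ltac:(lra) (fun z _ => DE s z)) as [z [E Hz]].
      rewrite E, Rabs_mult. apply Rmult_le_compat_r; [apply Rabs_pos|].
      rewrite Rabs_mult. apply Rmult_le_compat_l; [apply Rabs_pos|].
      rewrite Rabs_right by (left; apply exp_pos).
      left. apply exp_increasing. apply Rmult_lt_compat_l; lra. }
    intros t y Ht Hy. destruct (Rle_lt_dec y t).
    - apply H; lra.
    - rewrite Rabs_minus_sym, (Rabs_minus_sym t). apply H; lra. }
  assert (AD : AC_on c x D) by (apply AC_on_sub with c d; auto; lra).
  assert (He0 : exp (lam * (c - c)) = 1) by (rewrite Rminus_diag, Rmult_0_r; apply exp_0).
  assert (HBl : 0 <= B / lam) by (apply Rmult_le_pos; auto; left; apply Rinv_0_lt_compat; auto).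
  assert (U : D x - D c <= B / lam * exp (lam * (x - c)) - B / lam * exp (lam * (c - c))).
  { apply (AC_deriv_le c x D (fun t => B / lam * exp (lam * (t - c))) N); auto; try lra.
    intros t Ht HNt. destruct (Hae t ltac:(lra) HNt) as [l [Hl Hb]].
    exists l, (B * exp (lam * (t - c))). split; [auto|split; [apply DE|]].
    apply Rabs_le_between in Hb. lra. }
  assert (U' : - B / lam * exp (lam * (x - c)) - - B / lam * exp (lam * (c - c)) <= D x - D c).
  { apply (AC_deriv_le c x (fun t => - B / lam * exp (lam * (t - c))) D N); auto; try lra.
    intros t Ht HNt. destruct (Hae t ltac:(lra) HNt) as [l [Hl Hb]].
    exists (- B * exp (lam * (t - c))), l. split; [apply DE|split; [auto|]].
    apply Rabs_le_between in Hb. lra. }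
  rewrite HD0, He0 in U, U'. apply Rabs_le_between. unfold Rdiv in *. lra.
Qed.

Lemma geometric_limit (u : nat -> R) (B : R) :
  (forall k, Rabs (u (S k) - u k) <= B * (/ 2) ^ k) ->
  exists l : R, is_lim_seq u l /\ forall k, Rabs (u k - l) <= 2 * B * (/ 2) ^ k.
Proof.
  intros H.
  assert (Hp : forall k, 0 < (/ 2) ^ k) by (intros; apply pow_lt; lra).
  assert (HB : 0 <= B).
  { specialize (H 0%nat). simpl in H. pose proof (Rabs_pos (u 1%nat - u 0%nat)). lra. }
  assert (Hk : forall m k, Rabs (u (k + m)%nat - u k) <= 2 * B * (/ 2) ^ k).
  { intros m k. assert (Rabs (u (k + m)%nat - u k) <= 2 * B * ((/ 2) ^ k - (/ 2) ^ (k + m))).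
    { induction m as [|m IH].
      - rewrite Nat.add_0_r, !Rminus_diag, Rabs_R0. lra.
      - rewrite Nat.add_succ_r. specialize (H (k + m)%nat). simpl.
        replace (u (S (k + m)) - u k) with
          ((u (S (k + m)) - u (k + m)%nat) + (u (k + m)%nat - u k)) by ring.
        eapply Rle_trans; [apply Rabs_triang|]. lra. }
    specialize (Hp (k + m)%nat). nra. }
  assert (Hex : ex_finite_lim_seq u).
  { apply ex_lim_seq_cauchy_corr. intros eps.
    assert (Hl : is_lim_seq (fun k => 2 * B * (/ 2) ^ k) 0).
    { replace (Finite 0) with (Rbar_mult (2 * B) 0) by (simpl; f_equal; ring).
      apply is_lim_seq_scal_l. apply is_lim_seq_geom. rewrite Rabs_right; lra. }
    destruct (is_lim_seq_eps _ _ Hl (eps / 2)) as [N HN].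
    { pose proof (cond_pos eps). lra. }
    exists N. specialize (HN N (le_n N)). rewrite Rminus_0_r in HN. apply Rabs_def2 in HN.
    intros n m Hn Hm.
    pose proof (Hk (n - N)%nat N) as A1. pose proof (Hk (m - N)%nat N) as A2.
    replace (N + (n - N))%nat with n in A1 by lia. replace (N + (m - N))%nat with m in A2 by lia.
    apply Rabs_le_between in A1. apply Rabs_le_between in A2. apply Rabs_def1; lra. }
  destruct Hex as [l Hl]. exists l. split; auto. intros k.
  rewrite Rabs_minus_sym. apply (is_lim_seq_bound (fun m => u (k + m)%nat - u k)); auto.
  apply is_lim_seq_minus'; [|apply is_lim_seq_const].
  apply (is_lim_seq_ext (fun m => u (m + k)%nat)); [intros; f_equal; lia|].
  apply is_lim_seq_incr_n. auto.
Qed.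

(** * Picard iteration and shooting *)

Section Shooting.
Variables (c d L K : R) (G : R -> R -> R -> R).
Hypothesis Hcd : c < d.
Hypothesis HL : 0 <= L.
Hypothesis G_lip : forall x v z v' z', c <= x <= d ->
  Rabs (G x v z - G x v' z') <= L * (Rabs (v - v') + Rabs (z - z')).
Hypothesis G_bound : forall x v z, c <= x <= d -> Rabs (G x v z) <= K.
Hypothesis G_prim : forall V Z, continuity V -> continuity Z ->
  has_primitive c d (fun x => G x (V x) (Z x)).

Let HK : 0 <= K.
Proof. pose proof (G_bound c 0 0 ltac:(lra)). pose proof (Rabs_pos (G c 0 0)). lra. Qed.

(** Choice turns antiderivatives into one operator; its value on discontinuous functions is
    arbitrary. The integral functional used for the greatest solution is built from it too. *)
Lemma antiderivative_operator : exists J : (R -> R) -> R -> R, forall Z, continuity Z ->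
  J Z c = 0 /\ forall x, derivable_pt_lim (J Z) x (Z x).
Proof.
  apply (choice (fun (Z F : R -> R) => continuity Z ->
    F c = 0 /\ forall x, derivable_pt_lim F x (Z x))).
  intros Z. destruct (classic (continuity Z)) as [H|H].
  - destruct (continuous_antiderivative Z c H) as [F HF]. exists F. auto.
  - exists Z. tauto.
Qed.

Variable J : (R -> R) -> R -> R.
Hypothesis HJ : forall Z, continuity Z ->
  J Z c = 0 /\ forall x, derivable_pt_lim (J Z) x (Z x).
Variable Y : R.

Let J_cont Z : continuity Z -> continuity (fun x => Y + J Z x).
Proof.
  intros HZ. destruct (HJ Z HZ) as [_ HD]. apply derivable_continuous. intros x.
  exists (0 + Z x). apply (derivable_pt_lim_plus (fun _ => Y)); [apply derivable_pt_lim_const|apply HD].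
Qed.

(** The given primitive has some unknown Lipschitz constant; the bound on [G] improves it to [K].
    Clamping makes the estimate hold on the whole line, so all iterates are continuous. *)
Lemma picard_operator : exists T : (R -> R) -> R -> R, forall Z, continuity Z ->
  T Z c = 0 /\ (forall x y, Rabs (T Z x - T Z y) <= K * Rabs (x - y)) /\
  (forall x, T Z (clamp c d x) = T Z x) /\
  ae_in c d (fun x => derivable_pt_lim (T Z) x (G x (Y + J Z x) (Z x))).
Proof.
  apply (choice (fun (Z F : R -> R) => continuity Z ->
    F c = 0 /\ (forall x y, Rabs (F x - F y) <= K * Rabs (x - y)) /\
    (forall x, F (clamp c d x) = F x) /\
    ae_in c d (fun x => derivable_pt_lim F x (G x (Y + J Z x) (Z x))))).
  intros Z. destruct (classic (continuity Z)) as [HZ|HZ]; [|exists Z; tauto].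
  destruct (G_prim _ _ (J_cont Z HZ) HZ) as (F & M & HF & DF). apply ae_on_in in DF.
  exists (fun x => F (clamp c d x) - F c). intros _.
  assert (HcL : forall x, c <= clamp c d x <= d) by (intros; apply clamp_in; lra).
  repeat split.
  - rewrite clamp_id by lra. ring.
  - intros x y.
    replace (F (clamp c d x) - F c - (F (clamp c d y) - F c)) with
      (F (clamp c d x) - F (clamp c d y)) by ring.
    apply Rle_trans with (K * Rabs (clamp c d x - clamp c d y)).
    + apply (AC_derivative_bound c d); auto.
      * apply AC_on_lipschitz with M. auto.
      * revert DF. apply ae_in_impl. intros t Ht Hd. eexists. split; [apply Hd|].
        apply G_bound. lra.
    + apply Rmult_le_compat_l; auto. apply clamp_lip.
  - intros x. rewrite (clamp_id c d (clamp c d x)); auto.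
  - revert DF. apply ae_in_impl. intros t Ht Hd.
    apply (derivable_pt_lim_local (fun x => F x - F c) _ c d); auto.
    + intros y Hy. rewrite clamp_id by lra. auto.
    + rewrite <- (Rminus_0_r (G _ _ _)).
      apply (derivable_pt_lim_minus F (fun _ => F c)); auto. apply derivable_pt_lim_const.
Qed.

Variable T : (R -> R) -> R -> R.
Hypothesis HT : forall Z, continuity Z ->
  T Z c = 0 /\ (forall x y, Rabs (T Z x - T Z y) <= K * Rabs (x - y)) /\
  (forall x, T Z (clamp c d x) = T Z x) /\
  ae_in c d (fun x => derivable_pt_lim (T Z) x (G x (Y + J Z x) (Z x))).

(* In the norm [sup |Z x| / E x] the Picard operator is a contraction of ratio [1/2]. *)
Let lam := 4 * L + 1.
Let E (x : R) := exp (lam * (x - c)).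

Let E_ge1 x : c <= x -> 1 <= E x.
Proof.
  intros Hx. unfold E. pose proof (exp_ineq1_le (lam * (x - c))).
  assert (0 <= lam * (x - c)) by (apply Rmult_le_pos; unfold lam; lra). lra.
Qed.

Let J_contract Z1 Z2 A : continuity Z1 -> continuity Z2 -> 0 <= A ->
  (forall x, c <= x <= d -> Rabs (Z1 x - Z2 x) <= A * E x) ->
  forall x, c <= x <= d -> Rabs (J Z1 x - J Z2 x) <= A / lam * E x.
Proof.
  intros H1 H2 HA H x Hx. destruct (HJ Z1 H1) as [J1 D1]. destruct (HJ Z2 H2) as [J2 D2].
  assert (DJ : forall t, derivable_pt_lim (fun x => J Z1 x - J Z2 x) t (Z1 t - Z2 t))
    by (intros; apply derivable_pt_lim_minus; auto).
  apply (AC_exponential_bound c d lam A (fun x => J Z1 x - J Z2 x)); auto.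
  - unfold lam; lra.
  - apply AC_on_lipschitz with (A * E d). intros s t Hs Ht.
    assert (Hm : forall s t, c <= s < t -> t <= d ->
      Rabs (J Z1 s - J Z2 s - (J Z1 t - J Z2 t)) <= A * E d * Rabs (s - t)).
    { clear s t Hs Ht. intros s t Hs Ht.
      destruct (MVT_cor2 (fun x => J Z1 x - J Z2 x) (fun x => Z1 x - Z2 x) s t ltac:(lra)
        (fun z _ => DJ z)) as [z [Ez Hz]].
      rewrite Rabs_minus_sym, (Rabs_minus_sym s), Ez, Rabs_mult.
      apply Rmult_le_compat_r; [apply Rabs_pos|].
      eapply Rle_trans; [apply H; lra|]. apply Rmult_le_compat_l; auto.
      left. apply exp_increasing. apply Rmult_lt_compat_l; unfold lam; lra. }
    destruct (Rtotal_order s t) as [Hst|[->|Hst]].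
    + apply Hm; lra.
    + rewrite !Rminus_diag, Rabs_R0. lra.
    + rewrite Rabs_minus_sym, (Rabs_minus_sym s). apply Hm; lra.
  - lra.
  - exists (fun x => x = c). split; [apply null_set1|]. intros t Ht _.
    exists (Z1 t - Z2 t). split; [auto|]. apply H; lra.
Qed.

(** Both arguments of [G] move by at most [A * E x], so the derivative of the difference is at most
    [2 * L * A * E x]; integrating divides by [lam], which exceeds [4 * L]. *)
Let T_contract Z1 Z2 A : continuity Z1 -> continuity Z2 -> 0 <= A ->
  (forall x, c <= x <= d -> Rabs (Z1 x - Z2 x) <= A * E x) ->
  forall x, c <= x <= d -> Rabs (T Z1 x - T Z2 x) <= A / 2 * E x.
Proof.
  intros H1 H2 HA H x Hx.
  destruct (HT Z1 H1) as (T1 & L1 & _ & D1). destruct (HT Z2 H2) as (T2 & L2 & _ & D2).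
  assert (Hlam : 1 <= lam) by (unfold lam; lra).
  pose proof (J_contract Z1 Z2 A H1 H2 HA H) as HJc.
  assert (HB : Rabs (T Z1 x - T Z2 x) <= (2 * L * A) / lam * E x).
  { apply (AC_exponential_bound c d lam (2 * L * A) (fun x => T Z1 x - T Z2 x)); auto.
    - lra.
    - apply Rmult_le_pos; lra.
    - apply AC_on_minus; apply AC_on_lipschitz with K; auto.
    - lra.
    - generalize (ae_in_and _ _ _ _ D1 D2). apply ae_in_impl. intros t Ht [E1 E2].
      eexists. split; [apply derivable_pt_lim_minus; [apply E1|apply E2]|].
      eapply Rle_trans; [apply G_lip; lra|].
      replace (Y + J Z1 t - (Y + J Z2 t)) with (J Z1 t - J Z2 t) by ring.
      specialize (HJc t ltac:(lra)). specialize (H t ltac:(lra)).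
      assert (HAl : A / lam <= A).
      { unfold Rdiv. rewrite <- (Rmult_1_r A) at 2. apply Rmult_le_compat_l; auto.
        rewrite <- Rinv_1. apply Rinv_le_contravar; lra. }
      fold (E t). pose proof (E_ge1 t ltac:(lra)).
      assert (A / lam * E t <= A * E t) by (apply Rmult_le_compat_r; lra).
      replace (2 * L * A * E t) with (L * (A * E t + A * E t)) by ring.
      apply Rmult_le_compat_l; lra. }
  eapply Rle_trans; [apply HB|]. pose proof (E_ge1 x ltac:(lra)).
  apply Rmult_le_compat_r; [lra|].
  apply Rmult_le_reg_r with lam; [lra|].
  replace (2 * L * A / lam * lam) with (2 * L * A) by (field; lra). unfold lam. nra.
Qed.

Let iterate (s : R) : nat -> R -> R :=
  fix it k := match k with O => fun _ => s | S k => fun x => s + T (it k) x end.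

Let shift_lip s F : (forall x y, Rabs (F x - F y) <= K * Rabs (x - y)) ->
  forall x y, Rabs ((s + F x) - (s + F y)) <= K * Rabs (x - y).
Proof. intros H x y. replace (s + F x - (s + F y)) with (F x - F y) by ring. auto. Qed.

Let iterate_lip s k x y : Rabs (iterate s k x - iterate s k y) <= K * Rabs (x - y).
Proof.
  revert x y. induction k as [|k IH]; simpl.
  - intros x y. rewrite Rminus_diag, Rabs_R0. pose proof (Rabs_pos (x - y)). nra.
  - apply shift_lip. apply HT. apply (continuity_lipschitz K). auto.
Qed.

Let iterate_cont s k : continuity (iterate s k).
Proof. apply (continuity_lipschitz K). intros; apply iterate_lip. Qed.

Let iterate_clamp s k x : iterate s k (clamp c d x) = iterate s k x.
Proof. destruct k; simpl; auto. f_equal. apply HT, iterate_cont. Qed.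

(** [s] is the initial slope. Convergence of the iterates is exported because dependence on [s] is
    read off from them. *)
Lemma picard_solution (s : R) : exists Z,
  (forall x y, Rabs (Z x - Z y) <= K * Rabs (x - y)) /\
  (forall x, c <= x <= d -> Z x = s + T Z x) /\
  (forall x, c <= x <= d -> is_lim_seq (fun k => iterate s k x) (Z x)).
Proof.
  assert (Hstep : forall k x, c <= x <= d ->
    Rabs (iterate s (S k) x - iterate s k x) <= K * (d - c) * (/ 2) ^ k * E x).
  { induction k as [|k IH]; intros x Hx.
    - simpl. replace (s + T (fun _ => s) x - s) with (T (fun _ => s) x) by ring.
      destruct (HT (fun _ => s) (iterate_cont s 0)) as (T0 & TL & _).
      specialize (TL x c). rewrite T0, Rminus_0_r, (Rabs_right (x - c)) in TL by lra.
      pose proof (E_ge1 x ltac:(lra)).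
      assert (K * (x - c) <= K * (d - c)) by (apply Rmult_le_compat_l; lra).
      assert (0 <= K * (d - c)) by (apply Rmult_le_pos; lra). nra.
    - pose proof (T_contract (iterate s (S k)) (iterate s k) (K * (d - c) * (/ 2) ^ k)
        (iterate_cont s (S k)) (iterate_cont s k)) as HTc.
      simpl in *.
      replace (s + T (fun x0 => s + T (iterate s k) x0) x - (s + T (iterate s k) x)) with
        (T (fun x0 => s + T (iterate s k) x0) x - T (iterate s k) x) by ring.
      eapply Rle_trans; [apply HTc; auto|].
      + repeat apply Rmult_le_pos; try lra. apply pow_le; lra.
      + right. field. }
  assert (Hlim : forall x, exists z : R, is_lim_seq (fun k => iterate s k x) z /\
    forall k, Rabs (iterate s k x - z) <=
      2 * (K * (d - c) * E (clamp c d x)) * (/ 2) ^ k).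
  { intros x. apply geometric_limit. intros k. rewrite <- (iterate_clamp s (S k)),
      <- (iterate_clamp s k). pose proof (Hstep k _ (clamp_in c d x ltac:(lra))). lra. }
  apply choice in Hlim. destruct Hlim as [Z HZ].
  assert (ZL : forall x y, Rabs (Z x - Z y) <= K * Rabs (x - y)).
  { intros x y. apply (is_lim_seq_bound (fun k => iterate s k x - iterate s k y)).
    - apply is_lim_seq_minus'; apply HZ.
    - intros k. apply iterate_lip. }
  assert (ZC : continuity Z) by (apply (continuity_lipschitz K); auto).
  exists Z. split; [auto|split; [|intros; apply HZ]].
  intros x Hx. pose (B := K * (d - c)).
  assert (HB0 : 0 <= B) by (apply Rmult_le_pos; lra).
  assert (Hconv : is_lim_seq (fun k => 2 * B * E x * (/ 2) ^ k) 0).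
  { replace (Finite 0) with (Rbar_mult (2 * B * E x) 0) by (simpl; f_equal; ring).
    apply is_lim_seq_scal_l. apply is_lim_seq_geom. rewrite Rabs_right; lra. }
  apply cond_eq. intros eps He.
  destruct (is_lim_seq_eps _ _ Hconv eps He) as [k Hk]. specialize (Hk k (le_n k)).
  rewrite Rminus_0_r in Hk. apply Rabs_def2 in Hk.
  destruct (HZ x) as [_ HZx]. specialize (HZx (S k)). rewrite clamp_id in HZx by auto.
  pose proof (T_contract (iterate s k) Z (2 * B * (/ 2) ^ k) (iterate_cont s k) ZC) as HTc.
  assert (HT1 : Rabs (T (iterate s k) x - T Z x) <= 2 * B * (/ 2) ^ k / 2 * E x).
  { apply HTc; auto.
    - repeat apply Rmult_le_pos; try lra. apply pow_le; lra.
    - intros y Hy. destruct (HZ y) as [_ Hy']. specialize (Hy' k).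
      rewrite clamp_id in Hy' by auto. unfold B. lra. }
  fold B in HZx. simpl in HZx.
  assert (HZ2 : Rabs (s + T (iterate s k) x - Z x) <= B * E x * (/ 2) ^ k) by lra.
  assert (HT2 : Rabs (T (iterate s k) x - T Z x) <= B * E x * (/ 2) ^ k) by lra.
  apply Rabs_le_between in HZ2. apply Rabs_le_between in HT2.
  apply Rabs_def1; lra.
Qed.

(** The factor 2 is reproduced by each iteration: a new difference of slopes [|s - s'|] plus half of
    the previous bound, with [E >= 1]. *)
Lemma picard_dependence (s s' : R) (Z Z' : R -> R) :
  (forall x, c <= x <= d -> is_lim_seq (fun k => iterate s k x) (Z x)) ->
  (forall x, c <= x <= d -> is_lim_seq (fun k => iterate s' k x) (Z' x)) ->
  forall x, c <= x <= d -> Rabs (Z x - Z' x) <= 2 * Rabs (s - s') * E x.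
Proof.
  intros HZ HZ' x Hx.
  apply (is_lim_seq_bound (fun k => iterate s k x - iterate s' k x)).
  { apply is_lim_seq_minus'; auto. }
  assert (H : forall k y, c <= y <= d ->
    Rabs (iterate s k y - iterate s' k y) <= 2 * Rabs (s - s') * E y).
  { pose proof (Rabs_pos (s - s')) as Hp.
    induction k as [|k IH]; intros y Hy; pose proof (E_ge1 y ltac:(lra)) as HE.
    - simpl. nra.
    - simpl. replace (s + T (iterate s k) y - (s' + T (iterate s' k) y)) with
        ((s - s') + (T (iterate s k) y - T (iterate s' k) y)) by ring.
      eapply Rle_trans; [apply Rabs_triang|].
      pose proof (T_contract _ _ (2 * Rabs (s - s')) (iterate_cont s k) (iterate_cont s' k)
        ltac:(lra) IH y Hy). nra. }
  intros k. auto.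
Qed.

(** The end value depends continuously on the initial slope [s], and the slope of the solution stays
    within [K * (d - c)] of [s]. Hence the intermediate value theorem applies around the mean slope
    [m]. *)
Lemma shooting_target (Y2 : R) : exists V Z,
  (forall x y, Rabs (Z x - Z y) <= K * Rabs (x - y)) /\
  (forall x, derivable_pt_lim V x (Z x)) /\ V c = Y /\ V d = Y2 /\
  ae_in c d (fun x => derivable_pt_lim Z x (G x (V x) (Z x))).
Proof.
  destruct (choice _ picard_solution) as [S HS].
  assert (SC : forall s, continuity (S s)) by (intros s; apply (continuity_lipschitz K), HS).
  pose (F := fun s => Y + J (S s) d - Y2).
  assert (FC : continuity F).
  { apply (continuity_lipschitz (2 / lam * E d)). intros s s'. unfold F.
    replace (Y + J (S s) d - Y2 - (Y + J (S s') d - Y2)) with (J (S s) d - J (S s') d) by ring.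
    pose proof (J_contract (S s) (S s') (2 * Rabs (s - s')) (SC s) (SC s')) as H.
    eapply Rle_trans; [apply H|].
    - pose proof (Rabs_pos (s - s')). lra.
    - apply picard_dependence; apply HS.
    - lra.
    - right. unfold Rdiv. ring. }
  assert (Fv : forall s, exists r, Rabs r <= K * (d - c) /\ F s = Y - Y2 + (s + r) * (d - c)).
  { intros s. destruct (HJ (S s) (SC s)) as [J0 JD].
    destruct (MVT_cor2 (J (S s)) (S s) c d Hcd (fun t _ => JD t)) as [t [Et Ht]].
    destruct (HS s) as (SL & SE & _). destruct (HT (S s) (SC s)) as (T0 & TL & _).
    exists (S s t - s). split.
    - rewrite (SE t) by lra. replace (s + T (S s) t - s) with (T (S s) t - T (S s) c)
        by (rewrite T0; ring).
      eapply Rle_trans; [apply TL|]. apply Rmult_le_compat_l; auto. rewrite Rabs_right; lra.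
    - unfold F. rewrite J0, Rminus_0_r in Et. rewrite Et. ring. }
  pose (m := (Y2 - Y) / (d - c)).
  assert (Hm : m * (d - c) = Y2 - Y) by (unfold m; field; lra).
  assert (Hw : 0 <= K * (d - c)) by (apply Rmult_le_pos; lra).
  destruct (IVT_cor F (m - K * (d - c)) (m + K * (d - c)) FC) as [s [_ Hs]]; [lra| |].
  { destruct (Fv (m - K * (d - c))) as [r1 [Hr1 E1]].
    destruct (Fv (m + K * (d - c))) as [r2 [Hr2 E2]]. rewrite E1, E2.
    apply Rabs_le_between in Hr1. apply Rabs_le_between in Hr2.
    replace (Y - Y2) with (- (m * (d - c))) by lra.
    replace (- (m * (d - c)) + (m - K * (d - c) + r1) * (d - c)) with
      (- ((K * (d - c) - r1) * (d - c))) by ring.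
    replace (- (m * (d - c)) + (m + K * (d - c) + r2) * (d - c)) with
      ((K * (d - c) + r2) * (d - c)) by ring.
    assert (0 <= (K * (d - c) - r1) * (d - c)) by (apply Rmult_le_pos; lra).
    assert (0 <= (K * (d - c) + r2) * (d - c)) by (apply Rmult_le_pos; lra). nra. }
  exists (fun x => Y + J (S s) x), (S s).
  destruct (HJ (S s) (SC s)) as [J0 JD]. destruct (HS s) as (SL & SE & _).
  destruct (HT (S s) (SC s)) as (_ & _ & _ & TD).
  split; [auto|split; [|split; [|split]]].
  - intros x. rewrite <- (Rplus_0_l (S s x)).
    apply (derivable_pt_lim_plus (fun _ => Y)); [apply derivable_pt_lim_const|auto].
  - rewrite J0. ring.
  - unfold F in Hs. lra.
  - revert TD. apply ae_in_impl. intros x Hx HD.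
    apply (derivable_pt_lim_local (fun x => s + T (S s) x) _ c d); auto.
    + intros y Hy. rewrite (SE y) by lra. auto.
    + rewrite <- (Rplus_0_l (G _ _ _)).
      apply (derivable_pt_lim_plus (fun _ => s)); [apply derivable_pt_lim_const|auto].
Qed.
End Shooting.

(** The [C11] constant does not involve [L], so approximations with exploding Lipschitz constants
    stay in one class. It comes from the mean value theorem: somewhere the slope equals
    [(Y2 - Y1) / (d - c)]. *)
Lemma dirichlet_lipschitz (c d L K Y1 Y2 : R) (G : R -> R -> R -> R) :
  c < d -> 0 <= L ->
  (forall x v z v' z', c <= x <= d ->
    Rabs (G x v z - G x v' z') <= L * (Rabs (v - v') + Rabs (z - z'))) ->
  (forall x v z, c <= x <= d -> Rabs (G x v z) <= K) ->
  (forall V Z, continuity V -> continuity Z -> has_primitive c d (fun x => G x (V x) (Z x))) ->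
  exists V Z, C11 c d (Rabs (Y2 - Y1) / (d - c) + K + 2 * K * (d - c)) V Z /\
    V c = Y1 /\ V d = Y2 /\
    ae_in c d (fun x => derivable_pt_lim Z x (G x (V x) (Z x))).
Proof.
  intros Hcd HL Glip Gb Gp.
  destruct (antiderivative_operator c) as [J HJ].
  destruct (picard_operator c d K G Hcd Gb Gp J HJ Y1) as [T HT].
  destruct (shooting_target c d L K G Hcd HL Glip Gb J HJ Y1 T HT Y2)
    as (V & Z & ZL & VD & V1 & V2 & ZD).
  exists V, Z. split; [|auto].
  assert (HK : 0 <= K).
  { pose proof (Gb c 0 0 ltac:(lra)). pose proof (Rabs_pos (G c 0 0)). lra. }
  assert (Hq : 0 <= Rabs (Y2 - Y1) / (d - c)).
  { apply Rmult_le_pos; [apply Rabs_pos|]. left. apply Rinv_0_lt_compat. lra. }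
  assert (Hkd : 0 <= K * (d - c)) by (apply Rmult_le_pos; lra).
  assert (Hmv : forall x y, x < y -> Rabs (V y - V x - Z x * (y - x)) <= K * (y - x) ^ 2 /\
    Rabs (V x - V y - Z y * (x - y)) <= K * (x - y) ^ 2).
  { intros x y Hxy. destruct (MVT_cor2 V Z x y Hxy (fun t _ => VD t)) as [t [Et Ht]].
    split.
    - rewrite Et. replace (Z t * (y - x) - Z x * (y - x)) with ((Z t - Z x) * (y - x)) by ring.
      rewrite Rabs_mult, (Rabs_right (y - x)) by lra.
      assert (Rabs (Z t - Z x) <= K * (y - x)).
      { eapply Rle_trans; [apply ZL|]. apply Rmult_le_compat_l; auto. rewrite Rabs_right; lra. }
      simpl. rewrite Rmult_1_r, <- Rmult_assoc. apply Rmult_le_compat_r; lra.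
    - replace (V x - V y - Z y * (x - y)) with ((Z y - Z t) * (y - x)).
      2:{ replace (V x) with (V y - Z t * (y - x)) by lra. ring. }
      rewrite Rabs_mult, (Rabs_right (y - x)) by lra.
      assert (Rabs (Z y - Z t) <= K * (y - x)).
      { eapply Rle_trans; [apply ZL|]. apply Rmult_le_compat_l; auto. rewrite Rabs_right; lra. }
      replace ((x - y) ^ 2) with ((y - x) * (y - x)) by ring.
      rewrite <- Rmult_assoc. apply Rmult_le_compat_r; lra. }
  split.
  - intros x Hx. destruct (MVT_cor2 V Z c d Hcd (fun t _ => VD t)) as [t [Et Ht]].
    replace (Z x) with ((Z x - Z t) + (V d - V c) / (d - c)) by (rewrite Et; field; lra).
    eapply Rle_trans; [apply Rabs_triang|].
    rewrite V1, V2. unfold Rdiv at 1. rewrite Rabs_mult, (Rabs_right (/ (d - c)))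
      by (apply Rle_ge; left; apply Rinv_0_lt_compat; lra).
    assert (Rabs (Z x - Z t) <= K * (d - c)).
    { eapply Rle_trans; [apply ZL|]. apply Rmult_le_compat_l; auto.
      unfold Rabs; destruct (Rcase_abs _); lra. }
    fold (Rabs (Y2 - Y1) / (d - c)). lra.
  - intros x y Hx Hy. apply Rle_trans with (K * (y - x) ^ 2).
    + destruct (Rtotal_order x y) as [H|[H|H]].
      * exact (proj1 (Hmv x y H)).
      * replace (V y - V x - Z x * (y - x)) with 0 by (rewrite H; ring). rewrite Rabs_R0.
        apply Rmult_le_pos; [auto|apply pow2_ge_0].
      * exact (proj2 (Hmv y x H)).
    + apply Rmult_le_compat_r; [apply pow2_ge_0|]. lra.
Qed.

(** * Dirichlet problems between lower and upper solutions *)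

(** The four clauses serve comparison and limits, the a priori bound, existence of primitives, and
    approximation by Lipschitz right-hand sides. All are stable under [reflect]; the sign condition
    behind convexity is kept apart because reflection reverses it. *)
Definition admissible (c d : R) (h : R -> R -> R) : Prop :=
  equicont c d h /\
  (exists C, 0 <= C /\ forall x w, c <= x <= d -> Rabs (h x w) <= C * sqrt (Rabs w)) /\
  (forall w, continuity w -> has_primitive c d (fun x => h x (w x))) /\
  (forall eps, 0 < eps -> exists h' L, 0 <= L /\
     (forall x w w', c <= x <= d -> Rabs (h' x w - h' x w') <= L * Rabs (w - w')) /\
     (forall x w, c <= x <= d -> Rabs (h' x w - h x w) <= eps) /\
     (forall w, continuity w -> has_primitive c d (fun x => h' x (w x)))).

Definition solves (c d : R) (h : R -> R -> R) (K : R) (V Z : R -> R) : Prop :=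
  C11 c d K V Z /\
  ae_in c d (fun x => derivable_pt_lim Z x (h x (x * Z x - V x))).

(* [V] solves [V'' = h(x, x V' - V)] iff [- V] solves the equation for [reflect h]; this
   exchanges lower and upper solutions. *)
Definition reflect (h : R -> R -> R) (x w : R) : R := - h x (- w).

(** Added to [V''], it is positive above [up] and negative below [lo], which is exactly the strict
    inequality that comparison asks for. Cutting the ramps at 1 keeps it bounded independently of
    the data. *)
Definition penalty (lo up y : R) : R :=
  Rmin 1 (Rmax 0 (y - up)) - Rmin 1 (Rmax 0 (lo - y)).

Lemma ramp_lip (s t : R) :
  Rabs (Rmin 1 (Rmax 0 s) - Rmin 1 (Rmax 0 t)) <= Rabs (s - t).
Proof.
  unfold Rmin, Rmax. destruct (Rle_dec 0 s), (Rle_dec 0 t);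
    repeat destruct (Rle_dec _ _); unfold Rabs; repeat destruct (Rcase_abs _); lra.
Qed.

Lemma ramp_mono (s t : R) : s <= t -> Rmin 1 (Rmax 0 s) <= Rmin 1 (Rmax 0 t).
Proof. intros H. apply Rle_min_compat_l, Rle_max_compat_l, H. Qed.

Lemma ramp_range (s : R) : 0 <= Rmin 1 (Rmax 0 s) <= 1.
Proof.
  split; [|apply Rmin_l]. apply Rmin_glb; [lra|apply Rmax_l].
Qed.

Lemma ramp_zero (s : R) : s <= 0 -> Rmin 1 (Rmax 0 s) = 0.
Proof. intros H. rewrite Rmax_left by lra. apply Rmin_right; lra. Qed.

Lemma ramp_pos (s : R) : 0 < s -> 0 < Rmin 1 (Rmax 0 s).
Proof.
  intros H. apply Rmin_glb_lt; [lra|]. eapply Rlt_le_trans; [apply H|apply Rmax_r].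
Qed.

Lemma penalty_bound lo up y : Rabs (penalty lo up y) <= 1.
Proof.
  unfold penalty. pose proof (ramp_range (y - up)). pose proof (ramp_range (lo - y)).
  apply Rabs_le_between. lra.
Qed.

Lemma penalty_lip lo up y lo' up' y' :
  Rabs (penalty lo up y - penalty lo' up' y') <=
  Rabs (lo - lo') + Rabs (up - up') + 2 * Rabs (y - y').
Proof.
  unfold penalty.
  pose proof (ramp_lip (y - up) (y' - up')) as H1.
  pose proof (ramp_lip (lo - y) (lo' - y')) as H2.
  replace (y - up - (y' - up')) with ((y - y') + - (up - up')) in H1 by ring.
  replace (lo - y - (lo' - y')) with ((lo - lo') + - (y - y')) in H2 by ring.
  pose proof (Rabs_triang (y - y') (- (up - up'))) as H3.
  pose proof (Rabs_triang (lo - lo') (- (y - y'))) as H4.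
  rewrite Rabs_Ropp in H3, H4.
  match goal with |- Rabs (?a - ?b - (?a' - ?b')) <= _ =>
    replace (a - b - (a' - b')) with ((a - a') + - (b - b')) by ring end.
  eapply Rle_trans; [apply Rabs_triang|]. rewrite Rabs_Ropp. lra.
Qed.

Lemma penalty_mono lo up y y' : y <= y' -> penalty lo up y <= penalty lo up y'.
Proof.
  intros H. unfold penalty.
  pose proof (ramp_mono (y - up) (y' - up) ltac:(lra)).
  pose proof (ramp_mono (lo - y') (lo - y) ltac:(lra)). lra.
Qed.

Lemma penalty_zero lo up y : lo <= y <= up -> penalty lo up y = 0.
Proof. intros H. unfold penalty. rewrite !ramp_zero by lra. ring. Qed.

Lemma penalty_neg lo up y : lo <= up -> y < lo -> penalty lo up y < 0.
Proof.
  intros H1 H2. unfold penalty. rewrite (ramp_zero (y - up)) by lra.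
  pose proof (ramp_pos (lo - y) ltac:(lra)). lra.
Qed.

Lemma penalty_pos lo up y : lo <= up -> up < y -> 0 < penalty lo up y.
Proof.
  intros H1 H2. unfold penalty. rewrite (ramp_zero (lo - y)) by lra.
  pose proof (ramp_pos (y - up) ltac:(lra)). lra.
Qed.

Lemma cont_on_penalty a b lo up y : cont_on a b lo -> cont_on a b up -> cont_on a b y ->
  cont_on a b (fun x => penalty (lo x) (up x) (y x)).
Proof.
  intros Hl Hu Hy x Hx eps He.
  destruct (Hl x Hx (eps / 4) ltac:(lra)) as [d1 [P1 H1]].
  destruct (Hu x Hx (eps / 4) ltac:(lra)) as [d2 [P2 H2]].
  destruct (Hy x Hx (eps / 4) ltac:(lra)) as [d3 [P3 H3]].
  exists (Rmin d1 (Rmin d2 d3)). split; [repeat apply Rmin_glb_lt; auto|].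
  intros t Ht Htx. destruct (Rmin_Rgt_l _ _ _ Htx) as [T1 T2].
  destruct (Rmin_Rgt_l _ _ _ T2) as [T3 T4].
  eapply Rle_lt_trans; [apply penalty_lip|].
  specialize (H1 t Ht T1). specialize (H2 t Ht T3). specialize (H3 t Ht T4). lra.
Qed.

Lemma C11_weaken c d K K' V Z : K <= K' -> C11 c d K V Z -> C11 c d K' V Z.
Proof.
  intros HK [H1 H2]. split.
  - intros x Hx. specialize (H1 x Hx). lra.
  - intros x y Hx Hy. eapply Rle_trans; [apply H2; auto|].
    apply Rmult_le_compat_r; [apply pow2_ge_0|auto].
Qed.

Lemma C11_opp c d K V Z : C11 c d K V Z -> C11 c d K (fun x => - V x) (fun x => - Z x).
Proof.
  intros [H1 H2]. split.
  - intros x Hx. rewrite Rabs_Ropp. auto.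
  - intros x y Hx Hy.
    replace (- V y - - V x - - Z x * (y - x)) with (- (V y - V x - Z x * (y - x))) by ring.
    rewrite Rabs_Ropp. auto.
Qed.

Lemma equicont_reflect c d h : equicont c d h -> equicont c d (reflect h).
Proof.
  intros H eps He. destruct (H eps He) as [del [Hd Hh]]. exists del. split; auto.
  intros x w w' Hx Hw. unfold reflect.
  replace (- h x (- w) - - h x (- w')) with (- (h x (- w) - h x (- w'))) by ring.
  rewrite Rabs_Ropp. apply Hh; auto.
  replace (- w - - w') with (- (w - w')) by ring. rewrite Rabs_Ropp. auto.
Qed.

Lemma half_pow_pos n : 0 < (/ 2) ^ n.
Proof. apply pow_lt. lra. Qed.

Lemma half_pow_le1 n : (/ 2) ^ n <= 1.
Proof. induction n; simpl; [lra|]. pose proof (half_pow_pos n). lra. Qed.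

Lemma half_pow_small eps : 0 < eps -> exists N, forall n, (N <= n)%nat -> (/ 2) ^ n < eps.
Proof.
  intros He.
  assert (Hl : is_lim_seq (fun k => (/ 2) ^ k) 0)
    by (apply is_lim_seq_geom; rewrite Rabs_right; lra).
  destruct (is_lim_seq_eps _ _ Hl eps He) as [N HN]. exists N. intros n Hn.
  specialize (HN n Hn). rewrite Rminus_0_r in HN. apply Rabs_def2 in HN. lra.
Qed.

(* The equation is truncated at [|x V' - V| = M] and penalised outside [[lo, up]].  Replacing
   [h] by the Lipschitz functions [hn n] shifted by [4 / 2 ^ n] makes the right-hand sides
   strictly decreasing in [n], so that the approximate solutions increase. *)
Section Penalised.
Variables (c d : R) (h : R -> R -> R) (hn : nat -> R -> R -> R) (Ln : nat -> R).
Variables (lo up : R -> R) (Y1 Y2 K0 M : R).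
Hypothesis Hc : 0 < c.
Hypothesis Hcd : c < d.
Hypothesis h_eq : equicont c d h.
Hypothesis h_bound : forall x w, c <= x <= d -> Rabs (h x (clamp (- M) M w)) <= K0.
Hypothesis h_prim : forall w, continuity w -> has_primitive c d (fun x => h x (w x)).
Hypothesis L_nonneg : forall n, 0 <= Ln n.
Hypothesis hn_lip : forall n x w w', c <= x <= d ->
  Rabs (hn n x w - hn n x w') <= Ln n * Rabs (w - w').
Hypothesis hn_close : forall n x w, c <= x <= d -> Rabs (hn n x w - h x w) <= (/ 2) ^ n.
Hypothesis hn_prim : forall n w, continuity w -> has_primitive c d (fun x => hn n x (w x)).
Hypothesis Hlo : cont_on c d lo.
Hypothesis Hup : cont_on c d up.

(** The 6 is 1 for the distance from [hn] to [h], 4 for the shift and 1 for the penalty. *)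
Let K := Rabs (Y2 - Y1) / (d - c) + (K0 + 6) + 2 * (K0 + 6) * (d - c).
Let Gn (n : nat) (x v z : R) : R :=
  hn n x (clamp (- M) M (x * z - v)) + (4 * (/ 2) ^ n + penalty (lo x) (up x) v).

Lemma truncated_arg_continuity V Z : continuity V -> continuity Z ->
  continuity (fun x => clamp (- M) M (x * Z x - V x)).
Proof.
  intros HV HZ. apply (continuity_comp (fun x => x * Z x - V x) (clamp (- M) M));
    [|apply continuity_clamp].
  apply (continuity_minus (fun x => x * Z x) V); auto.
  apply (continuity_mult (fun x => x) Z); auto.
  apply derivable_continuous, derivable_id.
Qed.

Lemma truncated_arg_lip x v z v' z' : c <= x <= d ->
  Rabs (clamp (- M) M (x * z - v) - clamp (- M) M (x * z' - v')) <=
  (d + 1) * (Rabs (v - v') + Rabs (z - z')).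
Proof.
  intros Hx. eapply Rle_trans; [apply clamp_lip|].
  replace (x * z - v - (x * z' - v')) with (x * (z - z') + - (v - v')) by ring.
  eapply Rle_trans; [apply Rabs_triang|]. rewrite Rabs_Ropp, Rabs_mult, (Rabs_right x) by lra.
  pose proof (Rabs_pos (v - v')). pose proof (Rabs_pos (z - z')). nra.
Qed.

Lemma approximate_solution n : exists VZ : (R -> R) * (R -> R),
  C11 c d K (fst VZ) (snd VZ) /\ fst VZ c = Y1 /\ fst VZ d = Y2 /\
  ae_in c d (fun x => derivable_pt_lim (snd VZ) x (Gn n x (fst VZ x) (snd VZ x))).
Proof.
  destruct (dirichlet_lipschitz c d (Ln n * (d + 1) + 2) (K0 + 6) Y1 Y2 (Gn n))
    as (V & Z & HC & E1 & E2 & HD); auto.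
  - specialize (L_nonneg n). nra.
  - intros x v z v' z' Hx. unfold Gn.
    match goal with |- Rabs (?a + (?s + ?b) - (?a' + (?s + ?b'))) <= _ =>
      replace (a + (s + b) - (a' + (s + b'))) with ((a - a') + (b - b')) by ring end.
    eapply Rle_trans; [apply Rabs_triang|].
    pose proof (hn_lip n x (clamp (- M) M (x * z - v)) (clamp (- M) M (x * z' - v')) Hx) as A1.
    pose proof (truncated_arg_lip x v z v' z' Hx) as A2.
    pose proof (penalty_lip (lo x) (up x) v (lo x) (up x) v') as A3.
    rewrite !Rminus_diag, Rabs_R0 in A3.
    apply (Rmult_le_compat_l (Ln n)) in A2; [|auto].
    pose proof (Rabs_pos (z - z')). nra.
  - intros x v z Hx. unfold Gn.
    pose proof (hn_close n x (clamp (- M) M (x * z - v)) Hx) as A1.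
    pose proof (h_bound x (x * z - v) Hx) as A2.
    pose proof (penalty_bound (lo x) (up x) v) as A3.
    pose proof (half_pow_pos n). pose proof (half_pow_le1 n).
    apply Rabs_le_between in A1. apply Rabs_le_between in A2. apply Rabs_le_between in A3.
    apply Rabs_le_between. lra.
  - intros V Z HV HZ. apply has_primitive_plus.
    + apply (hn_prim n (fun x => clamp (- M) M (x * Z x - V x))).
      apply truncated_arg_continuity; auto.
    + apply has_primitive_continuous; [lra|].
      apply (cont_on_plus c d (fun _ => 4 * (/ 2) ^ n)).
      * apply cont_on_continuity, continuity_const. intros ? ?; reflexivity.
      * apply cont_on_penalty; auto. apply cont_on_continuity; auto.
  - exists (V, Z). simpl. auto.
Qed.

(** More curvature with the same end values means a smaller function. From [n] to [n + 1] the shift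
    drops by [2 / 2 ^ n], while the approximation errors cost at most [3/2] times [1 / 2 ^ n]; half
    of what is left is [eta]. *)
Lemma approximate_solutions_increase n (V Z V' Z' : R -> R) :
  C11 c d K V Z -> V c = Y1 -> V d = Y2 ->
  ae_in c d (fun x => derivable_pt_lim Z x (Gn n x (V x) (Z x))) ->
  C11 c d K V' Z' -> V' c = Y1 -> V' d = Y2 ->
  ae_in c d (fun x => derivable_pt_lim Z' x (Gn (S n) x (V' x) (Z' x))) ->
  forall x, c <= x <= d -> V x <= V' x.
Proof.
  intros HC E1 E2 HD HC' E1' E2' HD'.
  assert (HV : cont_on c d V) by (eapply cont_on_lipschitz, C11_lipschitz, HC).
  assert (HV' : cont_on c d V') by (eapply cont_on_lipschitz, C11_lipschitz, HC').
  pose (eta := (/ 2) ^ n / 4).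
  assert (Heta : 0 < eta) by (unfold eta; pose proof (half_pow_pos n); lra).
  (* The penalty is frozen along [V] inside the right-hand side. For [V'] the remainder is then a
     difference of penalties minus [eta], negative wherever [V' < V] because [penalty] is
     monotone. *)
  apply (comparison c d K
    (fun x w => hn (S n) x (clamp (- M) M w) +
       (4 * (/ 2) ^ (S n) + penalty (lo x) (up x) (V x) + eta)) V V' Z'
    (fun x => penalty (lo x) (up x) (V' x) - penalty (lo x) (up x) (V x) - eta)); auto; try lra.
  - intros eps He. pose proof (L_nonneg (S n)) as HL.
    exists (eps / (Ln (S n) + 1)). split; [apply Rdiv_lt_0_compat; lra|].
    intros x w w' Hx Hw.
    match goal with |- Rabs (?a + ?s - (?a' + ?s)) < _ =>
      replace (a + s - (a' + s)) with (a - a') by ring end.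
    eapply Rle_lt_trans; [apply hn_lip; auto|].
    pose proof (clamp_lip (- M) M w w') as Hcl. pose proof (Rabs_pos (w - w')).
    apply Rle_lt_trans with ((Ln (S n) + 1) * Rabs (w - w')).
    + apply Rle_trans with (Ln (S n) * Rabs (w - w')); [apply Rmult_le_compat_l; auto|nra].
    + replace eps with ((Ln (S n) + 1) * (eps / (Ln (S n) + 1))) by (field; lra).
      apply Rmult_lt_compat_l; lra.
  - intros x0 Hx0. right. exists c, d. split; [lra|split; [lra|]]. exists Z.
    split; [intros; eapply C11_derivable; eauto|split].
    + apply AC_on_lipschitz with (2 * K). eapply C11_deriv_lipschitz; eauto.
    + apply ae_in_on. revert HD. apply ae_in_impl. intros x Hx HDx.
      eexists. split; [apply HDx|]. unfold Gn.
      pose proof (hn_close n x (clamp (- M) M (x * Z x - V x)) ltac:(lra)) as A1.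
      pose proof (hn_close (S n) x (clamp (- M) M (x * Z x - V x)) ltac:(lra)) as A2.
      apply Rabs_le_between in A1. apply Rabs_le_between in A2.
      pose proof (half_pow_pos n). unfold eta. simpl in *. lra.
  - revert HD'. apply ae_in_impl. intros x Hx HDx. unfold Gn in HDx.
    match goal with |- derivable_pt_lim _ _ ?l => match type of HDx with
      derivable_pt_lim _ _ ?m => replace l with m by ring end end. exact HDx.
  - apply cont_on_minus; [apply cont_on_minus; apply cont_on_penalty; auto|].
    apply cont_on_continuity, continuity_const. intros ? ?; reflexivity.
  - intros x Hx Hlt. pose proof (penalty_mono (lo x) (up x) _ _ (Rlt_le _ _ Hlt)). lra.
Qed.

(** Monotonicity in [n] and the common [C11] bound give pointwise convergence, which the Lipschitz
    bounds make uniform for values and derivatives. *)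
Lemma penalised_solution : exists V Z, C11 c d K V Z /\ V c = Y1 /\ V d = Y2 /\
  ae_in c d (fun x => derivable_pt_lim Z x
    (h x (clamp (- M) M (x * Z x - V x)) + penalty (lo x) (up x) (V x))).
Proof.
  destruct (choice _ approximate_solution) as [VZ HVZ].
  pose (Vn := fun n => fst (VZ n)). pose (Zn := fun n => snd (VZ n)).
  assert (HC : forall n, C11 c d K (Vn n) (Zn n)) by (intros; apply HVZ).
  assert (HK : 0 <= K) by (eapply C11_K_nonneg; [|apply (HC 0%nat)]; lra).
  assert (Hinc : forall n x, c <= x <= d -> Vn n x <= Vn (S n) x).
  { intros n. destruct (HVZ n) as (A1 & A2 & A3 & A4).
    destruct (HVZ (S n)) as (B1 & B2 & B3 & B4).
    apply (approximate_solutions_increase n _ (Zn n) _ (Zn (S n))); auto. }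
  assert (Hub : forall n x, c <= x <= d ->
    Vn n x <= Y1 + (K + K * (d - c)) * (d - c)).
  { intros n x Hx. pose proof (C11_lipschitz _ _ _ _ _ (HC n) x c Hx ltac:(lra)) as A.
    assert (Ec : Vn n c = Y1) by apply HVZ. rewrite Ec, (Rabs_right (x - c)) in A by lra.
    apply Rabs_le_between in A.
    assert ((K + K * (d - c)) * (x - c) <= (K + K * (d - c)) * (d - c)).
    { apply Rmult_le_compat_l; [|lra]. nra. }
    lra. }
  pose (V := fun x => real (Lim_seq (fun n => Vn n x))).
  assert (HV : forall x, c <= x <= d -> is_lim_seq (fun n => Vn n x) (V x)).
  { intros x Hx. apply Lim_seq_correct'. apply ex_finite_lim_seq_incr with
      (Y1 + (K + K * (d - c)) * (d - c)); intros n; auto. }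
  destruct (C11_limit c d K Vn Zn V Hcd HC HV) as [Z [HCZ HZ]].
  assert (HVc : cont_on c d V) by (eapply cont_on_lipschitz, C11_lipschitz, HCZ).
  assert (HZc : cont_on c d Z) by (eapply cont_on_lipschitz, C11_deriv_lipschitz, HCZ).
  exists V, Z. split; [auto|split; [|split]].
  - assert (E : is_lim_seq (fun n => Vn n c) Y1).
    { apply (is_lim_seq_ext (fun _ => Y1)); [|apply is_lim_seq_const].
      intros n. symmetry. apply HVZ. }
    pose proof (is_lim_seq_unique _ _ E) as U. unfold V. rewrite U. reflexivity.
  - assert (E : is_lim_seq (fun n => Vn n d) Y2).
    { apply (is_lim_seq_ext (fun _ => Y2)); [|apply is_lim_seq_const].
      intros n. symmetry. apply HVZ. }
    pose proof (is_lim_seq_unique _ _ E) as U. unfold V. rewrite U. reflexivity.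
  - apply (ode_limit c d (2 * K) Zn (fun n x => Gn n x (Vn n x) (Zn n x)) Z); auto.
    + intros n. eapply C11_deriv_lipschitz, HC.
    + intros n. apply HVZ.
    + intros eps He.
      destruct (h_eq (eps / 4) ltac:(lra)) as [del [Hdel Hh]].
      (* The first bound moves the argument of [h] by at most [del / 2], the second moves the
         penalty by at most [eps / 8]. *)
      pose (e1 := Rmin (del / (4 * (d + 1))) (eps / 16)).
      assert (He1 : 0 < e1).
      { apply Rmin_glb_lt; [apply Rdiv_lt_0_compat; lra|lra]. }
      assert (He1a : e1 <= del / (4 * (d + 1))) by apply Rmin_l.
      assert (He1b : e1 <= eps / 16) by apply Rmin_r.
      destruct (lipschitz_limit_uniform c d (K + K * (d - c)) Vn V ltac:(lra) ltac:(nra)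
        (fun n => C11_lipschitz _ _ _ _ _ (HC n)) HV e1 He1) as [N1 HN1].
      destruct (lipschitz_limit_uniform c d (2 * K) Zn Z ltac:(lra) ltac:(nra)
        (fun n => C11_deriv_lipschitz _ _ _ _ _ (HC n)) HZ e1 He1) as [N2 HN2].
      destruct (half_pow_small (eps / 16) ltac:(lra)) as [N3 HN3].
      exists (Nat.max N1 (Nat.max N2 N3)). intros n Hn x Hx.
      specialize (HN1 n ltac:(lia) x Hx). specialize (HN2 n ltac:(lia) x Hx).
      specialize (HN3 n ltac:(lia)). unfold Gn.
      pose proof (hn_close n x (clamp (- M) M (x * Zn n x - Vn n x)) Hx) as A1.
      pose proof (truncated_arg_lip x (Vn n x) (Zn n x) (V x) (Z x) Hx) as A2.
      assert (A3 : Rabs (clamp (- M) M (x * Zn n x - Vn n x) - clamp (- M) M (x * Z x - V x)) < del).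
      { eapply Rle_lt_trans; [apply A2|].
        apply Rle_lt_trans with ((d + 1) * (2 * (del / (4 * (d + 1))))).
        - apply Rmult_le_compat_l; lra.
        - replace ((d + 1) * (2 * (del / (4 * (d + 1))))) with (del / 2) by (field; lra). lra. }
      specialize (Hh x _ _ Hx A3).
      pose proof (penalty_lip (lo x) (up x) (Vn n x) (lo x) (up x) (V x)) as A4.
      rewrite !Rminus_diag, Rabs_R0 in A4. pose proof (half_pow_pos n).
      assert (A5 : Rabs (penalty (lo x) (up x) (Vn n x) - penalty (lo x) (up x) (V x)) <= eps / 8)
        by lra.
      apply Rabs_le_between in A1. apply Rabs_def2 in Hh. apply Rabs_le_between in A5.
      apply Rabs_le_between. lra.
    + apply has_primitive_plus.
      (* Primitives are available along functions continuous on the line, so [V] and [Z] are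
         replaced by their clamped extensions. *)
      * apply (has_primitive_ext c d (fun x => h x (clamp (- M) M
          (x * Z (clamp c d x) - V (clamp c d x))))).
        { intros x Hx. rewrite (clamp_id c d x); auto. }
        apply (h_prim (fun x => clamp (- M) M (x * Z (clamp c d x) - V (clamp c d x)))).
        apply (truncated_arg_continuity (fun x => V (clamp c d x)) (fun x => Z (clamp c d x)));
          apply cont_on_clamp; auto; lra.
      * apply has_primitive_continuous; [lra|]. apply cont_on_penalty; auto.
Qed.
End Penalised.

(** [K] is fixed before the lower functions and the boundary values, so that a whole sequence of
    solutions lies in one [C11] class. It suffices to choose a truncation level that the solution
    never reaches. *)
Lemma dirichlet_between (c d B : R) (h : R -> R -> R) :
  0 < c -> c < d -> 0 <= B -> admissible c d h ->
  exists K, forall (g1 g2 be : R -> R) (Y1 Y2 : R),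
    cont_on c d g1 -> cont_on c d g2 -> cont_on c d be ->
    (forall x, c < x < d -> lower_at c d h g1 x) ->
    (forall x, c < x < d -> lower_at c d h g2 x) ->
    (forall x, c < x < d -> lower_at c d (reflect h) (fun x => - be x) x) ->
    (forall x, c <= x <= d -> g1 x <= be x /\ g2 x <= be x) ->
    Rabs Y1 <= B -> Rabs Y2 <= B ->
    Rmax (g1 c) (g2 c) <= Y1 <= be c -> Rmax (g1 d) (g2 d) <= Y2 <= be d ->
    exists V Z, solves c d h K V Z /\ V c = Y1 /\ V d = Y2 /\
      forall x, c <= x <= d -> Rmax (g1 x) (g2 x) <= V x <= be x.
Proof.
  intros Hc Hcd HB (Heq & [C [HC Hgrow]] & Hprim & Happ).
  (* If [K] is a [C11] constant of the solution, [d * K] bounds [x Z] and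
     [(K + K * (d - c)) * (d - c)] bounds [V - Y1]; hence [|x Z - V| <= B + D * K]. *)
  pose (D := d + (1 + (d - c)) * (d - c)).
  assert (HD : 0 <= D) by (unfold D; nra).
  assert (HBd : 0 <= 2 * B / (d - c)).
  { apply Rmult_le_pos; [lra|]. left. apply Rinv_0_lt_compat. lra. }
  pose (A1 := B + D * (2 * B / (d - c) + 6 * (1 + 2 * (d - c)))).
  pose (A2 := D * (1 + 2 * (d - c)) * C).
  assert (HA1 : 0 <= A1) by (unfold A1; assert (0 <= D * (2 * B / (d - c) + 6 * (1 + 2 * (d - c))))
    by (apply Rmult_le_pos; lra); lra).
  assert (HA2 : 0 <= A2) by (unfold A2; repeat apply Rmult_le_pos; lra).
  (* [rM] is [sqrt M]. By growth, [K] is affine in [rM] and [B + D * K = A1 + A2 * rM], which is at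
     most [rM * rM] because [rM >= 1]. *)
  pose (rM := A1 + A2 + 1). pose (M := rM * rM).
  assert (HsM : sqrt M = rM) by (apply sqrt_square; unfold rM; lra).
  pose (K0 := C * rM).
  pose (K := 2 * B / (d - c) + (K0 + 6) + 2 * (K0 + 6) * (d - c)).
  exists K. intros g1 g2 be Y1 Y2 Cg1 Cg2 Cbe Lg1 Lg2 Lbe Hle HY1 HY2 Hbc Hbd.
  assert (HM : 0 <= M) by (unfold M, rM; nra).
  assert (Hseq : forall n, exists hL : (R -> R -> R) * R, 0 <= snd hL /\
     (forall x w w', c <= x <= d -> Rabs (fst hL x w - fst hL x w') <= snd hL * Rabs (w - w')) /\
     (forall x w, c <= x <= d -> Rabs (fst hL x w - h x w) <= (/ 2) ^ n) /\
     (forall w, continuity w -> has_primitive c d (fun x => fst hL x (w x)))).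
  { intros n. destruct (Happ _ (half_pow_pos n)) as (h' & L & H). exists (h', L). exact H. }
  destruct (choice _ Hseq) as [hL HhL].
  pose (lo := fun x => Rmax (g1 x) (g2 x)).
  assert (Clo : cont_on c d lo).
  { intros x Hx eps He. destruct (Cg1 x Hx (eps / 2) ltac:(lra)) as [d1 [P1 H1]].
    destruct (Cg2 x Hx (eps / 2) ltac:(lra)) as [d2 [P2 H2]].
    exists (Rmin d1 d2). split; [apply Rmin_glb_lt; auto|]. intros y Hy Hyx.
    destruct (Rmin_Rgt_l _ _ _ Hyx) as [T1 T2].
    eapply Rle_lt_trans; [apply Rmax_dist|].
    specialize (H1 y Hy T1). specialize (H2 y Hy T2). lra. }
  assert (Hlobe : forall x, c <= x <= d -> lo x <= be x).
  { intros x Hx. destruct (Hle x Hx). apply Rmax_lub; auto. }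
  destruct (penalised_solution c d h (fun n => fst (hL n)) (fun n => snd (hL n)) lo be Y1 Y2 K0 M)
    as (V & Z & HCV & EV1 & EV2 & HDV); auto; try (intros; apply HhL; auto).
  { intros x w Hx. eapply Rle_trans; [apply Hgrow; auto|]. unfold K0.
    apply Rmult_le_compat_l; auto. rewrite <- HsM. apply sqrt_le_1_alt.
    apply Rabs_le_between. apply clamp_in. lra. }
  assert (HK0 : 0 <= K0) by (unfold K0; apply Rmult_le_pos; auto; unfold rM; lra).
  apply (C11_weaken c d _ K) in HCV.
  2:{ assert (Rabs (Y2 - Y1) / (d - c) <= 2 * B / (d - c)); [|unfold K; lra].
      apply Rmult_le_compat_r; [left; apply Rinv_0_lt_compat; lra|].
      apply Rabs_le_between in HY1. apply Rabs_le_between in HY2. apply Rabs_le_between. lra. }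
  assert (HK : 0 <= K) by (eapply C11_K_nonneg; [|apply HCV]; lra).
  assert (HVc : cont_on c d V) by (eapply cont_on_lipschitz, C11_lipschitz, HCV).
  assert (Hw : forall x, c <= x <= d -> clamp (- M) M (x * Z x - V x) = x * Z x - V x).
  { intros x Hx. apply clamp_id. apply Rabs_le_between.
    assert (Hz : Rabs (Z x) <= K) by (apply HCV; auto).
    pose proof (C11_lipschitz _ _ _ _ _ HCV x c Hx ltac:(lra)) as Hv.
    rewrite EV1, (Rabs_right (x - c)) in Hv by lra.
    assert (Hv2 : Rabs (V x - Y1) <= (K + K * (d - c)) * (d - c)).
    { eapply Rle_trans; [apply Hv|]. apply Rmult_le_compat_l; [nra|lra]. }
    assert (Hxz : Rabs (x * Z x) <= d * K).
    { rewrite Rabs_mult, (Rabs_right x) by lra. apply Rmult_le_compat; try lra. apply Rabs_pos. }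
    assert (Htot : Rabs (x * Z x - V x) <= B + D * K).
    { apply Rabs_le_between in Hv2. apply Rabs_le_between in Hxz.
      apply Rabs_le_between in HY1. apply Rabs_le_between. unfold D. lra. }
    eapply Rle_trans; [apply Htot|].
    replace (B + D * K) with (A1 + A2 * rM) by (unfold A1, A2, K, K0; ring).
    unfold M. assert (1 <= rM) by (unfold rM; lra).
    apply Rle_trans with ((A1 + A2) * rM); [nra|]. apply Rmult_le_compat_r; unfold rM; lra. }
  assert (HDw : ae_in c d (fun x => derivable_pt_lim Z x
    (h x (x * Z x - V x) + penalty (lo x) (be x) (V x)))).
  { revert HDV. apply ae_in_impl. intros x Hx HDx. rewrite Hw in HDx by lra. exact HDx. }
  assert (Cpen : cont_on c d (fun x => penalty (lo x) (be x) (V x)))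
    by (apply cont_on_penalty; auto).
  (* The penalty acts below the maximum of [g1] and [g2], but comparison is made with each
     separately, because [lower_at] is a condition on each of them and not on their maximum. *)
  assert (Hlow : forall g, cont_on c d g -> (forall x, c < x < d -> lower_at c d h g x) ->
    (forall x, c <= x <= d -> g x <= lo x) -> forall x, c <= x <= d -> g x <= V x).
  { intros g Cg Lg Hg.
    apply (comparison c d K h g V Z (fun x => penalty (lo x) (be x) (V x))); auto.
    - intros x Hx Hlt. apply penalty_neg; auto. specialize (Hg x Hx). lra.
    - rewrite EV1. specialize (Hg c ltac:(lra)). unfold lo in Hg. lra.
    - rewrite EV2. specialize (Hg d ltac:(lra)). unfold lo in Hg. lra. }
  assert (Hupp : forall x, c <= x <= d -> - be x <= - V x).
  { apply (comparison c d K (reflect h) (fun x => - be x) (fun x => - V x) (fun x => - Z x)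
             (fun x => - penalty (lo x) (be x) (V x))); auto; try lra.
    - apply equicont_reflect; auto.
    - apply (cont_on_comp c d be Ropp); auto. apply (continuity_opp (fun x => x)).
      apply derivable_continuous, derivable_id.
    - apply C11_opp; auto.
    - revert HDw. apply ae_in_impl. intros x Hx HDx. unfold reflect.
      replace (- (x * - Z x - - V x)) with (x * Z x - V x) by ring.
      replace (- h x (x * Z x - V x) + - penalty (lo x) (be x) (V x)) with
        (- (h x (x * Z x - V x) + penalty (lo x) (be x) (V x))) by ring.
      apply derivable_pt_lim_opp. exact HDx.
    - apply (cont_on_comp c d (fun x => penalty (lo x) (be x) (V x)) Ropp); auto.
      apply (continuity_opp (fun x => x)). apply derivable_continuous, derivable_id.
    - intros x Hx Hlt. pose proof (penalty_pos (lo x) (be x) (V x) (Hlobe x Hx)). lra. }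
  assert (Hbetween : forall x, c <= x <= d -> lo x <= V x <= be x).
  { intros x Hx. split; [|specialize (Hupp x Hx); lra]. apply Rmax_lub.
    - apply Hlow; auto. intros; apply Rmax_l.
    - apply Hlow; auto. intros; apply Rmax_r. }
  exists V, Z. split; [|auto]. split; auto.
  revert HDw. apply ae_in_impl. intros x Hx HDx.
  rewrite penalty_zero, Rplus_0_r in HDx by (apply Hbetween; lra). exact HDx.
Qed.

(** * The greatest solution *)

Definition lower_sol (c d : R) (h : R -> R -> R) (B1 B2 : R -> (R -> R) -> R)
  (g : R -> R) : Prop :=
  AC_on c d g /\ B1 (g c) g <= 0 /\ B2 (g d) g <= 0 /\
  forall x0, c < x0 < d -> lower_at c d h g x0.

(** At the supremum of the points where [f <= 0], a positive value would violate the left condition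
    and a negative one the right condition. *)
Lemma downward_jump_zero (f : R -> R) (a b : R) : a <= b ->
  (forall y, a <= y <= b -> liminf_left_ge f y (f y) /\ limsup_right_le f y (f y)) ->
  f a <= 0 <= f b -> exists y, a <= y <= b /\ f y = 0.
Proof.
  intros Hab Hf Hs.
  destruct (completeness (fun y => a <= y <= b /\ f y <= 0)) as [s [Hub Hlub]].
  { exists b. intros y Hy. lra. }
  { exists a. lra. }
  assert (Has : a <= s) by (apply Hub; lra).
  assert (Hsb : s <= b) by (apply Hlub; intros y Hy; lra).
  exists s. split; [lra|]. destruct (Hf s ltac:(lra)) as [Hl Hr]. apply Rle_antisym.
  - apply Rnot_lt_le; intro Hp. destruct (Hl (f s) Hp) as [del [Hdel H]].
    assert (s <= s - del); [|lra]. apply Hlub. intros y [Hy Hfy].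
    apply Rnot_lt_le; intro Hlt. assert (y <= s) by (apply Hub; auto).
    destruct (Req_dec y s) as [->|Hne]; [lra|]. specialize (H y ltac:(lra)). lra.
  - destruct (Req_dec s b) as [->|Hne]; [lra|].
    apply Rnot_lt_le; intro Hn. destruct (Hr (- f s) ltac:(lra)) as [del [Hdel H]].
    pose (z := Rmin b (s + del / 2)).
    assert (Hz : s < z <= b) by (unfold z; split; [apply Rmin_glb_lt; lra|apply Rmin_l]).
    assert (Hz2 : z <= s + del / 2) by apply Rmin_r.
    specialize (H z ltac:(lra)). assert (z <= s); [apply Hub; lra|lra].
Qed.

(** Carries the boundary inequalities of an increasing sequence to its limit. A term equal to [l]
    gives the claim at once; the left condition handles those below. *)
Lemma nonpos_left_limit (f : R -> R) (u : nat -> R) (l : R) :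
  liminf_left_ge f l (f l) -> (forall n, u n <= l) -> is_lim_seq u l ->
  (forall n, f (u n) <= 0) -> f l <= 0.
Proof.
  intros Hf Hu Hl Hn. apply Rnot_lt_le; intro Hp.
  destruct (Hf (f l) Hp) as [del [Hdel H]].
  destruct (is_lim_seq_eps _ _ Hl del Hdel) as [N HN]. specialize (HN N (le_n N)).
  specialize (Hu N). specialize (Hn N).
  destruct (Req_dec (u N) l) as [E|Hne]; [rewrite E in Hn; lra|].
  apply Rabs_def2 in HN. specialize (H (u N) ltac:(lra)). lra.
Qed.

Lemma lower_at_solves c d h K V Z x0 : c < x0 < d -> solves c d h K V Z -> lower_at c d h V x0.
Proof.
  intros Hx0 [HC HD]. right. exists c, d. split; [lra|split; [lra|]]. exists Z.
  split; [intros; eapply C11_derivable; eauto|split].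
  - eapply AC_on_lipschitz, C11_deriv_lipschitz, HC.
  - apply ae_in_on. revert HD. apply ae_in_impl. intros x Hx HDx. eexists. split; [apply HDx|lra].
Qed.

Lemma solves_limit c d h K (Vn Zn : nat -> R -> R) (V : R -> R) :
  0 < c -> c < d -> equicont c d h ->
  (forall w, continuity w -> has_primitive c d (fun x => h x (w x))) ->
  (forall n, solves c d h K (Vn n) (Zn n)) ->
  (forall x, c <= x <= d -> is_lim_seq (fun n => Vn n x) (V x)) ->
  exists Z, solves c d h K V Z.
Proof.
  intros Hc Hcd Heq Hprim HS HV.
  assert (HC : forall n, C11 c d K (Vn n) (Zn n)) by (intros; apply HS).
  assert (HK : 0 <= K) by (eapply C11_K_nonneg; [|apply (HC 0%nat)]; lra).
  destruct (C11_limit c d K Vn Zn V Hcd HC HV) as [Z [HCZ HZ]].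
  assert (HVc : cont_on c d V) by (eapply cont_on_lipschitz, C11_lipschitz, HCZ).
  assert (HZc : cont_on c d Z) by (eapply cont_on_lipschitz, C11_deriv_lipschitz, HCZ).
  exists Z. split; auto.
  apply (ode_limit c d (2 * K) Zn (fun n x => h x (x * Zn n x - Vn n x)) Z); auto.
  - intros n. eapply C11_deriv_lipschitz, HC.
  - intros n. apply HS.
  - intros eps He. destruct (Heq eps He) as [del [Hdel Hh]].
    pose (e1 := del / (2 * (d + 1))).
    assert (He1 : 0 < e1) by (apply Rdiv_lt_0_compat; lra).
    destruct (lipschitz_limit_uniform c d (K + K * (d - c)) Vn V ltac:(lra) ltac:(nra)
      (fun n => C11_lipschitz _ _ _ _ _ (HC n)) HV e1 He1) as [N1 HN1].
    destruct (lipschitz_limit_uniform c d (2 * K) Zn Z ltac:(lra) ltac:(nra)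
      (fun n => C11_deriv_lipschitz _ _ _ _ _ (HC n)) HZ e1 He1) as [N2 HN2].
    exists (Nat.max N1 N2). intros n Hn x Hx.
    specialize (HN1 n ltac:(lia) x Hx). specialize (HN2 n ltac:(lia) x Hx).
    left. apply Hh; auto.
    replace (x * Zn n x - Vn n x - (x * Z x - V x)) with
      (x * (Zn n x - Z x) + - (Vn n x - V x)) by ring.
    eapply Rle_lt_trans; [apply Rabs_triang|].
    rewrite Rabs_Ropp, Rabs_mult, (Rabs_right x) by lra.
    assert (E : (d + 1) * e1 = del / 2) by (unfold e1; field; lra).
    pose proof (Rabs_pos (Zn n x - Z x)).
    assert (x * Rabs (Zn n x - Z x) <= d * e1) by (apply Rmult_le_compat; lra). nra.
  - apply (has_primitive_ext c d (fun x => h x (x * Z (clamp c d x) - V (clamp c d x)))).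
    { intros x Hx. rewrite (clamp_id c d x); auto. }
    apply (Hprim (fun x => x * Z (clamp c d x) - V (clamp c d x))).
    apply (continuity_minus (fun x => x * Z (clamp c d x)) (fun x => V (clamp c d x))).
    + apply (continuity_mult (fun x => x) (fun x => Z (clamp c d x))).
      * apply derivable_continuous, derivable_id.
      * apply cont_on_clamp; auto; lra.
    + apply cont_on_clamp; auto; lra.
Qed.

(** * The integral as a strictly monotone functional *)

Section IntegralFunctional.
Variables (c d : R) (J : (R -> R) -> R -> R).
Hypothesis Hcd : c < d.
Hypothesis HJ : forall Z, continuity Z ->
  J Z c = 0 /\ forall x, derivable_pt_lim (J Z) x (Z x).

Let integral (V : R -> R) := J (fun x => V (clamp c d x)) d.

Let diff_mono V V' : cont_on c d V -> cont_on c d V' ->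
  (forall x, c <= x <= d -> V x <= V' x) -> forall x y, x <= y ->
  J (fun x => V' (clamp c d x)) x - J (fun x => V (clamp c d x)) x <=
  J (fun x => V' (clamp c d x)) y - J (fun x => V (clamp c d x)) y.
Proof.
  intros HV HV' Hle x y Hxy.
  apply cont_on_clamp in HV; [|lra]. apply cont_on_clamp in HV'; [|lra].
  destruct (HJ _ HV) as [_ D]. destruct (HJ _ HV') as [_ D'].
  destruct (Req_dec x y) as [->|Hne]; [lra|].
  destruct (MVT_cor2 (fun x => J (fun x => V' (clamp c d x)) x - J (fun x => V (clamp c d x)) x)
    (fun x => V' (clamp c d x) - V (clamp c d x)) x y ltac:(lra)) as [t [E _]].
  { intros t _. apply derivable_pt_lim_minus; auto. }
  pose proof (Hle (clamp c d t) (clamp_in c d t ltac:(lra))).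
  assert (0 <= (V' (clamp c d t) - V (clamp c d t)) * (y - x)) by (apply Rmult_le_pos; lra).
  lra.
Qed.

Lemma integral_mono V V' : cont_on c d V -> cont_on c d V' ->
  (forall x, c <= x <= d -> V x <= V' x) -> integral V <= integral V'.
Proof.
  intros HV HV' Hle. pose proof (diff_mono V V' HV HV' Hle c d ltac:(lra)) as H.
  apply cont_on_clamp in HV; [|lra]. apply cont_on_clamp in HV'; [|lra].
  destruct (HJ _ HV) as [E _]. destruct (HJ _ HV') as [E' _]. unfold integral. lra.
Qed.

(** The difference of the two primitives is nondecreasing and has no total increase, so it is
    constant and its derivative vanishes inside; continuity settles the endpoints. *)
Lemma integral_strict V V' : cont_on c d V -> cont_on c d V' ->
  (forall x, c <= x <= d -> V x <= V' x) -> integral V' <= integral V ->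
  forall x, c <= x <= d -> V' x = V x.
Proof.
  intros HV HV' Hle HI. pose proof (diff_mono V V' HV HV' Hle) as Hm.
  pose proof (proj1 (cont_on_clamp c d V ltac:(lra)) HV) as CV.
  pose proof (proj1 (cont_on_clamp c d V' ltac:(lra)) HV') as CV'.
  destruct (HJ _ CV) as [E D]. destruct (HJ _ CV') as [E' D'].
  assert (Hin : forall x, c < x < d -> V' x - V x = 0).
  { intros x Hx.
    assert (HD : derivable_pt_lim (fun x => J (fun x => V' (clamp c d x)) x -
        J (fun x => V (clamp c d x)) x) x (V' (clamp c d x) - V (clamp c d x)))
      by (apply derivable_pt_lim_minus; auto).
    rewrite (clamp_id c d x) in HD by lra.
    apply (uniqueness_limite (fun _ => 0) x); [|apply derivable_pt_lim_const].
    revert HD. apply (derivable_pt_lim_local _ _ c d); auto.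
    intros y Hy. pose proof (Hm c y ltac:(lra)). pose proof (Hm y d ltac:(lra)).
    unfold integral in HI. lra. }
  pose proof (cont_on_minus c d V' V HV' HV) as HC.
  intros x Hx. apply Rminus_diag_uniq. apply NNPP; intro Hne.
  destruct (HC x Hx (Rabs (V' x - V x)) (Rabs_pos_lt _ Hne)) as [del [Hdel H]].
  pose (s := Rmin (del / 2) ((d - c) / 4)).
  assert (Hs : 0 < s) by (apply Rmin_glb_lt; lra).
  assert (Hs1 : s <= del / 2) by apply Rmin_l.
  assert (Hs2 : s <= (d - c) / 4) by apply Rmin_r.
  assert (Hy : exists y, c < y < d /\ Rabs (y - x) < del).
  { destruct (Rle_lt_dec x ((c + d) / 2)).
    - exists (x + s). split; [lra|]. apply Rabs_def1; lra.
    - exists (x - s). split; [lra|]. apply Rabs_def1; lra. }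
  destruct Hy as [y [Hy Hyx]]. specialize (H y ltac:(lra) Hyx). simpl in H.
  rewrite (Hin y Hy), Rminus_0_l, Rabs_Ropp in H. lra.
Qed.
End IntegralFunctional.

Section Greatest.
Variables (c d : R) (h : R -> R -> R) (B1 B2 : R -> (R -> R) -> R) (al be : R -> R).
Hypothesis Hc : 0 < c.
Hypothesis Hcd : c < d.
Hypothesis Hh : admissible c d h.
Hypothesis Hal : lower_sol c d h B1 B2 al.
Hypothesis Abe : AC_on c d be.
Hypothesis Bbe1 : 0 <= B1 (be c) be.
Hypothesis Bbe2 : 0 <= B2 (be d) be.
Hypothesis Lbe : forall x0, c < x0 < d -> lower_at c d (reflect h) (fun x => - be x) x0.
Hypothesis Hab : forall x, c <= x <= d -> al x <= be x.
Hypothesis H1 : forall g y, in_order_interval c d al be g -> in_E c d al be y ->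
  liminf_left_ge (fun z => B1 z g) y (B1 y g) /\
  limsup_right_le (fun z => B1 z g) y (B1 y g) /\
  liminf_left_ge (fun z => B2 z g) y (B2 y g) /\
  limsup_right_le (fun z => B2 z g) y (B2 y g).
Hypothesis H2 : forall y g1 g2, in_E c d al be y ->
  in_order_interval c d al be g1 -> in_order_interval c d al be g2 ->
  (forall x, c <= x <= d -> g1 x <= g2 x) ->
  B1 y g2 <= B1 y g1 /\ B2 y g2 <= B2 y g1.

Let low (g : R -> R) := in_order_interval c d al be g /\ lower_sol c d h B1 B2 g.

Let E_at x y : c <= x <= d -> al x <= y <= be x -> in_E c d al be y.
Proof. intros Hx Hy. split; exists x; lra. Qed.

Let be_in : in_order_interval c d al be be.
Proof. split; auto. intros x Hx. specialize (Hab x Hx). lra. Qed.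

Let max_in g1 g2 : in_order_interval c d al be g1 -> in_order_interval c d al be g2 ->
  in_order_interval c d al be (fun x => Rmax (g1 x) (g2 x)).
Proof.
  intros [A1 I1] [A2 I2]. split; [apply AC_on_max; auto|]. intros x Hx.
  specialize (I1 x Hx). specialize (I2 x Hx).
  pose proof (Rmax_l (g1 x) (g2 x)). split; [lra|]. apply Rmax_lub; lra.
Qed.

(** The last two equations keep the second argument at the maximum: applied to [g1 = g2 = V], they
    become the boundary conditions as soon as the improvement of [V] is [V] itself. *)
Lemma improve_lower : exists K, forall g1 g2, low g1 -> low g2 ->
  exists VZ : (R -> R) * (R -> R),
    solves c d h K (fst VZ) (snd VZ) /\ low (fst VZ) /\
    (forall x, c <= x <= d -> g1 x <= fst VZ x /\ g2 x <= fst VZ x) /\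
    B1 (fst VZ c) (fun x => Rmax (g1 x) (g2 x)) = 0 /\
    B2 (fst VZ d) (fun x => Rmax (g1 x) (g2 x)) = 0.
Proof.
  pose (B := Rabs (al c) + Rabs (be c) + Rabs (al d) + Rabs (be d)).
  pose proof (Rabs_pos (al c)). pose proof (Rabs_pos (be c)).
  pose proof (Rabs_pos (al d)). pose proof (Rabs_pos (be d)).
  destruct (dirichlet_between c d B h Hc Hcd ltac:(unfold B; lra) Hh) as [K HKd].
  exists K. intros g1 g2 [I1 (A1 & P1 & Q1 & L1)] [I2 (A2 & P2 & Q2 & L2)].
  pose (m := fun x => Rmax (g1 x) (g2 x)).
  assert (Im : in_order_interval c d al be m) by (apply max_in; auto).
  assert (Hm1 : forall x, c <= x <= d -> g1 x <= m x) by (intros; apply Rmax_l).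
  assert (Hm2 : forall x, c <= x <= d -> g2 x <= m x) by (intros; apply Rmax_r).
  assert (Hmb : forall x, c <= x <= d -> m x <= be x) by (intros x Hx; apply Im, Hx).
  assert (Hma : forall x, c <= x <= d -> al x <= m x) by (intros x Hx; apply Im, Hx).
  (* The end value of [m] is that of one of [g1], [g2], and enlarging the second argument from that
     function to [m] only lowers [B1]. *)
  assert (Ec1 : B1 (m c) m <= 0).
  { unfold m at 1. apply (Rmax_case (g1 c) (g2 c) (fun y => B1 y m <= 0)).
    - eapply Rle_trans; [|apply P1]. apply H2; auto. apply (E_at c); [lra|apply I1; lra].
    - eapply Rle_trans; [|apply P2]. apply H2; auto. apply (E_at c); [lra|apply I2; lra]. }
  assert (Ed1 : B2 (m d) m <= 0).
  { unfold m at 1. apply (Rmax_case (g1 d) (g2 d) (fun y => B2 y m <= 0)).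
    - eapply Rle_trans; [|apply Q1]. apply H2; auto. apply (E_at d); [lra|apply I1; lra].
    - eapply Rle_trans; [|apply Q2]. apply H2; auto. apply (E_at d); [lra|apply I2; lra]. }
  assert (Ec2 : 0 <= B1 (be c) m).
  { eapply Rle_trans; [apply Bbe1|]. apply H2; auto. apply (E_at c); [lra|].
    specialize (Hab c ltac:(lra)). lra. }
  assert (Ed2 : 0 <= B2 (be d) m).
  { eapply Rle_trans; [apply Bbe2|]. apply H2; auto. apply (E_at d); [lra|].
    specialize (Hab d ltac:(lra)). lra. }
  pose proof (Hma c ltac:(lra)) as Hac. pose proof (Hma d ltac:(lra)) as Had.
  destruct (downward_jump_zero (fun z => B1 z m) (m c) (be c)) as [Y1 [HY1 Z1]]; auto.
  { apply Hmb; lra. }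
  { intros y Hy. assert (Ey : in_E c d al be y) by (apply (E_at c); lra).
    destruct (H1 m y Im Ey) as (? & ? & ? & ?). auto. }
  destruct (downward_jump_zero (fun z => B2 z m) (m d) (be d)) as [Y2 [HY2 Z2]]; auto.
  { apply Hmb; lra. }
  { intros y Hy. assert (Ey : in_E c d al be y) by (apply (E_at d); lra).
    destruct (H1 m y Im Ey) as (? & ? & ? & ?). auto. }
  simpl in Z1, Z2.
  assert (Habs : forall a b y, a <= y <= b -> Rabs y <= Rabs a + Rabs b).
  { intros a b y Hy. apply Rabs_le_between. pose proof (Rle_abs b). pose proof (Rle_abs (- a)).
    rewrite Rabs_Ropp in *. pose proof (Rabs_pos a). pose proof (Rabs_pos b). lra. }
  destruct (HKd g1 g2 be Y1 Y2) as (V & Z & HS & EV1 & EV2 & HV); auto;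
    try (apply AC_on_cont; auto).
  { intros x Hx. split; [apply I1|apply I2]; auto. }
  { pose proof (Habs (al c) (be c) Y1 ltac:(lra)). unfold B; lra. }
  { pose proof (Habs (al d) (be d) Y2 ltac:(lra)). unfold B; lra. }
  assert (IV : in_order_interval c d al be V).
  { split; [eapply AC_on_lipschitz, C11_lipschitz, HS|]. intros x Hx.
    specialize (HV x Hx). specialize (Hma x Hx). fold (m x) in HV. lra. }
  assert (HmV : forall x, c <= x <= d -> m x <= V x) by (intros x Hx; apply HV, Hx).
  exists (V, Z). simpl. split; [auto|split; [split; [auto|]|split]].
  - split; [apply IV|split; [|split]].
    + eapply Rle_trans; [|right; apply Z1]. rewrite EV1. apply H2; auto.
      apply (E_at c); lra.
    + eapply Rle_trans; [|right; apply Z2]. rewrite EV2. apply H2; auto.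
      apply (E_at d); lra.
    + intros x0 Hx0. eapply lower_at_solves; eauto.
  - intros x Hx. specialize (HmV x Hx). specialize (Hm1 x Hx). specialize (Hm2 x Hx). lra.
  - rewrite EV1, EV2. auto.
Qed.

(** The supremum of the integrals is approached by lower solutions [U n]. These need not be ordered
    or regular, so they are absorbed into an increasing sequence [W n] of genuine solutions of the
    differential equation. *)
Lemma greatest_solution : exists V Z K, solves c d h K V Z /\
  in_order_interval c d al be V /\ B1 (V c) V = 0 /\ B2 (V d) V = 0 /\
  forall g, in_order_interval c d al be g -> lower_sol c d h B1 B2 g ->
    forall x, c <= x <= d -> g x <= V x.
Proof.
  destruct improve_lower as [K Himp].
  destruct (antiderivative_operator c) as [J HJ].
  pose (I := fun V : R -> R => J (fun x => V (clamp c d x)) d).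
  assert (Hcont : forall g, low g -> cont_on c d g) by (intros g Hg; apply AC_on_cont, Hg).
  assert (Cbe : cont_on c d be) by (apply AC_on_cont; auto).
  assert (lal : low al).
  { split; auto. split; [apply Hal|]. intros x Hx. specialize (Hab x Hx). lra. }
  destruct (completeness (fun r => exists g, low g /\ r = I g)) as [S [Sub Slub]].
  { exists (I be). intros r [g [Hg ->]]. apply (integral_mono c d J Hcd HJ); auto.
    intros x Hx. apply Hg; auto. }
  { exists (I al), al. auto. }
  assert (HU : forall n : nat, exists g, low g /\ S - / (INR n + 1) < I g).
  { intros n. apply NNPP; intro Hn.
    assert (Hpos : 0 < / (INR n + 1)) by (apply Rinv_0_lt_compat; pose proof (pos_INR n); lra).
    assert (S <= S - / (INR n + 1)); [|lra]. apply Slub. intros r [g [Hg ->]].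
    apply Rnot_lt_le; intro Hlt. apply Hn. exists g. auto. }
  destruct (choice _ HU) as [U HUn].
  assert (HF : forall gg : (R -> R) * (R -> R), exists VZ : (R -> R) * (R -> R),
    low (fst gg) -> low (snd gg) -> solves c d h K (fst VZ) (snd VZ) /\ low (fst VZ) /\
    (forall x, c <= x <= d -> fst gg x <= fst VZ x /\ snd gg x <= fst VZ x)).
  { intros [g1 g2]. simpl. destruct (classic (low g1 /\ low g2)) as [[L1 L2]|HN].
    - destruct (Himp g1 g2 L1 L2) as [VZ HVZ]. exists VZ. tauto.
    - exists (g1, g2). tauto. }
  destruct (choice _ HF) as [F HFp].
  (* Starting from an improvement of [al] makes every [W n] a solution with the same [K], as the
     passage to the limit requires. *)
  pose (W := fix W n := match n with O => F (al, al) | S n => F (fst (W n), U n) end).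
  assert (HW : forall n, solves c d h K (fst (W n)) (snd (W n)) /\ low (fst (W n))).
  { induction n as [|n [_ IH]]; simpl.
    - destruct (HFp (al, al)) as (A & B & _); auto.
    - destruct (HFp (fst (W n), U n)) as (A & B & _); auto. apply HUn. }
  assert (HWs : forall n x, c <= x <= d ->
    fst (W n) x <= fst (W (Datatypes.S n)) x /\ U n x <= fst (W (Datatypes.S n)) x).
  { intros n. destruct (HFp (fst (W n), U n)) as (_ & _ & A); simpl; auto; [apply HW|apply HUn]. }
  assert (HWin : forall n x, c <= x <= d -> al x <= fst (W n) x <= be x)
    by (intros n; apply HW).
  pose (V := fun x => real (Lim_seq (fun n => fst (W n) x))).
  assert (HV : forall x, c <= x <= d -> is_lim_seq (fun n => fst (W n) x) (V x)).
  { intros x Hx. apply Lim_seq_correct'. apply ex_finite_lim_seq_incr with (be x); intros n.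
    - apply HWs; auto.
    - apply HWin; auto. }
  assert (HWV : forall n x, c <= x <= d -> fst (W n) x <= V x).
  { intros n x Hx. apply (is_lim_seq_incr_compare (fun n => fst (W n) x)); auto.
    intros k. apply HWs; auto. }
  destruct Hh as (Heq & _ & Hprim & _).
  destruct (solves_limit c d h K (fun n => fst (W n)) (fun n => snd (W n)) V) as [Z HS]; auto.
  { intros n. apply HW. }
  assert (IV : in_order_interval c d al be V).
  { split; [eapply AC_on_lipschitz, C11_lipschitz, HS|]. intros x Hx. split.
    - pose proof (HWin 0%nat x Hx). pose proof (HWV 0%nat x Hx). lra.
    - apply (is_lim_seq_le (fun n => fst (W n) x) (fun _ => be x) (V x) (be x)); auto.
      + intros n. apply HWin; auto.
      + apply is_lim_seq_const. }
  (* [V] dominates every [W n], so replacing [W n] by [V] in the second argument keeps [B_i]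
     nonpositive; then the first argument tends to its limit from the left. *)
  assert (lV : low V).
  { split; [auto|split; [apply IV|split; [|split]]].
    - apply (nonpos_left_limit (fun z => B1 z V) (fun n => fst (W n) c)); auto.
      + apply H1; auto. apply (E_at c); [lra|apply IV; lra].
      + intros n. apply HWV; lra.
      + apply HV; lra.
      + intros n. destruct (HW n) as [_ [In (An & Bn & _)]].
        eapply Rle_trans; [|apply Bn]. apply H2; auto. apply (E_at c); [lra|apply HWin; lra].
    - apply (nonpos_left_limit (fun z => B2 z V) (fun n => fst (W n) d)); auto.
      + apply H1; auto. apply (E_at d); [lra|apply IV; lra].
      + intros n. apply HWV; lra.
      + apply HV; lra.
      + intros n. destruct (HW n) as [_ [In (An & _ & Bn & _)]].
        eapply Rle_trans; [|apply Bn]. apply H2; auto. apply (E_at d); [lra|apply HWin; lra].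
    - intros x0 Hx0. eapply lower_at_solves; eauto. }
  assert (HIV : S <= I V).
  { apply Rnot_lt_le; intro Hlt.
    destruct (INR_archimed (S - I V) 1 ltac:(lra)) as [n Hn].
    destruct (HUn n) as [Ul HUI].
    assert (HIU : I (U n) <= I V).
    { apply (integral_mono c d J Hcd HJ); auto. intros x Hx.
      pose proof (HWs n x Hx). pose proof (HWV (Datatypes.S n) x Hx). lra. }
    pose proof (pos_INR n).
    assert (Hinv : / (INR n + 1) * (INR n + 1) = 1) by (field; lra).
    assert (0 < / (INR n + 1)) by (apply Rinv_0_lt_compat; lra). nra. }
  (* The integral of [V] attains the supremum [S], so a lower solution above [V] has the same
     integral. *)
  assert (Hsame : forall V', low V' -> (forall x, c <= x <= d -> V x <= V' x) ->
    forall x, c <= x <= d -> V' x = V x).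
  { intros V' lV' Hle. apply (integral_strict c d J Hcd HJ); auto.
    change (I V' <= I V). eapply Rle_trans; [|apply HIV]. apply Sub. exists V'. auto. }
  exists V, Z, K. split; [auto|split; [auto|]].
  assert (HB : B1 (V c) V = 0 /\ B2 (V d) V = 0).
  (* [V'] enters the two equations only through its end values, so agreement on [[c, d]] suffices;
     the second argument [Rmax V V] is [V] as a function. *)
  { destruct (Himp V V lV lV) as ([V' Z'] & _ & lV' & Hle & E1 & E2). simpl in *.
    assert (Es : forall x, c <= x <= d -> V' x = V x).
    { apply Hsame; auto. intros x Hx. apply Hle; auto. }
    rewrite (Es c) in E1 by lra. rewrite (Es d) in E2 by lra.
    replace (fun x => Rmax (V x) (V x)) with V in E1, E2; auto.
    apply functional_extensionality. intros x. symmetry. apply Rmax_left. lra. }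
  split; [apply HB|split; [apply HB|]].
  (* The improvement of [V] and [g] lies above both and coincides with [V], hence [g <= V]. *)
  intros g Ig Lg. destruct (Himp V g lV (conj Ig Lg)) as ([V' Z'] & _ & lV' & Hle & _).
  simpl in *. intros x Hx. rewrite <- (Hsame V' lV' (fun x Hx => proj1 (Hle x Hx)) x Hx).
  apply Hle; auto.
Qed.
End Greatest.

(** * The concrete right-hand side *)

Lemma sqrt_diff (s t : R) : 0 <= s -> 0 <= t ->
  Rabs (sqrt s - sqrt t) * (sqrt s + sqrt t) = Rabs (s - t).
Proof.
  intros Hs Ht. pose proof (sqrt_pos s). pose proof (sqrt_pos t).
  rewrite <- (Rabs_right (sqrt s + sqrt t)) by lra. rewrite <- Rabs_mult. f_equal.
  rewrite <- (sqrt_sqrt s) at 3 by auto. rewrite <- (sqrt_sqrt t) at 3 by auto. ring.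
Qed.

Lemma sqrt_diff_hoelder (s t : R) : 0 <= s -> 0 <= t ->
  Rabs (sqrt s - sqrt t) <= sqrt (Rabs (s - t)).
Proof.
  intros Hs Ht. rewrite <- (sqrt_diff s t) by auto.
  pose proof (sqrt_pos s). pose proof (sqrt_pos t). pose proof (Rabs_pos (sqrt s - sqrt t)).
  rewrite <- (sqrt_square (Rabs (sqrt s - sqrt t))) at 1 by auto. apply sqrt_le_1_alt.
  apply Rmult_le_compat_l; auto. unfold Rabs. destruct (Rcase_abs _); lra.
Qed.

Lemma sqrt_diff_lip (s t m : R) : 0 <= t -> 0 < m -> m * m <= s ->
  Rabs (sqrt s - sqrt t) <= Rabs (s - t) / m.
Proof.
  intros Ht Hm Hs. assert (0 <= s) by nra.
  assert (m <= sqrt s) by (rewrite <- (sqrt_square m) by lra; apply sqrt_le_1_alt; auto).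
  apply Rmult_le_reg_r with m; auto. unfold Rdiv. rewrite Rmult_assoc, Rinv_l, Rmult_1_r by lra.
  rewrite <- (sqrt_diff s t) by auto. apply Rmult_le_compat_l; [apply Rabs_pos|].
  pose proof (sqrt_pos t). lra.
Qed.

(** The quotient of [|a + b|] by the sum of the roots is at most 1. Since the bound does not depend
    on [s], perturbing [p] costs the same for all [w]. *)
Lemma sqrt_sqr_plus_lip (a b s : R) : 0 <= s ->
  Rabs (sqrt (a * a + s) - sqrt (b * b + s)) <= Rabs (a - b).
Proof.
  intros Hs. destruct (Req_dec a b) as [->|Hne].
  { rewrite !Rminus_diag, Rabs_R0. lra. }
  assert (Ha : Rabs a <= sqrt (a * a + s)).
  { rewrite <- sqrt_Rsqr_abs. apply sqrt_le_1_alt. unfold Rsqr. lra. }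
  assert (Hb : Rabs b <= sqrt (b * b + s)).
  { rewrite <- sqrt_Rsqr_abs. apply sqrt_le_1_alt. unfold Rsqr. lra. }
  pose proof (Rabs_pos a). pose proof (Rabs_pos b).
  assert (Hpos : 0 < Rabs a + Rabs b).
  { destruct (Req_dec a 0) as [->|Hza]; [|pose proof (Rabs_pos_lt a Hza); lra].
    pose proof (Rabs_pos_lt b ltac:(lra)). lra. }
  pose proof (sqrt_diff (a * a + s) (b * b + s) ltac:(nra) ltac:(nra)) as E.
  replace (a * a + s - (b * b + s)) with ((a - b) * (a + b)) in E by ring.
  rewrite Rabs_mult in E. pose proof (Rabs_triang a b). pose proof (Rabs_pos (a - b)).
  pose proof (Rabs_pos (sqrt (a * a + s) - sqrt (b * b + s))).
  apply Rmult_le_reg_r with (sqrt (a * a + s) + sqrt (b * b + s)); [lra|].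
  rewrite E. apply Rmult_le_compat_l; lra.
Qed.

(* [- H] as a function of [w = x z - y], the only combination of [y] and [z] in [H]. *)
Definition rhs (p q : R -> R) (x w : R) : R := - Hfun p q x (- w) 0.

Lemma rhs_Hfun p q x y z : rhs p q x (x * z - y) = - Hfun p q x y z.
Proof.
  unfold rhs, Hfun. replace (x * 0 - - (x * z - y)) with (x * z - y) by ring. reflexivity.
Qed.

Lemma rhs_eq p q x w : 0 < x ->
  rhs p q x w = (sqrt ((p x * x ^ 2) * (p x * x ^ 2) + 4 * x ^ 3 * q x * Rabs w) - p x * x ^ 2)
                / (2 * x ^ 3).
Proof.
  intros Hx. unfold rhs, Hfun. replace (x * 0 - - w) with w by ring.
  replace (p x ^ 2 * x ^ 4) with (p x * x ^ 2 * (p x * x ^ 2)) by ring. field.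
  apply Rgt_not_eq. apply Hx.
Qed.

Lemma rhs_nonneg p q x w : 0 < x -> 0 <= p x -> 0 <= q x -> 0 <= rhs p q x w.
Proof.
  intros Hx Hp Hq. rewrite rhs_eq by auto.
  pose proof (pow_lt x 3 Hx). pose proof (pow_lt x 2 Hx). pose proof (Rabs_pos w).
  apply Rmult_le_pos; [|left; apply Rinv_0_lt_compat; lra].
  assert (0 <= p x * x ^ 2) by (apply Rmult_le_pos; lra).
  rewrite <- (sqrt_square (p x * x ^ 2)) at 3 by auto.
  assert (0 <= 4 * x ^ 3 * q x * Rabs w) by (repeat apply Rmult_le_pos; lra).
  assert (sqrt (p x * x ^ 2 * (p x * x ^ 2)) <=
    sqrt (p x * x ^ 2 * (p x * x ^ 2) + 4 * x ^ 3 * q x * Rabs w)); [|lra].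
  apply sqrt_le_1_alt. lra.
Qed.

(** * Continuity, growth and Lipschitz approximation of [rhs] *)

Section Admissible.
Variables (c d Q : R) (p q : R -> R).
Hypothesis Hc : 0 < c.
Hypothesis Hcd : c < d.
Hypothesis Hp : forall x, c <= x <= d -> 0 <= p x.
Hypothesis Hq : forall x, c <= x <= d -> 0 <= q x <= Q.
Hypothesis Mp : measurable_on c d p.
Hypothesis Mq : measurable_on c d q.

Let C := sqrt (4 * d ^ 3 * Q) / (2 * c ^ 3).

Let C_nonneg : 0 <= C.
Proof.
  apply Rmult_le_pos; [apply sqrt_pos|]. left. apply Rinv_0_lt_compat.
  pose proof (pow_lt c 3 Hc). lra.
Qed.

Lemma rhs_diff_eq (p' : R -> R) x w w' : c <= x <= d ->
  Rabs (rhs p' q x w - rhs p' q x w') =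
  Rabs (sqrt ((p' x * x ^ 2) * (p' x * x ^ 2) + 4 * x ^ 3 * q x * Rabs w) -
        sqrt ((p' x * x ^ 2) * (p' x * x ^ 2) + 4 * x ^ 3 * q x * Rabs w')) / (2 * x ^ 3).
Proof.
  intros Hx. rewrite !rhs_eq by lra. pose proof (pow_lt x 3 ltac:(lra)) as H3.
  match goal with |- Rabs (?a / ?m - ?b / ?m) = _ =>
    replace (a / m - b / m) with ((a - b) * / m) by (unfold Rdiv; ring) end.
  rewrite Rabs_mult, (Rabs_right (/ _)) by (apply Rle_ge; left; apply Rinv_0_lt_compat; lra).
  unfold Rdiv. f_equal. f_equal. ring.
Qed.

Lemma rhs_radicand_nonneg (p' : R -> R) x w : c <= x <= d ->
  0 <= (p' x * x ^ 2) * (p' x * x ^ 2) + 4 * x ^ 3 * q x * Rabs w.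
Proof.
  intros Hx. pose proof (pow_lt x 3 ltac:(lra)). pose proof (Hq x Hx). pose proof (Rabs_pos w).
  pose proof (Rle_0_sqr (p' x * x ^ 2)) as Hs. unfold Rsqr in Hs.
  assert (0 <= 4 * x ^ 3 * q x * Rabs w) by (repeat apply Rmult_le_pos; lra). lra.
Qed.

Lemma rhs_radicand_diff (p' : R -> R) x w w' : c <= x <= d ->
  Rabs ((p' x * x ^ 2) * (p' x * x ^ 2) + 4 * x ^ 3 * q x * Rabs w -
        ((p' x * x ^ 2) * (p' x * x ^ 2) + 4 * x ^ 3 * q x * Rabs w')) <=
  4 * x ^ 3 * Q * Rabs (w - w').
Proof.
  intros Hx. pose proof (pow_lt x 3 ltac:(lra)). pose proof (Hq x Hx).
  match goal with |- Rabs (?a + ?b * ?r - (?a + ?b * ?t)) <= _ =>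
    replace (a + b * r - (a + b * t)) with (b * (r - t)) by ring end.
  rewrite Rabs_mult. apply Rmult_le_compat; try apply Rabs_pos.
  - rewrite Rabs_right by (apply Rle_ge; repeat apply Rmult_le_pos; lra).
    apply Rmult_le_compat_l; lra.
  - apply Rabs_triang_inv2.
Qed.

(** A square root of a nonnegative radicand that is Lipschitz in [w]. Uniform continuity and, since
    [rhs] vanishes at [w = 0], square-root growth both follow. *)
Lemma rhs_hoelder x w w' : c <= x <= d ->
  Rabs (rhs p q x w - rhs p q x w') <= C * sqrt (Rabs (w - w')).
Proof.
  intros Hx. rewrite rhs_diff_eq by auto.
  pose proof (pow_lt c 3 Hc) as H3c. pose proof (pow_incr c x 3 ltac:(lra)) as Hcx.
  pose proof (pow_incr x d 3 ltac:(lra)) as Hxd. pose proof (Hq x Hx). pose proof (Rabs_pos (w - w')).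
  unfold C. replace (sqrt (4 * d ^ 3 * Q) / (2 * c ^ 3) * sqrt (Rabs (w - w'))) with
    (sqrt (4 * d ^ 3 * Q * Rabs (w - w')) * / (2 * c ^ 3)).
  2:{ rewrite sqrt_mult_alt; [unfold Rdiv; ring|]. repeat apply Rmult_le_pos; lra. }
  apply Rmult_le_compat; try apply Rabs_pos.
  - left. apply Rinv_0_lt_compat. lra.
  - eapply Rle_trans; [apply sqrt_diff_hoelder; apply rhs_radicand_nonneg; auto|].
    apply sqrt_le_1_alt. eapply Rle_trans; [apply rhs_radicand_diff; auto|].
    apply Rmult_le_compat_r; [lra|]. apply Rmult_le_compat_r; lra.
  - apply Rinv_le_contravar; lra.
Qed.

Lemma rhs_zero x : c <= x <= d -> rhs p q x 0 = 0.
Proof.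
  intros Hx. rewrite rhs_eq by lra. rewrite Rabs_R0, Rmult_0_r, Rplus_0_r.
  rewrite sqrt_square; [unfold Rdiv; ring|].
  apply Rmult_le_pos; [auto|]. apply pow_le; lra.
Qed.

Lemma rhs_growth x w : c <= x <= d -> Rabs (rhs p q x w) <= C * sqrt (Rabs w).
Proof.
  intros Hx. pose proof (rhs_hoelder x w 0 Hx) as H.
  rewrite (rhs_zero x Hx), !Rminus_0_r in H. auto.
Qed.

Lemma rhs_primitive w : continuity w -> has_primitive c d (fun x => rhs p q x (w x)).
Proof.
  intros Hw. unfold rhs.
  apply (has_primitive_opp c d (fun x => Hfun p q x (- w x) 0)).
  destruct (cont_on_max c d (fun x => Rabs (w x))) as [x0 [Hx0 Hmax]]; [lra| |].
  { apply cont_on_continuity. apply (continuity_comp w Rabs); auto. exact Rcontinuity_abs. }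
  apply (Hfun_primitive c d (C * sqrt (Rabs (w x0))) p q (fun x => - w x) (fun _ => 0)); auto.
  - intros x Hx. apply Hq; auto.
  - apply (continuity_opp w); auto.
  - apply continuity_const. intros ? ?; reflexivity.
  - intros x Hx. pose proof (rhs_growth x (w x) Hx) as H. unfold rhs in H.
    rewrite Rabs_Ropp in H. eapply Rle_trans; [apply H|].
    apply Rmult_le_compat_l; auto. apply sqrt_le_1_alt. apply Hmax; auto.
Qed.

(** With [p + e] the radicand is at least the square of [e * x ^ 2], where the root is Lipschitz
    with constant [1 / (e * x ^ 2)]; dividing by [2 * x ^ 3] leaves [2 * Q / (e * x ^ 2)]. *)
Lemma rhs_shift_lip e x w w' : 0 < e -> c <= x <= d ->
  Rabs (rhs (fun x => p x + e) q x w - rhs (fun x => p x + e) q x w') <=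
  2 * Q / (e * c ^ 2) * Rabs (w - w').
Proof.
  intros He Hx. rewrite rhs_diff_eq by auto. pose proof (Hp x Hx) as Hpx.
  pose proof (pow_lt c 2 Hc) as H2c. pose proof (pow_incr c x 2 ltac:(lra)) as Hcx.
  pose proof (pow_lt x 3 ltac:(lra)) as H3. pose proof (pow_lt x 2 ltac:(lra)) as H2.
  pose proof (Hq x Hx) as HQ. pose proof (Rabs_pos (w - w')) as Hw.
  pose proof (Rabs_pos w) as Hw0.
  assert (Hm : 0 < e * x ^ 2) by (apply Rmult_lt_0_compat; lra).
  assert (Hb : 0 <= 4 * x ^ 3 * q x * Rabs w) by (repeat apply Rmult_le_pos; lra).
  eapply Rle_trans.
  { apply Rmult_le_compat_r; [left; apply Rinv_0_lt_compat; lra|].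
    eapply Rle_trans; [apply (sqrt_diff_lip _ _ (e * x ^ 2)); auto|].
    - apply (rhs_radicand_nonneg (fun x => p x + e)); auto.
    - assert (e * x ^ 2 <= (p x + e) * x ^ 2) by (apply Rmult_le_compat_r; lra).
      assert (e * x ^ 2 * (e * x ^ 2) <= (p x + e) * x ^ 2 * ((p x + e) * x ^ 2))
        by (apply Rmult_le_compat; lra). lra.
    - apply Rmult_le_compat_r; [left; apply Rinv_0_lt_compat; auto|].
      apply (rhs_radicand_diff (fun x => p x + e)); auto. }
  replace (4 * x ^ 3 * Q * Rabs (w - w') * / (e * x ^ 2) * / (2 * x ^ 3)) with
    (2 * (Q * Rabs (w - w')) * / (e * x ^ 2)) by (field; lra).
  replace (2 * Q / (e * c ^ 2) * Rabs (w - w')) with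
    (2 * (Q * Rabs (w - w')) * / (e * c ^ 2)) by (unfold Rdiv; ring).
  apply Rmult_le_compat_l.
  - apply Rmult_le_pos; [lra|]. apply Rmult_le_pos; lra.
  - apply Rinv_le_contravar; [apply Rmult_lt_0_compat; lra|]. apply Rmult_le_compat_l; lra.
Qed.

(** The root and the subtracted term each change by at most [e * x ^ 2]; division by [2 * x ^ 3]
    gives [e / x]. *)
Lemma rhs_shift_close e x w : 0 < e -> c <= x <= d ->
  Rabs (rhs (fun x => p x + e) q x w - rhs p q x w) <= e / c.
Proof.
  intros He Hx. rewrite !rhs_eq by lra.
  pose proof (pow_lt x 3 ltac:(lra)) as H3. pose proof (pow_lt x 2 ltac:(lra)) as H2.
  pose proof (Hq x Hx) as HQ. pose proof (Rabs_pos w) as Hw.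
  assert (Hb : 0 <= 4 * x ^ 3 * q x * Rabs w) by (repeat apply Rmult_le_pos; lra).
  pose proof (sqrt_sqr_plus_lip ((p x + e) * x ^ 2) (p x * x ^ 2) _ Hb) as A.
  replace ((p x + e) * x ^ 2 - p x * x ^ 2) with (e * x ^ 2) in A by ring.
  rewrite (Rabs_right (e * x ^ 2)) in A by (apply Rle_ge, Rmult_le_pos; lra).
  match goal with |- Rabs (?a / ?m - ?b / ?m) <= _ =>
    replace (a / m - b / m) with ((a - b) * / m) by (unfold Rdiv; ring) end.
  rewrite Rabs_mult, (Rabs_right (/ _)) by (apply Rle_ge; left; apply Rinv_0_lt_compat; lra).
  apply Rle_trans with (2 * (e * x ^ 2) * / (2 * x ^ 3)).
  - apply Rmult_le_compat_r; [left; apply Rinv_0_lt_compat; lra|].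
    apply Rabs_le_between in A. apply Rabs_le_between.
    replace ((p x + e) * x ^ 2) with (p x * x ^ 2 + e * x ^ 2) in * by ring. lra.
  - replace (2 * (e * x ^ 2) * / (2 * x ^ 3)) with (e * / x) by (field; lra).
    apply Rmult_le_compat_l; [lra|]. apply Rinv_le_contravar; lra.
Qed.

Lemma rhs_equicont : equicont c d (rhs p q).
Proof.
  intros eps He. pose (s := eps / (C + 1)).
  assert (Hs : 0 < s) by (apply Rdiv_lt_0_compat; lra).
  exists (s * s). split; [nra|]. intros x w w' Hx Hw.
  eapply Rle_lt_trans; [apply rhs_hoelder; auto|].
  assert (Hq' : sqrt (Rabs (w - w')) < s).
  { rewrite <- (sqrt_square s) by lra. apply sqrt_lt_1_alt. pose proof (Rabs_pos (w - w')). lra. }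
  assert (E : (C + 1) * s = eps) by (unfold s; field; lra).
  pose proof (sqrt_pos (Rabs (w - w'))). nra.
Qed.
End Admissible.

Lemma measurable_on_shift c d e p : measurable_on c d p -> measurable_on c d (fun x => p x + e).
Proof.
  intros H a.
  replace (fun x => c <= x <= d /\ a < p x + e) with (fun x => c <= x <= d /\ a - e < p x);
    [apply H|].
  apply functional_extensionality; intros x. apply propositional_extensionality.
  split; intros [Hx Ha]; split; auto; lra.
Qed.

Lemma rhs_admissible c d Q p q : 0 < c -> c < d ->
  (forall x, c <= x <= d -> 0 <= p x) -> (forall x, c <= x <= d -> 0 <= q x <= Q) ->
  measurable_on c d p -> measurable_on c d q -> admissible c d (rhs p q).
Proof.
  intros Hc Hcd Hp Hq Mp Mq. split; [apply (rhs_equicont c d Q); auto|split; [|split]].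
  - exists (sqrt (4 * d ^ 3 * Q) / (2 * c ^ 3)). split.
    + apply Rmult_le_pos; [apply sqrt_pos|]. left. apply Rinv_0_lt_compat.
      pose proof (pow_lt c 3 Hc). lra.
    + intros x w Hx. apply (rhs_growth c d Q); auto.
  - intros w Hw. apply (rhs_primitive c d Q); auto.
  - intros eps He. pose (e := eps * c).
    assert (He' : 0 < e) by (apply Rmult_lt_0_compat; auto).
    exists (rhs (fun x => p x + e) q), (2 * Q / (e * c ^ 2)).
    pose proof (pow_lt c 2 Hc).
    split; [|split; [|split]].
    + pose proof (Hq c ltac:(lra)). apply Rmult_le_pos; [lra|].
      left. apply Rinv_0_lt_compat. apply Rmult_lt_0_compat; auto.
    + intros x w w' Hx. apply (rhs_shift_lip c d Q); auto.
    + intros x w Hx. replace eps with (e / c) by (unfold e; field; lra).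
      apply (rhs_shift_close c d Q); auto.
    + intros w Hw. apply (rhs_primitive c d Q); auto.
      * intros x Hx. specialize (Hp x Hx). lra.
      * apply measurable_on_shift; auto.
Qed.

(** * Reflection and the theorem *)

Lemma reflect_involutive (h : R -> R -> R) : reflect (reflect h) = h.
Proof.
  apply functional_extensionality; intros x. apply functional_extensionality; intros w.
  unfold reflect. rewrite !Ropp_involutive. reflexivity.
Qed.

Lemma opp_involutive_fun (g : R -> R) : (fun x => - - g x) = g.
Proof. apply functional_extensionality; intros x. apply Ropp_involutive. Qed.

Lemma has_primitive_reflect c d h : (forall w, continuity w -> has_primitive c d (fun x => h x (w x))) ->
  forall w, continuity w -> has_primitive c d (fun x => reflect h x (w x)).
Proof.
  intros H w Hw. unfold reflect. apply (has_primitive_opp c d (fun x => h x (- w x))).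
  apply (H (fun x => - w x)). apply (continuity_opp w Hw).
Qed.

Lemma admissible_reflect c d h : admissible c d h -> admissible c d (reflect h).
Proof.
  intros (Heq & [C [HC Hg]] & Hprim & Happ).
  split; [apply equicont_reflect; auto|split; [|split]].
  - exists C. split; auto. intros x w Hx. unfold reflect. rewrite Rabs_Ropp, <- (Rabs_Ropp w). auto.
  - apply has_primitive_reflect; auto.
  - intros eps He. destruct (Happ eps He) as (h' & L & HL & Hlip & Hcl & Hp).
    exists (reflect h'), L. split; [auto|split; [|split]].
    + intros x w w' Hx. unfold reflect.
      replace (- h' x (- w) - - h' x (- w')) with (- (h' x (- w) - h' x (- w'))) by ring.
      rewrite Rabs_Ropp, <- (Rabs_Ropp (w - w')).
      replace (- (w - w')) with (- w - - w') by ring. auto.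
    + intros x w Hx. unfold reflect.
      replace (- h' x (- w) - - h x (- w)) with (- (h' x (- w) - h x (- w))) by ring.
      rewrite Rabs_Ropp. auto.
    + apply has_primitive_reflect; auto.
Qed.

Lemma solves_reflect c d h K V Z :
  solves c d (reflect h) K V Z -> solves c d h K (fun x => - V x) (fun x => - Z x).
Proof.
  intros [HC HD]. split; [apply C11_opp; auto|].
  revert HD. apply ae_in_impl. intros x Hx HDx. apply derivable_pt_lim_opp in HDx.
  unfold reflect in HDx. rewrite Ropp_involutive in HDx.
  replace (x * - Z x - - V x) with (- (x * Z x - V x)) by ring. exact HDx.
Qed.

Lemma lower_at_W21 c d p q g x0 :
  dini_Dlm_lt_Dup g x0 \/
    (exists a b, c <= a < x0 /\ x0 < b <= d /\ W21_ineq c d p q 1 g a b) ->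
  lower_at c d (rhs p q) g x0.
Proof.
  intros [H|(a & b & Ha & Hb & g' & Dg & Ag & N & HN & Hae)]; [left; auto|right].
  exists a, b. split; [auto|split; [auto|]]. exists g'. split; [auto|split; [auto|]].
  exists N. split; [auto|]. intros x Hx HNx. destruct (Hae x Hx HNx) as [l [Hl Hi]].
  exists l. split; [auto|]. rewrite rhs_Hfun. lra.
Qed.

(** Negation exchanges upper and lower Dini derivatives on each side, and it reverses the
    differential inequality together with the right-hand side. *)
Lemma lower_at_opp_W21 c d p q g x0 :
  dini_Dum_gt_Dlp g x0 \/
    (exists a b, c <= a < x0 /\ x0 < b <= d /\ W21_ineq c d p q (-1) g a b) ->
  lower_at c d (reflect (rhs p q)) (fun x => - g x) x0.
Proof.
  intros [(s1 & s2 & Hs & HR & HL)|(a & b & Ha & Hb & g' & Dg & Ag & N & HN & Hae)].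
  - left. exists (- s2), (- s1). split; [lra|split]; intros del Hdel.
    + destruct (HL del Hdel) as [h [Hh Hq]]. exists h. split; [auto|].
      replace ((- g (x0 + h) - - g x0) / h) with (- ((g (x0 + h) - g x0) / h)) by (field; lra). lra.
    + destruct (HR del Hdel) as [h [Hh Hq]]. exists h. split; [auto|].
      replace ((- g (x0 + h) - - g x0) / h) with (- ((g (x0 + h) - g x0) / h)) by (field; lra). lra.
  - right. exists a, b. split; [auto|split; [auto|]]. exists (fun x => - g' x).
    split; [intros; apply derivable_pt_lim_opp; auto|split; [apply AC_on_opp; auto|]].
    exists N. split; [auto|]. intros x Hx HNx. destruct (Hae x Hx HNx) as [l [Hl Hi]].
    exists (- l). split; [apply derivable_pt_lim_opp; auto|]. unfold reflect.
    replace (- (x * - g' x - - g x)) with (x * g' x - g x) by ring. rewrite rhs_Hfun. lra.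
Qed.

(** With equality both signs are allowed, so a solution is a lower and an upper solution and is
    caught by the maximality of both extremal functions. *)
Lemma is_solution_W21 c d p q B1 B2 V sgn : is_solution c d p q B1 B2 V ->
  W21_ineq c d p q sgn V c d.
Proof.
  intros (V' & HD & _ & HA & Hae & _). exists V'. split; [|split; auto].
  - intros x Hx. apply (deriv_on_derivable c d); auto.
  - destruct Hae as [N [HN Hae]]. exists N. split; auto. intros x Hx HNx.
    destruct (Hae x Hx HNx) as [l [Hl E]]. exists l. split; auto. rewrite E, Rmult_0_r. lra.
Qed.

Lemma solves_is_solution c d p q B1 B2 K V Z : c < d -> solves c d (rhs p q) K V Z ->
  B1 (V c) V = 0 -> B2 (V d) V = 0 -> is_solution c d p q B1 B2 V.
Proof.
  (* [is_solution] asks for two-sided continuity of the derivative even at [c] and [d]; the clamped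
     extension of [Z] provides it. *)
  intros Hcd [HC HD] E1 E2. exists (fun x => Z (clamp c d x)).
  assert (HC' : C11 c d K V (fun x => Z (clamp c d x))).
  { destruct HC as [A1 A2]. split; intros; rewrite clamp_id; auto. }
  split; [eapply C11_deriv_on; eauto|split; [|split; [|split; [|auto]]]].
  - intros x _. assert (Hcz : cont_on c d Z) by (eapply cont_on_lipschitz, C11_deriv_lipschitz, HC).
    apply cont_on_clamp in Hcz; [|lra]. apply Hcz.
  - eapply AC_on_lipschitz, C11_deriv_lipschitz, HC'.
  - apply ae_in_on. revert HD. apply ae_in_impl. intros x Hx HDx.
    exists (rhs p q x (x * Z x - V x)). split.
    + apply (derivable_pt_lim_local Z _ c d); auto. intros y Hy. rewrite clamp_id; auto; lra.
    + rewrite clamp_id by lra. rewrite rhs_Hfun. lra.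
Qed.

(** A nonnegative second derivative makes [Z] nondecreasing, so the graph lies above its tangents;
    weighting the tangent inequalities at the intermediate point yields convexity. *)
Lemma solves_convex c d h K V Z : c < d ->
  (forall x w, c <= x <= d -> 0 <= h x w) -> solves c d h K V Z -> convex_on c d V.
Proof.
  intros Hcd Hh [HC [N [HN HD]]].
  assert (HZ : forall x y, c <= x <= y -> y <= d -> Z x <= Z y).
  { intros x y Hx Hy. apply (AC_nondecreasing x y Z N); auto; [lra| |].
    - apply AC_on_sub with c d; try lra. eapply AC_on_lipschitz, C11_deriv_lipschitz, HC.
    - intros t Ht HNt. eexists. split; [apply HD; auto; lra|apply Hh; lra]. }
  assert (AV : forall x y, c <= x -> y <= d -> AC_on x y V).
  { intros x y Hx Hy. apply AC_on_sub with c d; try lra.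
    eapply AC_on_lipschitz, C11_lipschitz, HC. }
  assert (ALin : forall s x y, AC_on x y (fun t => s * t)).
  { intros s x y. apply AC_on_lipschitz with (Rabs s). intros u v _ _.
    replace (s * u - s * v) with (s * (u - v)) by ring. rewrite Rabs_mult. lra. }
  assert (Htan : forall x y, c <= x <= d -> c <= y <= d -> V x + Z x * (y - x) <= V y).
  { intros x y Hx Hy. destruct (Rle_lt_dec x y) as [Hxy|Hxy].
    - assert (Z x * y - Z x * x <= V y - V x); [|lra].
      apply (AC_deriv_le x y (fun t => Z x * t) V N); auto; [apply AV; lra|].
      intros t Ht _. exists (Z x), (Z t). split; [apply derivable_pt_lim_linear|].
      split; [eapply C11_derivable; eauto; lra|apply HZ; lra].
    - assert (V x - V y <= Z x * x - Z x * y); [|lra].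
      apply (AC_deriv_le y x V (fun t => Z x * t) N); auto; [lra|apply AV; lra|].
      intros t Ht _. exists (Z t), (Z x). split; [eapply C11_derivable; eauto; lra|].
      split; [apply derivable_pt_lim_linear|apply HZ; lra]. }
  intros x y t Hx Hy Ht. set (z := t * x + (1 - t) * y).
  assert (Hz : c <= z <= d) by (unfold z; split; nra).
  pose proof (Htan z x Hz Hx) as A1. pose proof (Htan z y Hz Hy) as A2.
  apply (Rmult_le_compat_l t) in A1; [|lra]. apply (Rmult_le_compat_l (1 - t)) in A2; [|lra].
  assert (E : t * (V z + Z z * (x - z)) + (1 - t) * (V z + Z z * (y - z)) = V z)
    by (unfold z at 3 6; ring).
  lra.
Qed.

Lemma liminf_left_ge_opp (f : R -> R) y :
  limsup_right_le f (- y) (f (- y)) -> liminf_left_ge (fun z => - f (- z)) y (- f (- y)).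
Proof.
  intros H eps He. destruct (H eps He) as [del [Hd Hf]]. exists del. split; auto.
  intros z Hz. specialize (Hf (- z) ltac:(lra)). lra.
Qed.

Lemma limsup_right_le_opp (f : R -> R) y :
  liminf_left_ge f (- y) (f (- y)) -> limsup_right_le (fun z => - f (- z)) y (- f (- y)).
Proof.
  intros H eps He. destruct (H eps He) as [del [Hd Hf]]. exists del. split; auto.
  intros z Hz. specialize (Hf (- z) ltac:(lra)). lra.
Qed.

Lemma in_order_interval_opp c d al be g :
  in_order_interval c d (fun x => - be x) (fun x => - al x) g ->
  in_order_interval c d al be (fun x => - g x).
Proof.
  intros [A I]. split; [apply AC_on_opp; auto|]. intros x Hx. specialize (I x Hx). lra.
Qed.

Lemma in_E_opp c d al be y :
  in_E c d (fun x => - be x) (fun x => - al x) y -> in_E c d al be (- y).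
Proof.
  intros [[x [Hx Hx']] [z [Hz Hz']]]. split; [exists z|exists x]; split; auto; lra.
Qed.

Theorem theorem4 (c d : R) (p q : R -> R) (B1 B2 : R -> (R -> R) -> R)
  (al be : R -> R) :
  0 < c -> c < d ->
  (forall x, c <= x <= d -> 0 <= p x) -> (forall x, c <= x <= d -> 0 <= q x) ->
  bounded_on c d p -> bounded_on c d q ->
  measurable_on c d p -> measurable_on c d q ->
  is_lower_solution c d p q B1 B2 al ->
  is_upper_solution c d p q B1 B2 be ->
  (forall x, c <= x <= d -> al x <= be x) ->
  (* (H1) *)
  (forall g y, in_order_interval c d al be g -> in_E c d al be y ->
     liminf_left_ge (fun z => B1 z g) y (B1 y g) /\
     limsup_right_le (fun z => B1 z g) y (B1 y g) /\
     liminf_left_ge (fun z => B2 z g) y (B2 y g) /\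
     limsup_right_le (fun z => B2 z g) y (B2 y g)) ->
  (* (H2) *)
  (forall y g1 g2, in_E c d al be y ->
     in_order_interval c d al be g1 -> in_order_interval c d al be g2 ->
     (forall x, c <= x <= d -> g1 x <= g2 x) ->
     B1 y g2 <= B1 y g1 /\ B2 y g2 <= B2 y g1) ->
  exists Vl Vu : R -> R,
    convex_on c d Vl /\ convex_on c d Vu /\
    in_order_interval c d al be Vl /\ in_order_interval c d al be Vu /\
    is_solution c d p q B1 B2 Vl /\ is_solution c d p q B1 B2 Vu /\
    forall V, in_order_interval c d al be V -> is_solution c d p q B1 B2 V ->
      forall x, c <= x <= d -> Vl x <= V x <= Vu x.
Proof.
  intros Hc Hcd Hp Hq _ [Q HQ] Mp Mq (Aal & Bal1 & Bal2 & Lal) (Abe & Bbe1 & Bbe2 & Lbe)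
    Hab H1 H2.
  assert (Hq' : forall x, c <= x <= d -> 0 <= q x <= Q).
  { intros x Hx. split; auto. specialize (HQ x Hx). pose proof (Rle_abs (q x)). lra. }
  pose proof (rhs_admissible c d Q p q Hc Hcd Hp Hq' Mp Mq) as Hadm.
  assert (Hrhs : forall x w, c <= x <= d -> 0 <= rhs p q x w).
  { intros x w Hx. apply rhs_nonneg; auto; lra. }
  destruct (greatest_solution c d (rhs p q) B1 B2 al be) as (Vu & Zu & Ku & Su & Iu & Eu1 & Eu2 & Gu);
    auto.
  { split; [auto|split; [auto|split; [auto|]]]. intros x0 Hx0. apply lower_at_W21, Lal, Hx0. }
  { intros x0 Hx0. apply lower_at_opp_W21, Lbe, Hx0. }
  (* Negating arguments and value preserves both hypotheses: monotonicity is reversed twice, and the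
     change of side in the first argument is matched by the exchange of lower and upper limits. *)
  pose (B1' := fun y (g : R -> R) => - B1 (- y) (fun x => - g x)).
  pose (B2' := fun y (g : R -> R) => - B2 (- y) (fun x => - g x)).
  destruct (greatest_solution c d (reflect (rhs p q)) B1' B2' (fun x => - be x) (fun x => - al x))
    as (Vl & Zl & Kl & Sl & Il & El1 & El2 & Gl); auto.
  { apply admissible_reflect; auto. }
  { split; [apply AC_on_opp; auto|]. unfold B1', B2'.
    rewrite !Ropp_involutive, opp_involutive_fun. split; [lra|split; [lra|]].
    intros x0 Hx0. apply lower_at_opp_W21, Lbe, Hx0. }
  { apply AC_on_opp; auto. }
  { unfold B1'. rewrite !Ropp_involutive, opp_involutive_fun. lra. }
  { unfold B2'. rewrite !Ropp_involutive, opp_involutive_fun. lra. }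
  { intros x0 Hx0. rewrite reflect_involutive, opp_involutive_fun. apply lower_at_W21, Lal, Hx0. }
  { intros x Hx. specialize (Hab x Hx). lra. }
  { intros g y Ig Ey. apply in_order_interval_opp in Ig. apply in_E_opp in Ey.
    destruct (H1 _ _ Ig Ey) as (L1 & R1 & L2 & R2). unfold B1', B2'. split; [|split; [|split]].
    - apply (liminf_left_ge_opp (fun z => B1 z (fun x => - g x))); auto.
    - apply (limsup_right_le_opp (fun z => B1 z (fun x => - g x))); auto.
    - apply (liminf_left_ge_opp (fun z => B2 z (fun x => - g x))); auto.
    - apply (limsup_right_le_opp (fun z => B2 z (fun x => - g x))); auto. }
  { intros y g1 g2 Ey I1 I2 Hle. apply in_order_interval_opp in I1.
    apply in_order_interval_opp in I2. apply in_E_opp in Ey. unfold B1', B2'.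
    destruct (H2 _ _ _ Ey I2 I1) as [A1 A2]; [|lra].
    intros x Hx. specialize (Hle x Hx). lra. }
  apply solves_reflect in Sl.
  exists (fun x => - Vl x), Vu.
  split; [eapply solves_convex; eauto|split; [eapply solves_convex; eauto|]].
  split; [apply in_order_interval_opp; auto|split; [auto|]].
  split; [|split; [eapply solves_is_solution; eauto|]].
  { eapply solves_is_solution; eauto; unfold B1', B2' in *; lra. }
  intros V IV SV x Hx.
  assert (BV : B1 (V c) V = 0 /\ B2 (V d) V = 0)
    by (destruct SV as (V' & _ & _ & _ & _ & E1 & E2); auto).
  destruct IV as [AV IV]. split.
  (* [- V] is a lower solution of the reflected problem, whose greatest solution is [Vl]. *)
  - assert (- V x <= Vl x); [|lra].
    apply (Gl (fun x => - V x)); auto.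
    + split; [apply AC_on_opp; auto|]. intros y Hy. specialize (IV y Hy). lra.
    + split; [apply AC_on_opp; auto|]. unfold B1', B2'.
      rewrite !Ropp_involutive, opp_involutive_fun. split; [lra|split; [lra|]].
      intros x0 Hx0. apply lower_at_opp_W21. right. exists c, d.
      split; [lra|split; [lra|]]. eapply is_solution_W21; eauto.
  - apply Gu; auto.
    + split; auto.
    + split; [auto|split; [lra|split; [lra|]]].
      intros x0 Hx0. apply lower_at_W21. right. exists c, d.
      split; [lra|split; [lra|]]. eapply is_solution_W21; eauto.
Qed.
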